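(* Let $p\ge7$ be a prime with $p\equiv3\pmod4$ and let $k=\frac{p+1}{2}$. Then $$P[\mathscr{C}_k\theta_{\mathbb{Z}}](j)\equiv\prod_{\mathcal{E}}(j-j(\mathcal{E}))\mod p,$$ where the product is over the elliptic curves $\mathcal{E}$ defined over $\mathbb{F}_p$, up to $\overline{\mathbb{F}}_p$-isomorphism, with $|\mathcal{E}(\mathbb{F}_p)[2]|=|\mathcal{E}(\mathbb{F}_p)[4]|=4$ (that is, with full rational $2$-torsion and no rational points of order $4$) and with $j(\mathcal{E})\ne0,1728$ in $\mathbb{F}_p$. (Each $\overline{\mathbb{F}}_p$-isomorphism class containing such a curve contributes exactly one factor.)
   Context: $M_k$ is the $\mathbb{Q}$-vector space of modular forms of weight $k$ for $\mathrm{SL}_2(\mathbb{Z})$ with rational $q$-expansion, $q=e^{2\pi i\tau}$. $E_k=1-\frac{2k}{B_k}\sum_{n\ge1}\bigl(\sum_{d\mid n}d^{k-1}\bigr)q^n$ is the Eisenstein series, $\Delta=\frac{1}{1728}(E_4^3-E_6^2)=q\prod_{n\ge1}(1-q^n)^{24}$, and $j=E_4^3/\Delta$. Every even $k\ge4$ is written uniquely as $k=12n_k+4a_k+6b_k$ with $n_k\in\mathbb{Z}_{\ge0}$, $a_k\in\{0,1,2\}$, $b_k\in\{0,1\}$. For $f\in M_k$, $P[f]\in\mathbb{Q}[j]$ is the unique polynomial (of degree $\le n_k$) with $\frac{f(\tau)}{\Delta(\tau)^{n_k}E_4(\tau)^{a_k}E_6(\tau)^{b_k}}=P[f](j(\tau))$.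 For a power series $f(q)$ and even $k\ge4$, $\mathscr{C}_kf$ is the unique modular form of weight $k$ for $\mathrm{SL}_2(\mathbb{Z})$ with $\mathscr{C}_kf-f=\mathcal{O}(q^{n_k+1})$. The Jacobi theta series is $\theta_{\mathbb{Z}}=\sum_{n\in\mathbb{Z}}q^{n^2}$; $P[\mathscr{C}_k\theta_{\mathbb{Z}}]$ has integer coefficients, so it can be reduced modulo $p$. An elliptic curve over $\mathbb{F}_p$ ($p\ge 7$) is given by $Y^2=X^3+aX+b$ with $a,b\in\mathbb{F}_p$ and $4a^3+27b^2\ne0$; $\mathcal{E}(\mathbb{F}_p)$ is its group of $\mathbb{F}_p$-rational points, $\mathcal{E}(\mathbb{F}_p)[n]$ the $n$-torsion subgroup of $\mathcal{E}(\mathbb{F}_p)$, and $j(\mathcal{E})$ its $j$-invariant (normalized with $j=1728$ for $b=0$). *)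

(* Defs.v *)
From HB Require Import structures.
From mathcomp Require Import all_boot all_order all_algebra.
From mathcomp Require Import complex.
From mathcomp Require Import all_classical all_reals all_analysis.
Import Order.TTheory GRing.Theory Num.Theory.
Import numFieldNormedType.Exports.

Set Implicit Arguments.
Unset Strict Implicit.
Unset Printing Implicit Defensive.

Local Open Scope classical_set_scope.
Local Open Scope ring_scope.
Local Open Scope complex_scope.

(* The usual topology of the complex numbers: R[i] normed over itself. *)
HB.instance Definition _ (R : rcfType) := PseudoPointedMetric.copy R[i] R[i]^o.
HB.instance Definition _ (R : rcfType) := NormedModule.copy R[i] R[i]^o.

(* Bernoulli numbers, from \sum_(j <= m) 'C(m+1, j) B_j = [m = 0]; the
   sequence [bernoulli_seq m] is B_0, ..., B_(m-1). *)
Fixpoint bernoulli_seq (m : nat) : seq rat :=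
  if m is m'.+1 then
    let s := bernoulli_seq m' in
    rcons s (((m' == 0%N)%:R - \sum_(j < m') 'C(m'.+1, j)%:R * s`_j)
             / m'.+1%:R)
  else [::].

Definition bernoulli (m : nat) : rat := (bernoulli_seq m.+1)`_m.

Definition sigma (r n : nat) : nat := \sum_(d <- divisors n) d ^ r.

Definition eisenstein_coef (k n : nat) : rat :=
  if n == 0%N then 1
  else - (k.*2%:R / bernoulli k) * (sigma k.-1 n)%:R.

(* The coefficient of q^n in \sum_(m in Z) q^(m^2): the number of integers m,
   necessarily in [-n, n], with m^2 = n; here m = i - n. *)
Definition theta_coef (n : nat) : nat :=
  #|[set i : 'I_(n.*2.+1) | ((i : nat)%:Z - n%:Z) ^+ 2 == n%:Z]|.

Section ModularForms.
Variable R : realType.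
Implicit Types (tau : R[i]) (f : R[i] -> R[i]) (c t : nat -> R[i]).

Definition upper_half_plane : set R[i] := [set tau | 0 < complex.Im tau].

(* q = exp (2 pi i tau) *)
Definition nome tau : R[i] :=
  let x := pi *+ 2 * complex.Re tau in
  (expR (- (pi *+ 2 * complex.Im tau)))%:C * (cos x +i* sin x).

Definition qterm c tau : nat -> R[i] := fun n => c n * nome tau ^+ n.

Definition has_qexpansion f c : Prop :=
  forall tau, upper_half_plane tau ->
    series (qterm c tau) @ \oo --> f tau.

Definition modular_form (k : nat) f : Prop :=
  [/\ forall tau, upper_half_plane tau -> derivable f tau 1,
      forall a b c d : int, a * d - b * c = 1 ->
        forall tau, upper_half_plane tau ->
          f ((a%:~R * tau + b%:~R) / (c%:~R * tau + d%:~R))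
            = (c%:~R * tau + d%:~R) ^+ k * f tau
    & exists c, has_qexpansion f c].

Definition eisenstein (k : nat) tau : R[i] :=
  limn (series (qterm (fun n => ratr (eisenstein_coef k n)) tau)).

Definition Delta tau : R[i] :=
  (eisenstein 4 tau ^+ 3 - eisenstein 6 tau ^+ 2) / 1728%:R.

Definition klein_j tau : R[i] := eisenstein 4 tau ^+ 3 / Delta tau.

Definition weight_decomposition (k n a b : nat) : Prop :=
  [/\ k = (12 * n + 4 * a + 6 * b)%N, (a <= 2)%N & (b <= 1)%N].

(* [f] is \mathscr{C}_k applied to the formal power series with coefficients
   [t]. *)
Definition is_C (k : nat) t f : Prop :=
  modular_form k f /\
  exists2 c, has_qexpansion f c &
    forall n a b, weight_decomposition k n a b ->
      forall m, (m <= n)%N -> c m = t m.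

(* [P] is P[f] for [f] of weight [k]. The identity is one of meromorphic
   functions, hence is only required off the zeros of the denominator (recall
   that x / 0 = 0 here). *)
Definition is_P (k : nat) f (P : {poly rat}) : Prop :=
  forall n a b, weight_decomposition k n a b ->
    (size P <= n.+1)%N /\
    forall tau, upper_half_plane tau ->
      let den := Delta tau ^+ n * eisenstein 4 tau ^+ a
                 * eisenstein 6 tau ^+ b in
      den != 0 -> f tau / den = (map_poly ratr P).[klein_j tau].

End ModularForms.

Section EllipticCurves.
Variable F : finFieldType.

(* [(a, b)] stands for Y^2 = X^3 + a X + b. *)
Definition weierstrass : Type := (F * F)%type.
HB.instance Definition _ := Finite.on weierstrass.

Implicit Types E : weierstrass.

Definition nonsingular E : bool := 4%:R * E.1 ^+ 3 + 27%:R * E.2 ^+ 2 != 0.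

Definition j_invariant E : F :=
  1728%:R * (4%:R * E.1 ^+ 3) / (4%:R * E.1 ^+ 3 + 27%:R * E.2 ^+ 2).

(* [None] is the point at infinity. *)
Definition point : Type := option (F * F).
HB.instance Definition _ := Finite.on point.

Definition on_curve E (P : point) : bool :=
  if P is Some (x, y) then y ^+ 2 == x ^+ 3 + E.1 * x + E.2 else true.

(* The chord-and-tangent law. *)
Definition add_point E (P Q : point) : point :=
  match P, Q with
  | None, _ => Q
  | _, None => P
  | Some (x1, y1), Some (x2, y2) =>
    if (x1 == x2) && (y1 == - y2) then None else
    let l := if x1 == x2 then (3%:R * x1 ^+ 2 + E.1) / (2%:R * y1)
             else (y2 - y1) / (x2 - x1) in
    let x3 := l ^+ 2 - x1 - x2 in
    Some (x3, l * (x1 - x3) - y1)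
  end.

Definition torsion E (n : nat) : {set point} :=
  [set P : point | on_curve E P & iter n (add_point E P) None == None].

Definition admissible : {set weierstrass} :=
  [set E : weierstrass | [&& nonsingular E, #|torsion E 2| == 4%N,
    #|torsion E 4| == 4%N, j_invariant E != 0 & j_invariant E != 1728%:R]].

(* Isomorphism over the extension [iota : F -> L], in characteristic other
   than 2 and 3: (x, y) |-> (u^2 x, u^3 y). *)
Definition isomorphic_over (L : fieldType) (iota : {rmorphism F -> L})
    E E' : bool :=
  `[< exists u : L, [/\ u != 0, iota E'.1 = u ^+ 4 * iota E.1
                     & iota E'.2 = u ^+ 6 * iota E.2] >].

End EllipticCurves.

(* Main.v *)
(* Only the q-expansion of f up to q^n matters. As q -> 0 the identity
   f = sum_i P_i E4^(3i+a) Delta^(n-i) E6^b gives a unitriangular integral system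
   for the coefficients P_i, so P is integral and its reduction is characterised
   by the congruence with theta modulo (p, q^(n+1)).

   Let T3, T4 be the fourth powers of theta(Q) and theta(-Q), q = Q^2, and
   T2 = T3 - T4. Then E4, E6 and Delta are polynomials in T3 and T4. Put
   k = (p+1)/2. Modulo p, 1 + X^k + (1-X)^k is twice the square of the product of
   X - l over the set Lam of l such that l and 1 - l are non-squares: these are
   double roots, and there are k/2 of them. At X = T2/T3, as
   T3^k = theta(Q)^(2p+2), this gives modulo Q^k
     2 (T3^(k/2) prod (T2/T3 - l))^2 = theta(Q)^2 + theta(-Q)^2 = 2 theta(q)^2.
   Grouping the l by the j-invariant of Y^2 = X (X-1) (X-l), which is 6-to-1 on
   Lam except over 0 and 1728, turns the left-hand factor into
   prod_j (E4^3 - j Delta) E4^a E6^b, with the j-invariants of the statement. *)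

Require Import Defs.
From HB Require Import structures.
From mathcomp Require Import all_boot all_order all_algebra.
From mathcomp Require Import complex.
From mathcomp Require Import all_classical all_reals all_analysis.
From mathcomp Require Import finfield ring lra zify.
Import Order.TTheory GRing.Theory Num.Theory.
Import numFieldNormedType.Exports.

Set Implicit Arguments.
Unset Strict Implicit.
Unset Printing Implicit Defensive.

(** No dimension formula for spaces of modular forms is used: the relations between theta series and
    Eisenstein series are identities of integer power series. Liouville's elementary identity yields
    Ramanujan's differential equations, Shanks' finite product yields the logarithmic derivative of
    $\theta(-Q)$, and the rest follows because certain differential equations and functional
    equations under $Q\mapsto Q^2$ have only one solution. Analysis serves only to turn the identity
    defining $P[f]$ into one between coefficients, along the imaginary axis near $q=0$. The
    decomposition $k=12n+4a+6b$ is not computed from $p$. Comparing degrees when the $l$ are grouped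
    by $j$ gives $k/2=6\,|J|+2a+3b$, where $J$ is the set of values $j\ne0,1728$ and the bits $a$,
    $b$ record whether 0 and 1728 are attained. So $n=|J|$, and the same monomials
    $E_4^{3i+a}\Delta^{n-i}E_6^b$ serve over $\mathbb{C}$ and over $\mathbb{F}_p$. A congruence
    modulo $Q^k$ controls the powers $q^i$ with $2i<k$, which covers all $i\le n$. *)

Local Open Scope ring_scope.

(** * Formal power series *)

(* Equality from linear combinations of hypotheses, the coefficients being
   supplied by the user and checked by [ring]. *)
Lemma lincomb1 (R : pzRingType) (c p q a b : R) :
  p = q -> a - b = c * (p - q) -> a = b.
Proof. by move=> -> /eqP; rewrite subrr mulr0 subr_eq0 => /eqP. Qed.
Lemma lincomb2 (R : pzRingType) (c c' p q p' q' a b : R) :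
  p = q -> p' = q' -> a - b = c * (p - q) + c' * (p' - q') -> a = b.
Proof. by move=> e -> h; apply: (lincomb1 e); rewrite h subrr mulr0 addr0. Qed.
Lemma lincomb3 (R : pzRingType) (c c' c'' p q p' q' p'' q'' a b : R) :
  p = q -> p' = q' -> p'' = q'' ->
  a - b = c * (p - q) + c' * (p' - q') + c'' * (p'' - q'') -> a = b.
Proof.
by move=> e e' -> h; apply: (lincomb2 e e'); rewrite h subrr mulr0 addr0.
Qed.
Lemma lincomb4 (R : pzRingType)
    (c c' c'' c3 p q p' q' p'' q'' p3 q3 a b : R) :
  p = q -> p' = q' -> p'' = q'' -> p3 = q3 ->
  a - b = c * (p - q) + c' * (p' - q') + c'' * (p'' - q'') + c3 * (p3 - q3) ->
  a = b.
Proof.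
by move=> e e' e'' -> h; apply: (lincomb3 e e' e''); rewrite h subrr mulr0 addr0.
Qed.

(** The wrapper keeps the convolution product apart from the pointwise structure on functions. *)
Record fps (R : Type) := Fps { fps_coef :> nat -> R }.

HB.instance Definition _ (R : Type) := gen_eqMixin (fps R).
HB.instance Definition _ (R : Type) := gen_choiceMixin (fps R).

Lemma fpsP (R : Type) (x y : fps R) : (forall i, x i = y i) -> x = y.
Proof. by case: x y => [x] [y] /= e; congr Fps; apply/funext. Qed.

Section FpsRing.
Variable R : comNzRingType.
Implicit Types x y z : fps R.

Definition fps_add x y := Fps (fun i => x i + y i).
Definition fps_opp x := Fps (fun i => - x i).
Definition fps_mul x y := Fps (fun n => \sum_(i < n.+1) x i * y (n - i)%N).

Fact fps_addA : associative fps_add.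
Proof. by move=> x y z; apply: fpsP => i /=; rewrite addrA. Qed.
Fact fps_addC : commutative fps_add.
Proof. by move=> x y; apply: fpsP => i /=; rewrite addrC. Qed.
Fact fps_add0 : left_id (Fps (fun=> 0)) fps_add.
Proof. by move=> x; apply: fpsP => i /=; rewrite add0r. Qed.
Fact fps_addN : left_inverse (Fps (fun=> 0)) fps_opp fps_add.
Proof. by move=> x; apply: fpsP => i /=; rewrite addNr. Qed.

HB.instance Definition _ :=
  GRing.isZmodule.Build (fps R) fps_addA fps_addC fps_add0 fps_addN.

(* Ring identities on series are checked on their truncations. *)
Definition fps_trunc n x : {poly R} := \poly_(i < n.+1) x i.
Definition fps_poly (p : {poly R}) : fps R := Fps (fun i => p`_i).

Lemma coef_fps_trunc n x i : (i <= n)%N -> (fps_trunc n x)`_i = x i.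
Proof. by rewrite coef_poly ltnS => ->. Qed.

(** A coefficient of index at most $n$ of a product only sees coefficients of index at most $n$, so
    the ring axioms descend from polynomials. *)
Lemma fps_mul_poly n x y (p q : {poly R}) :
    (forall i, (i <= n)%N -> p`_i = x i) ->
    (forall i, (i <= n)%N -> q`_i = y i) ->
  forall i, (i <= n)%N -> (p * q)`_i = fps_mul x y i.
Proof.
move=> ep eq i lein; rewrite coefM; apply: eq_bigr => j _.
by rewrite ep ?eq //; [apply: leq_trans lein; rewrite leq_subr
  | apply: leq_trans lein; rewrite -ltnS].
Qed.

Fact fps_mulA : associative fps_mul.
Proof.
move=> x y z; apply: fpsP => n.
have t u := @coef_fps_trunc n u; have m := @fps_mul_poly n.
rewrite -(m _ _ _ _ (t x) (m _ _ _ _ (t y) (t z))) // mulrA.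
by rewrite (m _ _ _ _ (m _ _ _ _ (t x) (t y)) (t z)).
Qed.
Fact fps_mulC : commutative fps_mul.
Proof.
move=> x y; apply: fpsP => n.
have t u := @coef_fps_trunc n u; have m := @fps_mul_poly n.
by rewrite -(m _ _ _ _ (t x) (t y)) // mulrC (m _ _ _ _ (t y) (t x)).
Qed.
Fact fps_mul1 : left_id (fps_poly 1) fps_mul.
Proof.
move=> x; apply: fpsP => n; have t u := @coef_fps_trunc n u.
by rewrite -(@fps_mul_poly n _ _ 1 _ _ (t x)) // mul1r t.
Qed.
Fact fps_mulD : left_distributive fps_mul fps_add.
Proof.
move=> x y z; apply: fpsP => n /=; rewrite -big_split /=.
by apply: eq_bigr => i _; rewrite mulrDl.
Qed.
Fact fps_1neq0 : fps_poly 1 != 0 :> fps R.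
Proof.
apply/eqP => /(congr1 (fun x : fps R => x 0%N)) /= /eqP.
by rewrite coef1 oner_eq0.
Qed.

HB.instance Definition _ := GRing.Zmodule_isComNzRing.Build (fps R)
  fps_mulA fps_mulC fps_mul1 fps_mulD fps_1neq0.

Lemma fpsE1 i : (1 : fps R) i = (i == 0%N)%:R. Proof. exact: coef1. Qed.
Lemma fpsED x y i : (x + y) i = x i + y i. Proof. by []. Qed.
Lemma fpsEN x i : (- x) i = - x i. Proof. by []. Qed.
Lemma fpsEB x y i : (x - y) i = x i - y i. Proof. by []. Qed.
Lemma fpsEM x y n : (x * y) n = \sum_(i < n.+1) x i * y (n - i)%N.
Proof. by []. Qed.
Lemma fpsEMn x n i : (x *+ n) i = x i *+ n.
Proof. by elim: n => // n ih; rewrite !mulrS fpsED ih. Qed.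
Lemma fpsE_sum I (r : seq I) (P : pred I) (F : I -> fps R) i :
  (\sum_(j <- r | P j) F j) i = \sum_(j <- r | P j) F j i.
Proof. by elim/big_rec2: _ => // j y x _ <-. Qed.
Lemma fpsEM0 x y : (x * y) 0%N = x 0%N * y 0%N.
Proof. by rewrite fpsEM big_ord1. Qed.
Lemma fpsEX0 x n : (x ^+ n) 0%N = x 0%N ^+ n.
Proof. by elim: n => [|n ih]; rewrite ?fpsE1 // !exprS fpsEM0 ih. Qed.
Lemma fpsE_prod0 I (r : seq I) (P : pred I) (F : I -> fps R) :
  (\prod_(j <- r | P j) F j) 0%N = \prod_(j <- r | P j) F j 0%N.
Proof.
by elim/big_rec2: _ => [|j y x _ <-]; rewrite ?fpsE1 ?fpsEM0.
Qed.
Lemma fpsEMnl n x i : (n%:R * x) i = n%:R * x i.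
Proof. by rewrite mulr_natl fpsEMn mulr_natl. Qed.
Lemma fpsE_nat n i : (n%:R : fps R) i = if i == 0%N then n%:R else 0.
Proof. by rewrite fpsEMn fpsE1; case: eqP => //= _; rewrite mul0rn. Qed.

Fact fps_poly_additive : {morph fps_poly : p q / p - q}.
Proof. by move=> p q; apply: fpsP => i /=; rewrite coefB. Qed.
HB.instance Definition _ :=
  GRing.isZmodMorphism.Build {poly R} (fps R) fps_poly fps_poly_additive.
Fact fps_poly_mul : monoid_morphism fps_poly.
Proof.
split=> // p q; apply: fpsP => n.
by rewrite -(@fps_mul_poly n _ _ p q).
Qed.
HB.instance Definition _ :=
  GRing.isMonoidMorphism.Build {poly R} (fps R) fps_poly fps_poly_mul.

Definition fpsX k := fps_poly 'X^k.
Definition fpsC c := fps_poly c%:P.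
Fact fpsC_additive : {morph fpsC : a b / a - b}.
Proof. by move=> a b; rewrite /fpsC !rmorphB. Qed.
HB.instance Definition _ :=
  GRing.isZmodMorphism.Build R (fps R) fpsC fpsC_additive.
Fact fpsC_mul : monoid_morphism fpsC.
Proof. by split=> [|a b]; rewrite /fpsC ?rmorph1 // !rmorphM. Qed.
HB.instance Definition _ :=
  GRing.isMonoidMorphism.Build R (fps R) fpsC fpsC_mul.

Lemma fpsE_X k i : fpsX k i = (i == k)%:R. Proof. exact: coefXn. Qed.
Lemma fpsE_C c i : fpsC c i = if i == 0%N then c else 0. Proof. exact: coefC. Qed.
Lemma fpsXD i j : fpsX (i + j) = fpsX i * fpsX j.
Proof. by rewrite /fpsX exprD rmorphM. Qed.
Lemma fpsXM i n : fpsX (i * n) = fpsX i ^+ n.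
Proof. by rewrite /fpsX exprM rmorphXn. Qed.
Lemma fpsE_XM k x n : (fpsX k * x) n = if (n < k)%N then 0 else x (n - k)%N.
Proof.
have t u := @coef_fps_trunc n u.
rewrite -(@fps_mul_poly n _ _ 'X^k _ _ (t x)) // coefXnM.
by case: ifP => // _; rewrite t // leq_subr.
Qed.
Lemma fpsE_CM c x n : (fpsC c * x) n = c * x n.
Proof.
have t u := @coef_fps_trunc n u.
by rewrite -(@fps_mul_poly n _ _ c%:P _ _ (t x)) // coefCM t.
Qed.

(** The operator $Q\,d/dQ$ rather than $d/dQ$: it preserves the order of vanishing and is the one in
    Ramanujan's equations. *)
Definition fps_deriv x := Fps (fun n => n%:R * x n).
Fact fps_deriv_additive : {morph fps_deriv : x y / x - y}.
Proof. by move=> x y; apply: fpsP => i /=; rewrite mulrBr. Qed.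
HB.instance Definition _ :=
  GRing.isZmodMorphism.Build (fps R) (fps R) fps_deriv fps_deriv_additive.
Lemma fpsE_deriv x n : fps_deriv x n = n%:R * x n. Proof. by []. Qed.
Lemma fps_derivB x y : fps_deriv (x - y) = fps_deriv x - fps_deriv y.
Proof. exact: raddfB. Qed.
Lemma fps_derivD x y : fps_deriv (x + y) = fps_deriv x + fps_deriv y.
Proof. exact: raddfD. Qed.
Lemma fps_derivM x y :
  fps_deriv (x * y) = fps_deriv x * y + x * fps_deriv y.
Proof.
apply: fpsP => n; rewrite fpsED !fpsEM /= mulr_sumr -big_split /=.
apply: eq_bigr => i _; have /subnKC e : (i <= n)%N by rewrite -ltnS.
by rewrite -[in n%:R]e natrD; ring.
Qed.
Lemma fps_deriv1 : fps_deriv 1 = 0.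
Proof. by apply: fpsP => -[|n] /=; rewrite ?mul0r // coef1 mulr0. Qed.
Lemma fps_deriv_nat n : fps_deriv n%:R = 0.
Proof. by rewrite raddfMn /= fps_deriv1 mul0rn. Qed.
Lemma fps_derivMn n x : fps_deriv (n%:R * x) = n%:R * fps_deriv x.
Proof. by rewrite fps_derivM fps_deriv_nat mul0r add0r. Qed.
Lemma fps_derivX k : fps_deriv (fpsX k) = k%:R * fpsX k.
Proof.
apply: fpsP => i; rewrite fpsEMnl /= coefXn.
by case: eqP => [->//|_]; rewrite !mulr0.
Qed.

(** The substitution $Q\mapsto Q^2$; a series in $q$ becomes a series in $Q$ through it. *)
Definition fps_dbl x := Fps (fun n => if (2 %| n)%N then x (n %/ 2)%N else 0).
Fact fps_dbl_additive : {morph fps_dbl : x y / x - y}.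
Proof. by move=> x y; apply: fpsP => i /=; case: ifP => // _; rewrite subr0. Qed.
HB.instance Definition _ :=
  GRing.isZmodMorphism.Build (fps R) (fps R) fps_dbl fps_dbl_additive.
Lemma fps_dbl_trunc n x i :
  (i <= n)%N -> (fps_trunc n x \Po 'X^2)`_i = fps_dbl x i.
Proof.
move=> lein; rewrite coef_comp_poly_Xn //=; case: ifP => // _.
by rewrite coef_fps_trunc // (leq_trans _ lein) // leq_div.
Qed.
Fact fps_dbl_mul : monoid_morphism fps_dbl.
Proof.
split=> [|x y]; apply: fpsP => n.
  by rewrite /= !coef1; case: ifP => h; [congr (nat_of_bool _)%:R; lia | case: n h].
have t u := @fps_dbl_trunc n u; have t' u := @coef_fps_trunc (n %/ 2) u.
rewrite -[RHS](fps_mul_poly (t x) (t y)) // -rmorphM coef_comp_poly_Xn //.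
rewrite [LHS]/=; case: ifP => // _.
by rewrite (@fps_mul_poly n x y) ?leq_div // => i le; rewrite coef_fps_trunc.
Qed.
HB.instance Definition _ :=
  GRing.isMonoidMorphism.Build (fps R) (fps R) fps_dbl fps_dbl_mul.
Lemma fps_deriv_dbl x : fps_deriv (fps_dbl x) = 2%:R * fps_dbl (fps_deriv x).
Proof.
apply: fpsP => n; rewrite fpsEMnl /=; case: ifP => [h|_]; last by rewrite !mulr0.
by rewrite mulrA -natrM mulnC divnK.
Qed.
Lemma fpsE_dbl x n :
  fps_dbl x n = if (2 %| n)%N then x (n %/ 2)%N else 0.
Proof. by []. Qed.
Lemma fps_dbl0 x : fps_dbl x 0%N = x 0%N. Proof. by []. Qed.

Lemma fps_dblC c : fps_dbl (fpsC c) = fpsC c.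
Proof.
apply: fpsP => -[|n]; rewrite fpsE_dbl !fpsE_C //=.
by case: ifP => // d; case: eqP => // e; move: d; rewrite dvdn_eq e.
Qed.

Definition fps_flip x := Fps (fun n => (-1) ^+ n * x n).
Fact fps_flip_additive : {morph fps_flip : x y / x - y}.
Proof. by move=> x y; apply: fpsP => i /=; rewrite mulrBr. Qed.
HB.instance Definition _ :=
  GRing.isZmodMorphism.Build (fps R) (fps R) fps_flip fps_flip_additive.
Fact fps_flip_mul : monoid_morphism fps_flip.
Proof.
split=> [|x y]; apply: fpsP => n.
  by rewrite /= coef1; case: n => [|n]; rewrite ?mul1r // mulr0.
rewrite fpsEM /= mulr_sumr; apply: eq_bigr => i _.
have /subnKC e : (i <= n)%N by rewrite -ltnS.
by rewrite -[in (-1) ^+ n]e exprD; ring.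
Qed.
HB.instance Definition _ :=
  GRing.isMonoidMorphism.Build (fps R) (fps R) fps_flip fps_flip_mul.
Lemma fpsE_flip x n : fps_flip x n = (-1) ^+ n * x n. Proof. by []. Qed.
Lemma fps_deriv_flip x : fps_deriv (fps_flip x) = fps_flip (fps_deriv x).
Proof. by apply: fpsP => n /=; rewrite mulrCA. Qed.

Definition vanish N x := forall i, (i < N)%N -> x i = 0.

Lemma vanish_eq N x y : x = y -> vanish N x -> vanish N y.
Proof. by move=> ->. Qed.
Lemma vanish0 N : vanish N 0. Proof. by []. Qed.
Lemma vanishD N x y : vanish N x -> vanish N y -> vanish N (x + y).
Proof. by move=> hx hy i iN; rewrite fpsED hx // hy // addr0. Qed.
Lemma vanishN N x : vanish N x -> vanish N (- x).
Proof. by move=> hx i iN; rewrite fpsEN hx // oppr0. Qed.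
Lemma vanishB N x y : vanish N x -> vanish N y -> vanish N (x - y).
Proof. by move=> hx /vanishN; exact: vanishD. Qed.
Lemma vanish_sum N I (r : seq I) (P : pred I) (F : I -> fps R) :
  (forall i, P i -> vanish N (F i)) -> vanish N (\sum_(i <- r | P i) F i).
Proof. by move=> h; elim/big_ind: _ => // x y; exact: vanishD. Qed.
Lemma vanishM M N x y :
  vanish M x -> vanish N y -> vanish (M + N) (x * y).
Proof.
move=> hx hy n nMN; rewrite fpsEM big1 // => i _.
case: (ltnP i M) => [/hx -> | Mi]; first by rewrite mul0r.
by rewrite hy ?mulr0 //; have := ltn_ord i; lia.
Qed.
Lemma vanishMl N x y : vanish N y -> vanish N (x * y).
Proof. by move=> h; apply: (@vanishM 0 N). Qed.
Lemma vanishMr N x y : vanish N x -> vanish N (x * y).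
Proof. by rewrite mulrC; exact: vanishMl. Qed.
Lemma vanishW M N x : (M <= N)%N -> vanish N x -> vanish M x.
Proof. by move=> le h i iM; apply: h; apply: leq_trans le. Qed.
Lemma vanishX N k x : vanish N x -> vanish (k * N) (x ^+ k).
Proof.
move=> h; elim: k => [|k ih]; first by [].
by rewrite exprS mulSn; exact: vanishM.
Qed.
Lemma vanish_dbl N x : vanish N x -> vanish N (fps_dbl x).
Proof.
move=> h i iN /=; case: ifP => // _; apply: h.
exact: leq_ltn_trans (leq_div _ _) iN.
Qed.
Lemma vanish_flip N x : vanish N x -> vanish N (fps_flip x).
Proof. by move=> h i iN /=; rewrite h ?mulr0. Qed.
Lemma vanish_deriv N x : vanish N x -> vanish N (fps_deriv x).
Proof. by move=> h i iN /=; rewrite h ?mulr0. Qed.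
Lemma vanish_fpsX k : vanish k (fpsX k).
Proof. by move=> i ik; rewrite fpsE_X ltn_eqF. Qed.
Lemma vanish_eq0 x : (forall N, vanish N x) -> x = 0.
Proof. by move=> h; apply: fpsP => i; apply: (h i.+1). Qed.

(** The inverse is the geometric series in $u=1-x$. As $u^i=O(Q^i)$, coefficient $n$ is already
    final in the $n$-th partial sum, so the diagonal of the partial sums is the limit. *)
Lemma fps_unit x : x 0%N = 1 -> exists y, x * y = 1.
Proof.
move=> x0; pose u := 1 - x; pose Y n : fps R := \sum_(i < n.+1) u ^+ i.
have uX i : vanish i (u ^+ i).
  rewrite -[i in vanish i]muln1; apply: vanishX => -[|//] _.
  by rewrite fpsEB fpsE1 x0 subrr.
have YE m n : (m <= n)%N -> Y n m = Y m m.
  move=> mn; rewrite /Y -(subnK (mn : m.+1 <= n.+1)%N) addnC big_split_ord.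
  rewrite fpsED addrC (@vanish_sum m.+1) ?add0r // => i _ j jm.
  by apply: uX => /=; lia.
exists (Fps (fun n => Y n n)); apply: fpsP => n.
have -> : (x * Fps (fun n => Y n n)) n = (x * Y n) n.
  by rewrite !fpsEM; apply: eq_bigr => i _; rewrite YE // leq_subr.
have -> : x * Y n = 1 - u ^+ n.+1.
  have -> : x = 1 - u by rewrite /u; ring.
  rewrite -[X in _ = X - _](expr1n _ n.+1) subrXX; congr (_ * _).
  by apply: eq_bigr => i _; rewrite expr1n mul1r.
by rewrite fpsEB uX ?subr0.
Qed.

End FpsRing.

Section FpsDomain.
Variable R : idomainType.
Implicit Types x y : fps R.

Lemma vanish_cancel N x y : x 0%N != 0 -> vanish N (x * y) -> vanish N y.
Proof.
move=> x0 h n; elim/ltn_ind: n => n ih nN; have := h n nN.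
rewrite fpsEM big_ord_recl big1 ?addr0 => [|i _]; last first.
  by rewrite ih ?mulr0 //= /bump; have := ltn_ord i; lia.
by rewrite subn0 => /eqP; rewrite mulf_eq0 (negPf x0) => /eqP.
Qed.
Lemma fps_cancel x y : x 0%N != 0 -> x * y = 0 -> y = 0.
Proof.
move=> x0 xy; apply: vanish_eq0 => N; apply: (vanish_cancel x0).
by rewrite xy; apply: vanish0.
Qed.
Lemma fps_mulI x y z : x 0%N != 0 -> x * y = x * z -> y = z.
Proof.
move=> x0 e; apply/eqP; rewrite -subr_eq0; apply/eqP.
by apply: (fps_cancel x0); rewrite mulrBr e subrr.
Qed.
End FpsDomain.

Section FpsMap.
Variables (R S : comNzRingType) (f : {rmorphism R -> S}).
Definition fps_map (x : fps R) : fps S := Fps (fun n => f (x n)).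
Fact fps_map_additive : {morph fps_map : x y / x - y}.
Proof. by move=> x y; apply: fpsP => i /=; rewrite rmorphB. Qed.
HB.instance Definition _ :=
  GRing.isZmodMorphism.Build (fps R) (fps S) fps_map fps_map_additive.
Fact fps_map_mul : monoid_morphism fps_map.
Proof.
split=> [|x y]; apply: fpsP => n /=; first by rewrite !coef1 rmorph_nat.
by rewrite rmorph_sum; apply: eq_bigr => i _; rewrite rmorphM.
Qed.
HB.instance Definition _ :=
  GRing.isMonoidMorphism.Build (fps R) (fps S) fps_map fps_map_mul.
Lemma fpsE_map x n : fps_map x n = f (x n). Proof. by []. Qed.
Lemma fps_map_dbl x : fps_map (fps_dbl x) = fps_dbl (fps_map x).
Proof. by apply: fpsP => n /=; case: ifP => // _; rewrite rmorph0. Qed.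
Lemma fps_map_flip x : fps_map (fps_flip x) = fps_flip (fps_map x).
Proof. by apply: fpsP => n /=; rewrite rmorphM rmorph_sign. Qed.
Lemma fps_map_vanish N x : vanish N x -> vanish N (fps_map x).
Proof. by move=> h i iN /=; rewrite h ?rmorph0. Qed.
End FpsMap.

(** * Lambert series *)

Section Lambert.
Variable R : idomainType.
Local Notation D := (@fps_deriv R).

(* [lambert k] is Q^k / (1 - Q^k) for k > 0, and 0 for k = 0. *)
Definition lambert k : fps R := Fps (fun n => ((0 < n) && (k %| n))%N%:R).

Lemma vanish_lambert k : vanish k (lambert k).
Proof.
by move=> i ik /=; case: (posnP i) => //= i0; rewrite gtnNdvd.
Qed.
Lemma lambertE k : (0 < k)%N -> (1 - fpsX R k) * (1 + lambert k) = 1.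
Proof.
move=> k0; rewrite mulrBl mul1r; apply: fpsP => n.
rewrite fpsEB fpsE_XM !fpsED !fpsE1 /=.
case: (ltnP n k) => [nk|kn]; first by rewrite subr0; case: n nk => [|n] nk;
  rewrite ?addr0 //= gtnNdvd // addr0.
have -> /= : (0 < n)%N by lia.
rewrite [n == 0%N]gtn_eqF 1?add0r; last by lia.
have -> : (k %| n - k)%N = (k %| n)%N by rewrite dvdn_subl.
have := kn; rewrite leq_eqVlt => /predU1P[->|lt].
  by rewrite subnn dvdnn /= addr0 subrr.
by rewrite subn_gt0 lt subn_eq0 leqNgt lt /= add0r subrr.
Qed.
Lemma lambertMX k : (0 < k)%N -> lambert k * (1 - fpsX R k) = fpsX R k.
Proof. by move=> /lambertE e; apply: (lincomb1 (c := 1) e); ring. Qed.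

Lemma sub1X_neq0 k : (0 < k)%N -> (1 - fpsX R k) 0%N != 0.
Proof. by move=> k0; rewrite fpsEB fpsE1 fpsE_X (ltn_eqF k0) subr0 oner_neq0. Qed.

(** Partial fractions: with $u=Q^a$ and $v=Q^b$, both sides agree after multiplication by
    $(1-u)(1-v)(1-uv)$, whose factors can be cancelled. *)
Lemma lambertM a b : (0 < a)%N -> (0 < b)%N ->
  lambert a * lambert b = lambert (a + b) * (1 + lambert a + lambert b).
Proof.
move=> a0 b0; have ab0 : (0 < a + b)%N by rewrite addn_gt0 a0.
have ea := lambertMX a0; have eb := lambertMX b0; have := lambertMX ab0.
rewrite fpsXD => eab.
set u := fpsX R a in ea eab; set v := fpsX R b in eb eab.
have u0 := sub1X_neq0 a0.
have v0 := sub1X_neq0 b0.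
have := sub1X_neq0 ab0; rewrite fpsXD -/u -/v => uv0.
apply: (fps_mulI u0); apply: (fps_mulI v0); apply: (fps_mulI uv0).
apply: (lincomb3 (c := (1 - u * v) * (lambert b * (1 - v))
    - (1 - v) * lambert (a + b) * (1 - u * v))
  (c' := (1 - u * v) * u - (1 - u) * lambert (a + b) * (1 - u * v))
  (c'' := - ((1 - u) * (1 - v) + u * (1 - v) + (1 - u) * v)) ea eb eab).
ring.
Qed.
Lemma deriv_lambert k : (0 < k)%N ->
  D (lambert k) = k%:R * (lambert k + lambert k ^+ 2).
Proof.
move=> k0; have e := lambertMX k0.
have /(congr1 D) := e; rewrite fps_derivM raddfB /= fps_deriv1 fps_derivX => e'.
apply: (fps_mulI (sub1X_neq0 k0)).
apply: (lincomb2 (c := - k%:R * (1 + lambert k)) (c' := 1) e e').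
ring.
Qed.

Lemma big_triangle (V : nmodType) N (G : nat -> nat -> V) :
  \sum_(c < N) \sum_(b < c.+1) G (c - b)%N b =
  \sum_(a < N) \sum_(b < N - a) G a b.
Proof.
elim: N => [|N ih]; first by rewrite !big_ord0.
rewrite big_ord_recr /= ih.
have -> : \sum_(b < N.+1) G (N - b)%N b = \sum_(a < N.+1) G a (N - a)%N.
  rewrite (reindex_inj rev_ord_inj) /=; apply: eq_bigr => i _.
  by rewrite subSS subKn // -ltnS.
rewrite big_ord_recr [RHS]big_ord_recr /= addrA -big_split subnn subSnn big_ord1.
congr (_ + _); apply: eq_bigr => i _ /=.
by rewrite (subSn (ltnW (ltn_ord i))) big_ord_recr.
Qed.

Lemma big_square (V : comNzRingType) N (G : nat -> nat -> V) :
  \sum_(i < N) \sum_(j < N) G i j =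
  \sum_(i < N) G i i + \sum_(i < N) \sum_(j < i) (G i j + G j i).
Proof.
elim: N => [|N ih]; first by rewrite !big_ord0 addr0.
under eq_bigr => i _ do rewrite big_ord_recr /=.
by rewrite big_split /= !big_ord_recr /= ih !big_split /=; ring.
Qed.

Local Notation x i := (lambert i.+1).

(** The second sum groups the pairs by $a+b=i+1\le N$, with $b=j+1$. The pairs left out have
    $a+b>N$, and then $x_ax_b=O(Q^{N+1})$. *)
Lemma lambert_pairs N (G : nat -> nat -> fps R) :
  vanish N.+1 (\sum_(i < N) \sum_(j < N) G i j * (x i * x j)
    - \sum_(i < N) \sum_(j < i) G (i - j.+1)%N j * (x (i - j.+1)%N * x j)).
Proof.
case: N => [|N]; first by rewrite !big_ord0 subrr; exact: vanish0.
rewrite [X in _ - X]big_ord_recl big_ord0 add0r.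
have -> : \sum_(i < N) \sum_(j < bump 0 i)
    G (bump 0 i - j.+1)%N j * (x (bump 0 i - j.+1)%N * x j)
  = \sum_(i < N) \sum_(j < N - i) G i j * (x i * x j).
  by rewrite -(big_triangle _ (fun i j => G i j * (x i * x j))).
rewrite big_ord_recr addrAC -sumrB /=.
have tail i j : (N <= i + j)%N -> vanish N.+2 (G i j * (x i * x j)).
  move=> le; apply: vanishMl; apply: (vanishW (N := i.+1 + j.+1)); first lia.
  by apply: vanishM; apply: vanish_lambert.
apply: vanishD; apply: vanish_sum => i _; last by apply: (tail N i); lia.
have e := subnKC (leq_trans (leq_subr i N) (leqnSn N)).
rewrite -e big_split_ord /= e addrAC subrr add0r; apply: vanish_sum => j _; apply: tail => /=.
by have := ltn_ord i; lia.
Qed.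

(* Liouville's identity for
   \sum_(a, b >= 1) (F(|a - b|) - F(a + b)) x_a x_b with F(0) = 0 and
   x_a = Q^a / (1 - Q^a); the only input is
   x_a x_b = x_(a + b) (1 + x_a + x_b). *)
Lemma liouville N (F : nat -> fps R) :
  vanish N.+1 (2%:R * \sum_(i < N) \sum_(j < i) F (i - j)%N * (x i * x j)
    - \sum_(i < N) \sum_(j < N) F (i + j).+2 * (x i * x j)
    - (2%:R * \sum_(i < N) F i.+1 * x i ^+ 2
       - 2%:R * \sum_(i < N) x i * \sum_(j < i) F j.+1
       - \sum_(i < N) i%:R * (F i.+1 * x i))).
Proof.
(* [W] carries the weight $F(a+b)$ of the second sum. [T] carries $F(a)$, where $a$ will be the
   difference of the two indices of the first sum. *)
have W := lambert_pairs (N := N) (fun i j => F (i + j).+2).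
have T := lambert_pairs (N := N) (fun i j => F i.+1).
set w := \sum_(i < N) \sum_(j < N) F (i + j).+2 * _ in W *.
set w' := \sum_(i < N) \sum_(j < i) _ in W.
set t' := \sum_(i < N) \sum_(j < i) _ in T.
set s1 := \sum_(i < N) \sum_(j < i) _.
have w'E : w' = \sum_(i < N) i%:R * (F i.+1 * x i)
  + 2%:R * \sum_(i < N) F i.+1 * x i * \sum_(j < i) x j.
  rewrite mulr_sumr -big_split; apply: eq_bigr => i _ /=.
  have -> : \sum_(j < i) F (i - j.+1 + j).+2 * (x (i - j.+1)%N * x j)
    = \sum_(j < i) F i.+1 * x i * (1 + x (i - j.+1)%N + x j).
    apply: eq_bigr => j _; have -> : (i - j.+1 + j).+2 = i.+1.
      by have := ltn_ord j; lia.
    rewrite lambertM // mulrA; congr (_ * lambert _ * _).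
    by have := ltn_ord j; lia.
  rewrite -mulr_sumr !big_split /= sumr_const card_ord.
  have -> : \sum_(j < i) x (i - j.+1)%N = \sum_(j < i) x j.
    by rewrite [RHS](reindex_inj rev_ord_inj).
  ring.
(* Here the product formula is read backwards: for $c=a+b$ it gives $x_cx_b=x_ax_b-x_c-x_cx_a$, and
   $F(c-b)$ becomes $F(a)$. *)
have s1E : s1 = t' - \sum_(i < N) x i * \sum_(j < i) F j.+1
  - \sum_(i < N) \sum_(j < i) F j.+1 * (x j * x i).
  rewrite -!sumrB; apply: eq_bigr => i _.
  rewrite mulr_sumr.
  have -> : \sum_(j < i) x i * F j.+1 = \sum_(j < i) x i * F (i - j)%N.
    rewrite [RHS](reindex_inj rev_ord_inj); apply: eq_bigr => j _.
    by congr (_ * F _); rewrite /=; have := ltn_ord j; lia.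
  have -> : \sum_(j < i) F j.+1 * (x j * x i)
      = \sum_(j < i) F (i - j)%N * (x (i - j.+1)%N * x i).
    rewrite [RHS](reindex_inj rev_ord_inj); apply: eq_bigr => j _.
    by congr (F _ * (lambert _ * _)); rewrite /=; have := ltn_ord j; lia.
  rewrite -!sumrB; apply: eq_bigr => j _.
  have ji := ltn_ord j.
  have e : x (i - j.+1)%N * x j = x i * (1 + x (i - j.+1)%N + x j).
    by rewrite lambertM //; congr (lambert _ * _); lia.
  have -> : (i - j.+1).+1 = (i - j)%N by lia.
  have e' : (i - j.+1).+1 = (i - j)%N by lia.
  by rewrite e' in e; apply: (lincomb1 (c := - F (i - j)%N) e); ring.
rewrite (big_square _ (fun i j => F i.+1 * (x i * x j))) in T.
have e0 : \sum_(i < N) \sum_(j < i) (F i.+1 * (x i * x j) + F j.+1 * (x j * x i))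
  = \sum_(i < N) \sum_(j < i) F i.+1 * (x i * x j)
    + \sum_(i < N) \sum_(j < i) F j.+1 * (x j * x i).
  by rewrite -big_split; apply: eq_bigr => i _; rewrite big_split.
rewrite e0 in T.
have e1 : \sum_(i < N) \sum_(j < i) F i.+1 * (x i * x j)
  = \sum_(i < N) F i.+1 * x i * \sum_(j < i) x j.
  by apply: eq_bigr => i _; rewrite mulr_sumr; apply: eq_bigr => j _; ring.
have e2 : \sum_(i < N) F i.+1 * x i ^+ 2 = \sum_(i < N) F i.+1 * (x i * x i).
  by apply: eq_bigr => i _; ring.
rewrite e1 in T; rewrite w'E in W; rewrite s1E e2.
apply: (vanish_eq _ (vanishD (vanishN W) (vanishMl (- 2%:R) T))); ring.
Qed.
End Lambert.

(** * Divisor sums and Ramanujan's differential equations *)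

Section Ramanujan.
Variable R : idomainType.
Local Notation D := (@fps_deriv R).
Local Notation x i := (lambert R i.+1).

(* The constant term is reset to 0, since [divisors 0] is [[:: 1]]. *)
Definition divsum r : fps R :=
  Fps (fun n => if n == 0%N then 0 else (sigma r n)%:R).

Lemma sigmaE r n : (0 < n)%N -> sigma r n = (\sum_(i < n | i.+1 %| n) i.+1 ^ r)%N.
Proof.
move=> n0; rewrite /sigma; have -> : (\sum_(i < n | i.+1 %| n) i.+1 ^ r)%N
  = (\sum_(d <- [seq d <- iota 1 n | d %| n]) d ^ r)%N.
  have -> : iota 1 n = index_iota 1 n.+1 by rewrite /index_iota subSS subn0.
  by rewrite big_filter big_add1 big_mkord.
apply: perm_big; apply: uniq_perm.
- exact: divisors_uniq.
- by rewrite filter_uniq ?iota_uniq.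
move=> d; rewrite -dvdn_divisors // mem_filter mem_iota.
case dn: (d %| n)%N => //=; rewrite (dvdn_gt0 n0 dn) add1n ltnS.
by rewrite dvdn_leq.
Qed.

(** For $n>0$ the coefficient of $Q^n$ in $Q^d/(1-Q^d)$ is 1 if $d\mid n$ and 0 otherwise, hence 0
    for $d>n$. *)
Lemma divsum_lambert r N :
  vanish N.+1 (divsum r - \sum_(i < N) i.+1%:R ^+ r * x i).
Proof.
move=> n nN; rewrite fpsEB fpsE_sum; case: (posnP n) => [->|n0].
  by rewrite big1 ?subr0 // => i _; rewrite -natrX fpsEMnl /= mulr0.
rewrite [divsum r n]/= gtn_eqF // sigmaE //.
have -> : \sum_(i < N) (i.+1%:R ^+ r * x i) n
  = \sum_(i < N) ((i.+1 ^ r) * (i.+1 %| n))%N%:R :> R.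
  by apply: eq_bigr => i _; rewrite -natrX fpsEMnl /= n0 natrM.
rewrite -natr_sum; apply/eqP; rewrite subr_eq0; apply/eqP; congr _%:R.
rewrite -(subnKC (nN : n <= N)%N) big_split_ord /= [X in (_ + X)%N]big1.
  rewrite addn0 big_mkcond; apply: eq_bigr => i _.
  by case: ifP; rewrite ?muln1 ?muln0.
by move=> i _; rewrite gtnNdvd ?muln0 //= ltnS leq_addr.
Qed.

Section Power.
Variables (N : nat).
Local Notation s r := (\sum_(i < N) i.+1%:R ^+ r * x i).

Lemma lambert_sqr r :
  \sum_(i < N) i.+1%:R ^+ r.+1 * x i ^+ 2 = D (s r) - s r.+1.
Proof.
rewrite raddf_sum -sumrB; apply: eq_bigr => i _.
by rewrite -!natrX /= fps_derivMn deriv_lambert // !natrX exprS; ring.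
Qed.

(** A positive even exponent makes the summand symmetric and zero on the diagonal, so the triangle
    counts for half of the square, where the power can be expanded. *)
Lemma sum_diff e (G := fun i j => (i%:R - j%:R) ^+ (2 * e.+1) * (x i * x j)) :
  2%:R * \sum_(i < N) \sum_(j < i) (i - j)%N%:R ^+ (2 * e.+1) * (x i * x j)
  = \sum_(i < N) \sum_(j < N) G i j.
Proof.
rewrite (big_square N G) [X in _ = X + _]big1 ?add0r => [|i _]; last first.
  by rewrite /G subrr mulnS expr0n mul0r.
rewrite mulr_sumr; apply: eq_bigr => i _; rewrite mulr_sumr.
apply: eq_bigr => j _; rewrite natrB; last exact: ltnW.
rewrite /G; have -> : (j%:R - i%:R : fps R) ^+ (2 * e.+1)
    = (i%:R - j%:R) ^+ (2 * e.+1).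
  by rewrite exprM -sqrrN opprB -exprM.
ring.
Qed.

Lemma sum_sqr i : 6%:R * \sum_(j < i) j.+1%:R ^+ 2
  = i%:R * (i%:R + 1) * (2%:R * i%:R + 1) :> fps R.
Proof.
elim: i => [|i ih]; first by rewrite big_ord0; ring.
by rewrite big_ord_recr mulrDr ih /=; ring.
Qed.

Lemma sum_pow4 i : 30%:R * \sum_(j < i) j.+1%:R ^+ 4
  = i%:R * (i%:R + 1) * (2%:R * i%:R + 1) * (3%:R * i%:R ^+ 2 + 3%:R * i%:R - 1)
  :> fps R.
Proof.
elim: i => [|i ih]; first by rewrite big_ord0; ring.
by rewrite big_ord_recr mulrDr ih /=; ring.
Qed.

End Power.

(** Liouville's identity for $F(c)=c^2$: since $(a-b)^2-(a+b)^2=-4ab$, its left-hand side is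
    $-4(\sum_a a\,x_a)^2$. This is Ramanujan's equation for the derivative of $P$. *)
Lemma divsum11 : 12%:R * divsum 1 ^+ 2
  = 5%:R * divsum 3 + divsum 1 - 6%:R * D (divsum 1).
Proof.
apply/eqP; rewrite -subr_eq0; apply/eqP; apply: vanish_eq0 => N.
apply: (vanishW (leqnSn N)).
have := @liouville R N (fun c => c%:R ^+ 2).
rewrite (sum_diff N 0) lambert_sqr.
set s := fun r => \sum_(i < N) i.+1%:R ^+ r * x i.
rewrite -/(s 1%N) -/(s 2%N).
have -> : \sum_(i < N) \sum_(j < N) (i%:R - j%:R) ^+ 2 * (x i * x j)
    = \sum_(i < N) \sum_(j < N) (i + j).+2%:R ^+ 2 * (x i * x j)
      - 4%:R * s 1%N ^+ 2.
  rewrite /s expr2 big_distrlr mulr_sumr -sumrB; apply: eq_bigr => i _ /=.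
  rewrite mulr_sumr -sumrB; apply: eq_bigr => j _ /=; ring.
have e1 : \sum_(i < N) i%:R * (i.+1%:R ^+ 2 * x i) = s 3%N - s 2%N.
  by rewrite /s -sumrB; apply: eq_bigr => i _; ring.
have e2 : 6%:R * (\sum_(i < N) x i * \sum_(j < i) j.+1%:R ^+ 2)
   = 2%:R * s 3%N - 3%:R * s 2%N + s 1%N.
  rewrite /s !mulr_sumr -sumrB -big_split; apply: eq_bigr => i _ /=.
  by rewrite mulrCA sum_sqr; ring.
rewrite e1 => h.
have d r : vanish N.+1 (divsum r - s r) := @divsum_lambert r N.
have Dd r := vanish_deriv (d r).
have := vanishD (vanishMl (- 3%:R) h) (vanishD (vanishMr (12%:R * (divsum 1 + s 1%N)) (d 1%N))
  (vanishD (vanishMl (- 5%:R) (d 3%N)) (vanishD (vanishMl (-1) (d 1%N))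
     (vanishMl 6%:R (Dd 1%N))))).
apply: vanish_eq; rewrite fps_derivB; apply: (lincomb1 (c := - 1) e2).
ring.
Qed.

(** Liouville's identity for $F(c)=c^4$, where $(a-b)^4-(a+b)^4=-8a^3b-8ab^3$. This is Ramanujan's
    equation for the derivative of $E_4$. *)
Lemma divsum13 : 240%:R * (divsum 1 * divsum 3)
  = 21%:R * divsum 5 + 10%:R * divsum 3 - divsum 1 - 30%:R * D (divsum 3).
Proof.
apply/eqP; rewrite -subr_eq0; apply/eqP; apply: vanish_eq0 => N.
apply: (vanishW (leqnSn N)).
have := @liouville R N (fun c => c%:R ^+ 4).
rewrite (sum_diff N 1) lambert_sqr.
set s := fun r => \sum_(i < N) i.+1%:R ^+ r * x i.
rewrite -/(s 3%N) -/(s 4%N).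
have -> : \sum_(i < N) \sum_(j < N) (i%:R - j%:R) ^+ 4 * (x i * x j)
    = \sum_(i < N) \sum_(j < N) (i + j).+2%:R ^+ 4 * (x i * x j)
      - 8%:R * (s 1%N * s 3%N) - 8%:R * (s 3%N * s 1%N).
  rewrite /s !big_distrlr !mulr_sumr -!sumrB; apply: eq_bigr => i _ /=.
  rewrite !mulr_sumr -!sumrB; apply: eq_bigr => j _ /=; ring.
have e1 : \sum_(i < N) i%:R * (i.+1%:R ^+ 4 * x i) = s 5%N - s 4%N.
  by rewrite /s -sumrB; apply: eq_bigr => i _; ring.
have e2 : 30%:R * (\sum_(i < N) x i * \sum_(j < i) j.+1%:R ^+ 4)
   = 6%:R * s 5%N - 15%:R * s 4%N + 10%:R * s 3%N - s 1%N.
  rewrite /s !mulr_sumr -!sumrB -!big_split -sumrB; apply: eq_bigr => i _ /=.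
  by rewrite mulrCA sum_pow4; ring.
rewrite e1 => h.
have d r : vanish N.+1 (divsum r - s r) := @divsum_lambert r N.
have Dd r := vanish_deriv (d r).
have := vanishD (vanishMl (- 15%:R) h) (vanishD (vanishMl (240%:R * divsum 1) (d 3%N))
   (vanishD (vanishMl (240%:R * s 3%N) (d 1%N))
  (vanishD (vanishMl (- 21%:R) (d 5%N)) (vanishD (vanishMl (- 10%:R) (d 3%N)) (vanishD (d 1%N)
     (vanishMl 30%:R (Dd 3%N))))))).
apply: vanish_eq; rewrite fps_derivB; apply: (lincomb1 (c := - 1) e2).
ring.
Qed.
End Ramanujan.

(** * Theta series *)

Section Shanks.
Variable R : idomainType.
Local Notation D := (@fps_deriv R).
Local Notation q := (fpsX R).

Definition theta : fps R := Fps (fun n => (theta_coef n)%:R).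

Lemma theta_coefE n : theta_coef n =
  ((n == 0) + 2 * \sum_(s < n) (s.+1 ^ 2 == n))%N.
Proof.
rewrite /theta_coef.
rewrite (@eq_card _ _ [pred i : 'I_(n.*2.+1) | ((i : nat)%:Z - n%:Z) ^+ 2 == n%:Z]);
  last by move=> i; apply/idP/idP; rewrite in_setE.
rewrite -sum1_card big_mkcond /=.
have -> : n.*2.+1 = (n + n.+1)%N by lia.
rewrite big_split_ord /= big_ord_recl (reindex_inj rev_ord_inj) /=.
rewrite !unfold_in /= addn0 subrr expr0n /= -[0 == n%:Z]/(0%N == n)%N.
rewrite mul2n -addnn addnCA (eq_sym 0%N); congr (_ + _)%N; last congr (_ + _)%N.
  apply: eq_bigr => s _; rewrite unfold_in /=.
  have -> : ((n - s.+1)%:Z - n%:Z) = - s.+1%:Z by have := ltn_ord s; lia.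
  by rewrite sqrrN -[_ ^+ 2]/((s.+1 ^ 2)%N%:Z) eqz_nat; case: (_ == _)%N.
apply: eq_bigr => s _; rewrite unfold_in /= /bump /= add1n.
have -> : ((n + s.+1)%:Z - n%:Z) = s.+1%:Z by lia.
by rewrite -[_ ^+ 2]/((s.+1 ^ 2)%N%:Z) eqz_nat; case: (_ == _)%N.
Qed.

Lemma theta_sum N : vanish N.+1 (theta - (1 + 2%:R * \sum_(s < N) q (s.+1 ^ 2))).
Proof.
move=> n nN; rewrite fpsEB fpsED fpsEMnl fpsE_sum fpsE1 /= theta_coefE.
rewrite natrD natrM natr_sum -(subnKC (nN : n <= N)%N) big_split_ord /=.
rewrite [X in (_ + (_ * (_ + X)))]big1 ?addr0 => [|i _]; last first.
  by rewrite coefXn; case: eqP => //; have := leq_pexp2l (ltn0Sn (n + i)) (ltn0Sn 1); lia.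
under [X in _ - (_ + (_ * X))]eq_bigr do rewrite coefXn eq_sym.
by rewrite subrr.
Qed.

(** The inverse of $1+Q^k$, written $(1-Q^k)/(1-Q^{2k})$. Hence [rho k] is the factor
    $(1-Q^k)/(1+Q^k)$ of Gauss' product. *)
Definition plusXV k : fps R := (1 - q k) * (1 + lambert R (2 * k)).
Definition rho k : fps R := (1 - q k) * plusXV k.
Definition rhos s n : fps R := \prod_(s <= k < n) rho k.

Lemma plusXVE k : (0 < k)%N -> (1 + q k) * plusXV k = 1.
Proof.
move=> k0; have e : (0 < 2 * k)%N by lia.
have := lambertE R e; rewrite mulnC fpsXM => {}e.
by rewrite /plusXV mulnC; apply: (lincomb1 (c := 1) e); ring.
Qed.

Lemma plusX_neq0 k : (0 < k)%N -> (1 + q k) 0%N != 0.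
Proof. by move=> k0; rewrite fpsED fpsE1 fpsE_X (ltn_eqF k0) addr0 oner_neq0. Qed.

(* Shanks' finite form of Gauss' product for \sum (-1)^n q^(n^2): the terms
   with s > 0 on the right are O(q^n), and the increment in n telescopes. *)
Lemma shanks n :
  1 + 2%:R * \sum_(1 <= s < n.+1) (-1) ^+ s * q (s ^ 2) =
  rhos 1 n.+1 + \sum_(1 <= s < n.+1)
    2%:R * (-1) ^+ s * rhos s.+1 n.+1 * q (s * n.+1) * plusXV s.
Proof.
elim: n => [|n ih]; first by rewrite /rhos !big_geq // mulr0.
set t := fun n s => 2%:R * (-1) ^+ s * rhos s.+1 n.+1 * q (s * n.+1) * plusXV s.
rewrite -/(t n.+1) big_nat_recr //= mulrDr addrA ih.
set N := n.+1; apply: (fps_mulI (@plusX_neq0 N isT)).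
(* [g] is the primitive in $s$: $1+Q^N$ times the change of the $s$-th error term from $n$ to
   $N=n+1$ equals $g(s+1)-g(s)$. *)
pose g s := 2%:R * (-1) ^+ s * q (s * N) * rhos s N.
have rhosS s : (s <= N)%N -> (1 + q N) * rhos s N.+1 = (1 - q N) * rhos s N.
  move=> sN; rewrite /rhos big_nat_recr //= /rho.
  by apply: (lincomb1 (c := rhos s N * (1 - q N)) (@plusXVE N isT)); rewrite /rhos; ring.
have a s : (0 < s)%N -> (s < N)%N -> (1 + q N) * (t N s - t n s) = g s.+1 - g s.
  move=> s0 sN; rewrite /t /g -/N.
  have e := rhosS s.+1 sN; have e' := plusXVE s0.
  have -> : rhos s N = (1 - q s) * plusXV s * rhos s.+1 N.
    by rewrite /rhos big_ltn.
  rewrite mulnS mulSn !fpsXD exprS.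
  apply: (lincomb2 (c := 2%:R * (-1) ^+ s * q s * q (s * N) * plusXV s)
    (c' := - (2%:R * (-1) ^+ s * q N * q (s * N) * rhos s.+1 N)) e e').
  ring.
have b := rhosS 1%N isT.
rewrite [X in _ = _ * (_ + X)]big_nat_recr //=.
rewrite -[\sum_(1 <= i < N) (_ * rhos _ N.+1 * _ * _)]/(\sum_(1 <= i < N) t N i).
rewrite -[\sum_(1 <= i < N) (_ * rhos _ N * _ * _)]/(\sum_(1 <= i < N) t n i).
rewrite -/(t N N); have -> : t N N = 2%:R * (-1) ^+ N * q (N ^ 2) * q N * plusXV N.
  rewrite /t /rhos big_geq // (_ : N * N.+1 = N ^ 2 + N)%N ?fpsXD; first ring.
  by rewrite mulnS mulnn addnC.
have c : (1 + q N) * (\sum_(1 <= s < N) t N s - \sum_(1 <= s < N) t n s)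
    = 2%:R * (-1) ^+ N * q (N ^ 2) + 2%:R * q N * rhos 1 N.
  rewrite -sumrB mulr_sumr.
  under eq_big_nat => s /andP[s0 sN] do rewrite a //.
  rewrite telescope_sumr // /g mul1n mulnn; have -> : rhos N N = 1.
    by rewrite /rhos big_geq.
  ring.
have e := @plusXVE N isT.
apply: (lincomb3 (c := - 1) (c' := - 1)
  (c'' := - (2%:R * (-1) ^+ N * q (N ^ 2) * q N)) b c e).
ring.
Qed.

Lemma fps_flipX m : fps_flip (q m) = (-1) ^+ m * q m.
Proof.
apply: fpsP => i; rewrite [LHS]/= coefXn -signr_odd -[in RHS]signr_odd !mulr_sign.
case: (eqVneq i m) => [->|/negPf im] /=.
  by case: (odd m); rewrite ?fpsEN fpsE_X eqxx.
by case: (odd i); case: (odd m); rewrite ?fpsEN fpsE_X im ?oppr0.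
Qed.

(** Gauss' product for $\theta(-Q)$ up to order $N$: each error term of [shanks] contains
    $Q^{s(N+1)}$ with $s\ge1$. *)
Lemma theta4_rhos N : vanish N.+1 (fps_flip theta - rhos 1 N.+1).
Proof.
have e : fps_flip (1 + 2%:R * \sum_(s < N) q (s.+1 ^ 2)) = rhos 1 N.+1
   + \sum_(1 <= s < N.+1)
    2%:R * (-1) ^+ s * rhos s.+1 N.+1 * q (s * N.+1) * plusXV s.
  rewrite -shanks rmorphD rmorph1 rmorphM rmorph_nat; congr (1 + 2%:R * _).
  rewrite big_add1 big_mkord rmorph_sum; apply: eq_bigr => s _ /=.
  by rewrite fps_flipX -signr_odd oddX signr_odd.
have := vanish_flip (@theta_sum N); rewrite rmorphB /= e => h.
have h2 : vanish N.+1 (\sum_(1 <= s < N.+1)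
    2%:R * (-1) ^+ s * rhos s.+1 N.+1 * q (s * N.+1) * plusXV s).
  rewrite big_add1 big_mkord; apply: vanish_sum => s _.
  apply: vanishMr; apply: vanishMl; apply: (@vanishW _ _ (s.+1 * N.+1)).
    by rewrite leq_pmull.
  exact: vanish_fpsX.
by apply: vanish_eq (vanishD h h2); ring.
Qed.

(** Logarithmic derivative of $(1-Q^k)/(1+Q^k)$, using $Q^k/(1+Q^k)=x_k-2x_{2k}$. *)
Lemma deriv_rho k : (0 < k)%N ->
  D (rho k) = rho k * (- (2 * k)%:R * (lambert R k - lambert R (2 * k))).
Proof.
move=> k0; have k20 : (0 < 2 * k)%N by lia.
have e1 : rho k * (1 + q k) = 1 - q k.
  by apply: (lincomb1 (c := 1 - q k) (plusXVE k0)); rewrite /rho; ring.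
have /(congr1 D) := e1.
rewrite fps_derivM fps_derivD fps_derivB fps_deriv1 fps_derivX => e2.
have e3 := lambertMX R k0; have := lambertMX R k20.
rewrite [X in q X]mulnC fpsXM => e4; rewrite natrM.
apply: (fps_mulI (plusX_neq0 k0)); apply: (fps_mulI (plusX_neq0 k0)).
apply: (lincomb4 (c := 1 + q k)
    (c' := 2%:R * k%:R * (1 + q k) * (lambert R k - lambert R (2 * k)) - k%:R * q k)
  (c'' := 2%:R * k%:R * (1 + q k)) (c3 := - 2%:R * k%:R) e2 e1 e3 e4).
ring.
Qed.

(** The coefficient of $Q^n$, $n>0$, is the sum of the divisors $d$ of $n$ with $n/d$ odd. The
    series arises as $-\frac12$ times the logarithmic derivative of $\theta(-Q)$. *)
Definition oddsum : fps R := divsum R 1 - fps_dbl (divsum R 1).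

Lemma dbl_lambert k : (0 < k)%N -> fps_dbl (lambert R k) = lambert R (2 * k).
Proof.
move=> k0; apply: fpsP => n /=; case: ifP => [h|h].
  have -> : (0 < n %/ 2)%N = (0 < n)%N by move: h; lia.
  by congr (_ && _)%:R; rewrite -[in RHS](divnK h) mulnC dvdn_pmul2r.
case: (boolP (2 * k %| n)%N) => [d|_]; last by rewrite andbF.
by rewrite (dvdn_trans (dvdn_mulr _ (dvdnn 2)) d) in h.
Qed.

Lemma oddsum_lambert N : vanish N.+1 (oddsum
   - \sum_(k < N) k.+1%:R * (lambert R k.+1 - lambert R (2 * k.+1))).
Proof.
have h : vanish N.+1 _ := @divsum_lambert R 1 N.
apply: vanish_eq (vanishB h (vanish_dbl h)).
rewrite rmorphB /= rmorph_sum /oddsum.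
under [X in _ = _ - X]eq_bigr => k _ do rewrite mulrBr.
rewrite sumrB.
have -> : \sum_(i < N) fps_dbl (i.+1%:R ^+ 1 * lambert R i.+1)
  = \sum_(i < N) i.+1%:R * lambert R (2 * i.+1).
  by apply: eq_bigr => i _; rewrite rmorphM expr1 rmorph_nat /= dbl_lambert.
under eq_bigr do rewrite expr1.
ring.
Qed.

Lemma deriv_theta4 : D (fps_flip theta) = - 2%:R * oddsum * fps_flip theta.
Proof.
apply/eqP; rewrite -subr_eq0; apply/eqP; apply: vanish_eq0 => N.
apply: (vanishW (leqnSn N)).
have h := @theta4_rhos N; have m := @oddsum_lambert N.
set S := \sum_(k < N) _ in m.
have DP : D (rhos 1 N.+1) = - 2%:R * S * rhos 1 N.+1.
  rewrite /S /rhos; elim: N {h m S} => [|N ih].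
    by rewrite big_geq // big_ord0 fps_deriv1 mulr0 mul0r.
  rewrite big_nat_recr //= fps_derivM ih deriv_rho // natrM big_ord_recr /=.
  ring.
have := vanishD (vanish_deriv h) (vanishD (vanishMl (2%:R * fps_flip theta) m)
  (vanishMl (2%:R * S) h)).
by apply: vanish_eq; rewrite fps_derivB DP; ring.
Qed.
End Shanks.

(** * Fourth powers of theta series and Eisenstein series *)

Section ThetaIdentities.
Local Notation D := (@fps_deriv int).
Local Notation dbl := (@fps_dbl int).
Local Notation flip := (@fps_flip int).
Local Notation M := (oddsum int).

(* Functional equations between a series at Q and at Q^2 are solved by comparing
   orders of vanishing at Q = 0. *)
Lemma dbl_fix (c : int) (x : fps int) :
  c != 1 -> x = fpsC c * dbl x -> x = 0.
Proof.
move=> c1 e; apply: fpsP => n; elim/ltn_ind: n => n ih.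
rewrite e fpsE_CM /=; case: ifP => d; last by rewrite mulr0.
case: (posnP n) => [n0|n0]; last by rewrite ih ?mulr0 // ltn_Pdiv.
have := congr1 (fun x : fps int => x 0%N) e.
rewrite fpsE_CM /= n0 div0n => /eqP; rewrite -subr_eq0 -{1}[x 0%N]mul1r -mulrBl.
by rewrite mulf_eq0 subr_eq0 eq_sym (negPf c1) => /eqP ->; rewrite mulr0.
Qed.

(** If $x=O(Q^n)$, the coefficient of $Q^{n+1}$ is $a_1x_n$ on the left, while the right only
    involves $x_m$ with $2m\le n+1$. Then $m<n$ as soon as $n\ge2$, so $x_0$ and $x_1$ must be
    given. *)
Lemma dbl_fix1 (a b x : fps int) : a 0%N = 0 -> a 1%N != 0 ->
  x 0%N = 0 -> x 1%N = 0 -> a * x = b * dbl x -> x = 0.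
Proof.
move=> a0 a1 x0 x1 e; apply: fpsP => n; elim/ltn_ind: n => n ih.
case: n ih => [//|[//|n]] ih.
have := congr1 (fun x : fps int => x n.+3) e.
rewrite !fpsEM big_ord_recl a0 mul0r add0r big_ord_recl /= big1 ?addr0; last first.
  by move=> i _; rewrite /bump /= ih ?mulr0 //; have := ltn_ord i; lia.
rewrite /bump /= subSS subn0 big1 => [/eqP|i _]; last first.
  by case: ifP => _; rewrite ?mulr0 // ih ?mulr0 //; have := ltn_ord i; lia.
by rewrite mulf_eq0 (negPf a1) => /eqP.
Qed.

Lemma dbl_fix0 (b x : fps int) : b 0%N != 0 ->
  x 0%N = 0 -> x * dbl b = b * dbl x -> x = 0.
Proof.
move=> b0 x0 e; apply: fpsP => n; elim/ltn_ind: n => n ih.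
case: (posnP n) => [->//|n0].
have := congr1 (fun x : fps int => x n) e.
rewrite !fpsEM big_ord_recr /= subnn dvdn0 div0n big1 ?add0r; last first.
  by move=> i _; rewrite ih ?mul0r.
rewrite big1 => [/eqP|i _]; last first.
  by case: ifP => _; rewrite ?mulr0 // ih ?mulr0 //; have := ltn_ord i; lia.
by rewrite mulf_eq0 (negPf b0) orbF => /eqP.
Qed.

Lemma ode_eq0 (L x : fps int) : L 0%N = 0 -> x 0%N = 0 -> D x = L * x -> x = 0.
Proof.
move=> L0 x0 e; apply: fpsP => n; elim/ltn_ind: n => n ih.
case: (posnP n) => [->//|n0].
have := congr1 (fun x : fps int => x n) e.
rewrite fpsEM big_ord_recl L0 mul0r add0r big1 => [|i _]; last first.
  by rewrite ih ?mulr0 //= ltn_subrL n0.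
by move=> /= /eqP; rewrite mulf_eq0 pnatr_eq0 gtn_eqF //= => /eqP.
Qed.

Lemma fps_flipK : involutive flip.
Proof. by move=> x; apply: fpsP => n /=; rewrite mulrA -expr2 sqrr_sign mul1r. Qed.

Lemma big_ord_double (V : nmodType) n (F : nat -> V) :
  \sum_(k < 2 * n) F k = \sum_(k < n) (F (2 * k)%N + F (2 * k).+1).
Proof.
elim: n => [|n ih]; first by rewrite !big_ord0.
by rewrite mulnS !big_ord_recr /= ih addrA.
Qed.

Lemma oddsum_even : M + flip M = 4%:R * dbl M.
Proof.
apply: fpsP => n; rewrite fpsED fpsEMnl fpsE_flip fpsE_dbl.
case: ifP => h; last first.
  have {}h : odd n by rewrite dvdn2 in h; move/negbFE: h.
  by rewrite -signr_odd h /= mulN1r subrr mulr0.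
have en : n = (2 * (n %/ 2))%N by rewrite mulnC divnK.
move: (n %/ 2)%N en => m ->.
rewrite -signr_odd oddM expr0 mul1r.
(* The divisors of $2m$ with odd codivisor are the doubles of those of $m$ with odd codivisor. *)
suff -> : M (2 * m)%N = 2%:R * M m by ring.
have h1 := @oddsum_lambert int (2 * m) (2 * m)%N (leqnn _).
have h2 := @oddsum_lambert int m m (leqnn _).
move: h1 h2; rewrite !fpsEB => /eqP; rewrite subr_eq0 => /eqP ->.
move=> /eqP; rewrite subr_eq0 => /eqP ->.
rewrite !fpsE_sum mulr_sumr (big_ord_double _ (fun k =>
  (k.+1%:R * (lambert int k.+1 - lambert int (2 * k.+1))) (2 * m)%N)).
apply: eq_bigr => i _; rewrite !fpsEMnl !fpsEB /=.
have c1 : (2 * (2 * i).+1 %| 2 * m)%N = ((2 * i).+1 %| 2 * m)%N.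
  by rewrite dvdn_pmul2l // Gauss_dvdr // coprimen2 /= mul2n odd_double.
rewrite c1 subrr mulr0 add0r.
have -> : (2 * i).+2 = (2 * i.+1)%N by lia.
rewrite !dvdn_pmul2l //.
have -> : (0 < 2 * m)%N = (0 < m)%N by lia.
by rewrite mulrA -natrM.
Qed.

Local Notation th := (theta int).
Local Notation th4 := (flip th).

Lemma theta_0 : th 0%N = 1. Proof. by rewrite /= theta_coefE big_ord0. Qed.
Lemma theta_1 : th 1%N = 2. Proof. by rewrite /= theta_coefE big_ord1. Qed.
Lemma theta4_0 : th4 0%N = 1. Proof. by rewrite [LHS]/= theta_coefE big_ord0. Qed.
Lemma theta4_1 : th4 1%N = -2. Proof. by rewrite [LHS]/= theta_coefE big_ord1. Qed.

Lemma deriv_theta : D th = - 2%:R * flip M * th.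
Proof.
rewrite -{1}[th]fps_flipK fps_deriv_flip deriv_theta4 !rmorphM /= fps_flipK.
by rewrite rmorphN /= rmorph_nat.
Qed.

(** Both sides have constant term 1 and logarithmic derivative $-8M(Q^2)$, by [oddsum_even]. *)
Lemma theta_theta4 : th * th4 = dbl th4 ^+ 2.
Proof.
apply/eqP; rewrite -subr_eq0; apply/eqP.
apply: (@ode_eq0 (- 8%:R * dbl M)).
- by rewrite fpsEM0 /= subrr mulr0.
- by rewrite fpsEB fpsEX0 fpsEM0 fps_dbl0 theta_0 theta4_0; ring.
rewrite fps_derivB expr2 !fps_derivM fps_deriv_dbl deriv_theta deriv_theta4.
have e := oddsum_even; rewrite !rmorphM rmorphN rmorph_nat /=.
by apply: (lincomb1 (c := - 2%:R * th * th4) e); ring.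
Qed.

Lemma theta_add : th + th4 = 2%:R * dbl (dbl th).
Proof.
apply: fpsP => n; rewrite fpsED fpsEMnl fpsE_flip fpsE_dbl.
case: ifP => h; last first.
  have {}h : odd n by rewrite dvdn2 in h; move/negbFE: h.
  by rewrite -signr_odd h /= mulN1r subrr mulr0.
have en : n = (2 * (n %/ 2))%N by rewrite mulnC divnK.
move: (n %/ 2)%N en => m ->.
rewrite -signr_odd oddM expr0 mul1r -mulr2n mulr_natl; congr (_ *+ 2).
rewrite /= theta_coefE.
have -> : (2 * m == 0)%N = (m == 0)%N by lia.
rewrite (big_ord_double _ (fun s => (s.+1 ^ 2 == 2 * m : nat))%N).
have -> : (\sum_(k < m) (((2 * k).+1 ^ 2 == 2 * m) + ((2 * k).+2 ^ 2 == 2 * m))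
   = \sum_(k < m) (2 * k.+1 ^ 2 == m))%N.
  apply: eq_bigr => k _.
  have -> : ((2 * k).+1 ^ 2 == 2 * m)%N = false.
    by apply/negP => /eqP /(congr1 odd); rewrite oddX oddM /= oddM.
  rewrite (_ : (2 * k).+2 = 2 * k.+1)%N; last lia.
  by rewrite expnMn (expnS 2 1) -mulnA expn1 eqn_pmul2l.
case: ifP => d; last first.
  rewrite big1 ?muln0 => [|k _].
    by case: m d.
  by case: eqP => // e; rewrite -e dvdn_mulr in d.
have em : m = (2 * (m %/ 2))%N by rewrite mulnC divnK.
move: (m %/ 2)%N em => g ->.
rewrite theta_coefE (_ : (2 * g == 0)%N = (g == 0)%N); last lia.
under eq_bigr => k _ do rewrite eqn_pmul2l //.
rewrite (_ : 2 * g = g + g)%N; last lia.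
rewrite big_split_ord /= [X in (_ + 2 * (_ + X))%N]big1 ?addn0 // => k _.
by case: eqP => // e; have := leq_pexp2l (ltn0Sn (g + k)) (ltn0Sn 1); lia.
Qed.

(** By [theta_add] and [theta_theta4] the difference $x$ of the two sides satisfies $x(Q)=-2x(Q^2)$,
    hence is zero. *)
Lemma theta_sqr : th ^+ 2 + th4 ^+ 2 = 2%:R * dbl th ^+ 2.
Proof.
apply/eqP; rewrite -subr_eq0; apply/eqP; apply: (@dbl_fix (- 2%:R)) => //.
have -> : fpsC (- 2%:R : int) = - 2%:R by rewrite rmorphN rmorph_nat.
apply: (lincomb2 (c := th + th4 + 2%:R * dbl (dbl th)) (c' := - 2%:R)
  theta_add theta_theta4).
ring.
Qed.

(** Jacobi's $\theta_3^4$, next to $\theta_4^4$. Taking $\theta_2^4$ to be their difference avoids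
    fractional powers of $Q$ and builds in Jacobi's quartic identity. The three relations that
    follow are the duplication formulas of the arithmetic-geometric mean. *)
Definition T3 := th ^+ 4.
Definition T4 := th4 ^+ 4.
Local Notation T2 := (T3 - T4).

Lemma T3T4 : T3 * T4 = dbl T4 ^+ 2.
Proof.
rewrite /T3 /T4 rmorphXn -exprMn theta_theta4; ring.
Qed.
Lemma T3DT4 : T3 + T4 + 2%:R * dbl T4 = 4%:R * dbl T3.
Proof.
rewrite /T3 /T4 !rmorphXn /=.
have e := theta_theta4; have f := theta_sqr.
apply: (lincomb2 (c := - 2%:R * (th * th4 + dbl th4 ^+ 2))
  (c' := th ^+ 2 + th4 ^+ 2 + 2%:R * dbl th ^+ 2) e f); ring.
Qed.
Lemma T2_sqr : T2 ^+ 2 = 16%:R * dbl T3 * dbl T2.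
Proof.
have e := T3T4; have f := T3DT4; rewrite rmorphB /=.
apply: (lincomb2 (c := - 4%:R) (c' := T3 + T4 - 2%:R * dbl T4 + 4%:R * dbl T3)
   e f); ring.
Qed.

(* Ramanujan's P, the quasimodular Eisenstein series of weight 2. *)
Definition EP : fps int := 1 - 24%:R * divsum int 1.
Definition E4 : fps int := 1 + 240%:R * divsum int 3.
Definition E6 : fps int := 1 - 504%:R * divsum int 5.

Lemma deriv_EP : 12%:R * D EP = EP ^+ 2 - E4.
Proof.
rewrite /EP fps_derivB fps_derivMn fps_deriv1 /E4.
by apply: (lincomb1 (c := - 48%:R) (divsum11 int)); ring.
Qed.
Lemma deriv_E4 : 3%:R * D E4 = EP * E4 - E6.
Proof.
rewrite /E4 fps_derivD fps_derivMn fps_deriv1 /EP /E6.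
by apply: (lincomb1 (c := 24%:R) (divsum13 int)); ring.
Qed.

Local Notation P1 := EP.
Local Notation P2 := (dbl P1).
Local Notation P4 := (dbl P2).

Lemma deriv_pow4 (x : fps int) : D (x ^+ 4) = 4%:R * x ^+ 3 * D x.
Proof. by rewrite !exprS expr0 mulr1 !fps_derivM; ring. Qed.

Lemma deriv_T4 : 3%:R * D T4 = (P1 - P2) * T4.
Proof.
rewrite /T4 deriv_pow4 deriv_theta4 /P1 rmorphB rmorphM rmorph1 rmorph_nat /=.
rewrite /oddsum; ring.
Qed.
Lemma deriv_T3 : 3%:R * D T3 = (5%:R * P2 - 4%:R * P4 - P1) * T3.
Proof.
have e := oddsum_even.
rewrite /T3 deriv_pow4 deriv_theta.
rewrite /P1 !(rmorphB, rmorphM, rmorph1, rmorph_nat) /=.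
apply: (lincomb1 (c := - 24%:R * th ^+ 4) e).
rewrite /oddsum; ring.
Qed.

Lemma coefM_1 (x y : fps int) : (x * y) 1%N = x 0%N * y 1%N + x 1%N * y 0%N.
Proof. by rewrite fpsEM big_ord_recl big_ord1. Qed.

Lemma T2_0 : T2 0%N = 0.
Proof. by rewrite fpsEB /T3 /T4 !fpsEX0 theta_0 theta4_0. Qed.
Lemma T2_1 : T2 1%N = 16.
Proof.
rewrite fpsEB /T3 /T4 !exprS !expr0 !coefM_1 !fpsEM0 !fpsE1.
by rewrite theta_0 theta4_0 theta_1 theta4_1.
Qed.

Lemma EP_0 : P1 0%N = 1. Proof. by rewrite fpsEB fpsEMnl fpsE1 mulr0 subr0. Qed.

(* The difference of the two sides is a solution e of
   T2(Q) e(Q) = 16 T3(Q^2) e(Q^2) vanishing to order 2. *)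
Lemma deriv_T2 : 3%:R * D T2 = (4%:R * P4 - P2) * T2.
Proof.
apply/eqP; rewrite -subr_eq0; apply/eqP.
apply: (@dbl_fix1 T2 (16%:R * dbl T3)).
- exact: T2_0.
- by rewrite T2_1.
- by rewrite fpsEB fpsEMnl fpsEM0 T2_0 fpsE_deriv mul0r !mulr0 subr0.
- rewrite fpsEB fpsEMnl fpsE_deriv coefM_1 T2_0 T2_1 fpsEB fpsEMnl !fps_dbl0 EP_0.
  by rewrite mulr0 addr0.
move: T2_sqr (congr1 dbl deriv_T3); move: T2 => t e e3.
have /(congr1 D) := e; rewrite expr2 -mulrA fps_derivMn !fps_derivM !fps_deriv_dbl.
move=> e2; have n2 : (2%:R : fps int) 0%N != 0 by rewrite fpsE_nat.
apply: (fps_mulI n2).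
apply: (lincomb3 (c := 3%:R) (c' := - 2%:R * (4%:R * P4 - P2))
  (c'' := 32%:R * dbl t) e2 e e3).
ring.
Qed.

Lemma torsion_free n (x y : fps int) : n.+1%:R * x = n.+1%:R * y -> x = y.
Proof. by apply: fps_mulI; rewrite fpsE_nat pnatr_eq0. Qed.

(* Jacobi's four-square theorem. The logarithmic derivatives of T3, T4 and
   T3 - T4 make the left-hand sides proportional to T3 and T4; the sum of the
   left-hand sides transforms like T3 + T4 under Q |-> Q^2, so the factor is
   constant. *)
Lemma theta_EP : 4%:R * P4 - P1 = 3%:R * T3 /\ 8%:R * P4 + P1 - 6%:R * P2 = 3%:R * T4.
Proof.
have u : T3 * (8%:R * P4 + P1 - 6%:R * P2) = T4 * (4%:R * P4 - P1).
  have := deriv_T2; rewrite fps_derivB => e.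
  by apply: (lincomb3 (c := 1) (c' := -1) (c'' := -1) deriv_T3 deriv_T4 e); ring.
pose A := 12%:R * P4 - 6%:R * P2; pose B := T3 + T4.
have uA : (4%:R * P4 - P1) * B = T3 * A.
  by apply: (lincomb1 (c := -1) u); rewrite /A /B; ring.
have uB : (8%:R * P4 + P1 - 6%:R * P2) * B = T4 * A.
  by apply: (lincomb1 (c := 1) u); rewrite /A /B; ring.
have B0 : B 0%N = 2.
  by rewrite fpsED /T3 /T4 !fpsEX0 theta_0 theta4_0.
have dA : A * dbl B = B * dbl A.
  have ea := congr1 dbl uA; have eb := congr1 dbl uB.
  apply: (lincomb3 (c := 4%:R) (c' := - 2%:R)
    (c'' := - dbl A) ea eb T3DT4).
  rewrite /A /B; ring.
have AB : A = 3%:R * B.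
  apply/eqP; rewrite -subr_eq0; apply/eqP.
  apply: (@dbl_fix0 B); first by rewrite B0.
    by rewrite fpsEB fpsEMnl B0 /A fpsEB !fpsEMnl !fps_dbl0 EP_0.
  by apply: (lincomb1 (c := 1) dA); ring.
have nB : B 0%N != 0 by rewrite B0.
split; apply: (fps_mulI nB); rewrite AB in uA uB.
  by apply: (lincomb1 (c := 1) uA); ring.
by apply: (lincomb1 (c := 1) uB); ring.
Qed.

Lemma EPE : P1 = 2%:R * P2 - 2%:R * T3 + T4.
Proof.
have [e3 e4] := theta_EP; apply: (@torsion_free 2).
by apply: (lincomb2 (c := - 2%:R) (c' := 1) e3 e4); ring.
Qed.
Lemma EP_dbl2E : 4%:R * P4 = 2%:R * P2 + T3 + T4.
Proof.
have [e3 e4] := theta_EP.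
by apply: (lincomb2 (c := 1) (c' := 1) e3 EPE); ring.
Qed.
Lemma deriv_T3' : 3%:R * D T3 = (P2 + T3 - 2%:R * T4) * T3.
Proof.
by apply: (lincomb3 (c := 1) (c' := - T3) (c'' := - T3) deriv_T3 EP_dbl2E EPE); ring.
Qed.
Lemma deriv_T4' : 3%:R * D T4 = (P2 + T4 - 2%:R * T3) * T4.
Proof. by apply: (lincomb2 (c := 1) (c' := T4) deriv_T4 EPE); ring. Qed.

(** Differentiating [EP_dbl2E] and eliminating all derivatives relates $E_4(Q^2)$ to $E_4(Q^4)$. By
    the duplication formulas the quadratic form in $T_3,T_4$ obeys the same relation, so the
    difference $x$ satisfies $x(Q)=4x(Q^2)$. *)
Lemma E4_theta : dbl E4 = T3 ^+ 2 - T3 * T4 + T4 ^+ 2.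
Proof.
apply/eqP; rewrite -subr_eq0; apply/eqP; apply: (@dbl_fix 4%:R) => //.
rewrite rmorph_nat; apply: (@torsion_free 3).
have e2 : 24%:R * D P2 = 4%:R * (P2 ^+ 2 - dbl E4).
  rewrite fps_deriv_dbl.
  have e := congr1 dbl deriv_EP.
  by apply: (lincomb1 (c := 4%:R) e); ring.
have e4 : 48%:R * D P4 = (4%:R * P4) ^+ 2 - 16%:R * dbl (dbl E4).
  have e := congr1 dbl (congr1 dbl deriv_EP); rewrite !fps_deriv_dbl.
  by apply: (lincomb1 (c := 16%:R) e); ring.
have := congr1 D EP_dbl2E; rewrite !fps_derivD !fps_derivMn => e.
rewrite EP_dbl2E in e4.
have e3 := deriv_T3'; have e3' := deriv_T4'.
have e' : 48%:R * D P4 = 4%:R * (P2 ^+ 2 - dbl E4) + 12%:R * (D T3 + D T4).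
  by apply: (lincomb2 (c := 12%:R) (c' := 1) e e2); ring.
have E : 16%:R * dbl (dbl E4) - 4%:R * dbl E4
  = - 3%:R * T3 ^+ 2 + 18%:R * T3 * T4 - 3%:R * T4 ^+ 2.
  by apply: (lincomb4 (c := -1) (c' := 1) (c'' := - 4%:R) (c3 := - 4%:R)
    e' e4 e3 e3'); ring.
apply: (lincomb3 (c := 2%:R * dbl T4 - T3 - T4 - 4%:R * dbl T3) (c' := - 12%:R)
  (c'' := -1) T3DT4 T3T4 E); ring.
Qed.

(** $E_6$ is read off from Ramanujan's $3DE_4=PE_4-E_6$ by differentiating the theta expression of
    $E_4$; the terms with $P(Q^2)$ cancel. *)
Lemma E6_theta :
  2%:R * dbl E6 = (2%:R * T3 - T4) * (T3 + T4) * (2%:R * T4 - T3).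
Proof.
have e : dbl (3%:R * D E4) = P2 * dbl E4 - dbl E6 by rewrite deriv_E4; ring.
rewrite E4_theta in e; have dY : D (T3 ^+ 2 - T3 * T4 + T4 ^+ 2)
    = (2%:R * T3 - T4) * D T3 + (2%:R * T4 - T3) * D T4.
  by rewrite fps_derivD fps_derivB !expr2 !fps_derivM; ring.
have := congr1 D E4_theta; rewrite fps_deriv_dbl dY => f.
have e3 := deriv_T3'; have e3' := deriv_T4'.
apply: (lincomb4 (c := 2%:R) (c' := - 3%:R) (c'' := - (2%:R * T3 - T4))
  (c3 := - (2%:R * T4 - T3)) e f e3 e3').
ring.
Qed.
End ThetaIdentities.

(** * The integral discriminant *)

Lemma sigma_mod12 n : (12 %| 5 * sigma 3 n + 7 * sigma 5 n)%N.
Proof.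
rewrite /sigma !big_distrr -big_split; apply: (@big_ind _ (fun x => 12 %| x)%N) => //= [x y|d _].
  exact: dvdn_add.
rewrite /dvdn -modnDm -modnMm -[in X in (_ + X)%N]modnMm -modnXm -[in X in (_ + X)%N]modnXm.
by have := ltn_pmod d (isT : 0 < 12)%N; move: (d %% 12)%N; do 12?case=> //.
Qed.

(** The expansion of $(E_4^3-E_6^2)/1728$ in the divisor sums. The linear part is
    $144(5\sigma_3+7\sigma_5)/1728$, and the quotient by 12 is exact because $12\mid5d^3+7d^5$ for
    every $d$. The other constants are $3\cdot240^2$, $240^3$ and $504^2$ over 1728. *)
Definition DeltaZ : fps int :=
  Fps (fun n => ((5 * divsum int 3 n + 7 * divsum int 5 n) %/ 12)%Z)
  + 100%:R * divsum int 3 ^+ 2 + 8000%:R * divsum int 3 ^+ 3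
  - 147%:R * divsum int 5 ^+ 2.

Lemma DeltaZE : 1728%:R * DeltaZ = E4 ^+ 3 - E6 ^+ 2.
Proof.
have e : 12%:R * Fps (fun n => ((5 * divsum int 3 n + 7 * divsum int 5 n) %/ 12)%Z)
   = 5%:R * divsum int 3 + 7%:R * divsum int 5.
  apply: fpsP => n; rewrite fpsED !fpsEMnl /=.
  rewrite mulrC divzK //; case: eqP => // _.
  by rewrite !natz dvdzE /= sigma_mod12.
rewrite /DeltaZ /E4 /E6; apply: (lincomb1 (c := 144%:R) e); ring.
Qed.

Lemma DeltaZ_0 : DeltaZ 0%N = 0.
Proof. by rewrite /DeltaZ fpsEB !fpsED !fpsEMnl !fpsEX0 /= div0z. Qed.
Lemma DeltaZ_1 : DeltaZ 1%N = 1.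
Proof.
have s r : sigma r 1 = 1%N by rewrite /sigma big_cons big_nil exp1n.
rewrite /DeltaZ fpsEB !fpsED !fpsEMnl !exprS !expr0 !coefM_1 !fpsEM0 !fpsE1.
by rewrite /= !s.
Qed.
Lemma E4_0 : E4 0%N = 1. Proof. by rewrite fpsED fpsEMnl fpsE1 mulr0 addr0. Qed.
Lemma E6_0 : E6 0%N = 1. Proof. by rewrite fpsEB fpsEMnl fpsE1 mulr0 subr0. Qed.

(** With $x=T_3$, $y=T_4$ this is the discriminant identity
    $4(x^2-xy+y^2)^3-((2x-y)(x+y)(2y-x))^2=27(xy(x-y))^2$, multiplied through by 27 since
    $27\cdot256=4\cdot1728$. *)
Lemma DeltaZ_theta : 256%:R * fps_dbl DeltaZ = (T3 * T4 * (T3 - T4)) ^+ 2.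
Proof.
have := congr1 (@fps_dbl int) DeltaZE => e.
have e' : 1728%:R * fps_dbl DeltaZ = fps_dbl E4 ^+ 3 - fps_dbl E6 ^+ 2.
  by apply: (lincomb1 (c := 1) e); ring.
rewrite E4_theta in e'; have e6 := E6_theta; apply: (@torsion_free 26).
apply: (lincomb2 (c := 4%:R)
  (c' := - (2%:R * fps_dbl E6 + (2%:R * T3 - T4) * (T3 + T4) * (2%:R * T4 - T3)))
  e' e6); ring.
Qed.

(** * Curves with full 2-torsion and no rational point of order 4 *)

Section QuadraticCharacter.
Variables (F : finFieldType) (r : nat).
(* Euler's criterion: the exponent is (#|F| - 1) / 2 when #|F| = 4 r + 3. *)
Definition chi (x : F) : F := x ^+ (2 * r).+1.

Lemma chiM x y : chi (x * y) = chi x * chi y. Proof. exact: exprMn. Qed.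
Lemma chiV x : chi x^-1 = (chi x)^-1. Proof. by rewrite /chi exprVn. Qed.
Lemma chiN x : chi (- x) = - chi x.
Proof. by rewrite /chi exprNn -signr_odd /= oddM mulN1r. Qed.
Lemma chi1 : chi 1 = 1. Proof. exact: expr1n. Qed.
Lemma chi0 : chi 0 = 0. Proof. by rewrite /chi expr0n. Qed.
(** If $x^{2r+1}=1$ then $x=x^{2r+2}$, so $x^{r+1}$ is an explicit square root. *)
Lemma chi_square x : chi x = 1 -> exists2 s, s != 0 & x = s ^+ 2.
Proof.
move=> c; have x0 : x != 0.
  by apply: contra_eq_neq c => ->; rewrite chi0 eq_sym oner_neq0.
exists (x ^+ r.+1); first by rewrite expf_neq0.
by rewrite -[LHS]mul1r -c -exprSr -exprM; congr (_ ^+ _); lia.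
Qed.

Hypothesis cardF : #|F| = (4 * r + 3)%N.

Lemma chi_sqr x : x != 0 -> chi x ^+ 2 = 1.
Proof.
move=> x0; apply: (mulIf x0); rewrite mul1r -exprM -exprSr.
by rewrite -[RHS]expf_card cardF; congr (_ ^+ _); lia.
Qed.
Lemma chiP x : x != 0 -> chi x = 1 \/ chi x = -1.
Proof.
move=> /chi_sqr /eqP; rewrite sqrf_eq1 => /orP[] /eqP; first by left.
by right.
Qed.
Lemma square_chi s : s != 0 -> chi (s ^+ 2) = 1.
Proof. by move=> /chi_sqr; rewrite /chi -!exprM mulnC. Qed.

Hypothesis two_neq0 : 2%:R != 0 :> F.

Lemma one_neqN1 : 1 <> -1 :> F.
Proof. by move=> /eqP; rewrite -subr_eq0 opprK -[1 + 1]/(2%:R) (negPf two_neq0). Qed.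

Definition Lam : {set F} := [set l | (chi l == -1) && (chi (1 - l) == -1)].

Lemma LamP l : reflect (chi l = -1 /\ chi (1 - l) = -1) (l \in Lam).
Proof. by rewrite inE; apply: (iffP andP) => [] [] /eqP ? /eqP ?. Qed.
Lemma chiN1_neq0 x : chi x = -1 -> x != 0.
Proof.
by move=> c; apply: contra_eq_neq c => ->; rewrite chi0 eq_sym oppr_eq0 oner_neq0.
Qed.
Lemma Lam_neq0 l : l \in Lam -> l != 0.
Proof. by move=> /LamP[/chiN1_neq0]. Qed.
Lemma Lam_neq1 l : l \in Lam -> 1 - l != 0.
Proof. by move=> /LamP[_ /chiN1_neq0]. Qed.
Lemma Lam_sub l : l \in Lam -> 1 - l \in Lam.
Proof. by move=> /LamP[h1 h2]; apply/LamP; rewrite subKr. Qed.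
Lemma Lam_inv l : l \in Lam -> l^-1 \in Lam.
Proof.
move=> h; have /LamP[h1 h2] := h; have l0 := Lam_neq0 h; apply/LamP.
have -> : 1 - l^-1 = - ((1 - l) * l^-1) by field.
by rewrite chiN chiM chiV h1 h2 invrN invr1 mulrNN mulr1.
Qed.

(* The j-invariant of the Legendre curve Y^2 = X (X - 1) (X - l). *)
Definition jl (l : F) : F :=
  256%:R * (l ^+ 2 - l + 1) ^+ 3 / (l ^+ 2 * (1 - l) ^+ 2).

Section Curve.
Hypothesis three_neq0 : 3%:R != 0 :> F.
Variable E : weierstrass F.
Definition cubic (x : F) : F := x ^+ 3 + E.1 * x + E.2.

Lemma eq_oppr (y : F) : (y == - y) = (y == 0).
Proof.
rewrite -subr_eq0 opprK -mulr2n -mulr_natl mulf_eq0 (negPf two_neq0).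
by [].
Qed.

Lemma torsion2P (P : Defs.point F) : (P \in torsion E 2) =
  (if P is Some (x, y) then (y == 0) && (cubic x == 0) else true).
Proof.
rewrite inE; case: P => [[x y]|] //=.
rewrite eqxx /= eq_oppr; case: (eqVneq y 0) => [->|y0] /=; last by rewrite andbF.
by rewrite expr0n /= eq_sym andbT.
Qed.

Lemma torsion24 : torsion E 2 \subset torsion E 4.
Proof.
apply/fintype.subsetP => P; rewrite torsion2P inE; case: P => [[x y]|] //=.
move=> /andP[/eqP -> /eqP cx].
by rewrite /= oppr0 !eqxx /= oppr0 !eqxx /= expr0n /= -/(cubic x) cx eqxx.
Qed.

(* If P has order 4 then its double (x3, 0) is a point of order 2, and the
   tangent at P is the line through it. *)
Lemma torsion4_square x y : y != 0 -> Some (x, y) \in torsion E 4 ->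
  exists2 x3, cubic x3 = 0 &
    forall e, cubic e = 0 -> e != x3 -> chi (x3 - e) = 1.
Proof.
move=> y0; rewrite inE => /andP[/eqP oc].
rewrite [iter _ _ _]/= eqxx /= eq_oppr (negPf y0).
set l := (3%:R * x ^+ 2 + E.1) / _; set x3 := l ^+ 2 - x - x.
set y3 := l * (x - x3) - y.
have el : l * (2%:R * y) = 3%:R * x ^+ 2 + E.1 by rewrite /l divfK // mulf_neq0.
have oc' : y ^+ 2 = cubic x by [].
(* The tangent at $P$ meets the curve twice at $x$ and once more at abscissa $x_3$. *)
have id X : cubic X = (y + l * (X - x)) ^+ 2 + (X - x) ^+ 2 * (X - x3).
  rewrite /x3 /cubic; move: el oc => el oc.
  apply: (lincomb2 (c := -1) (c' := - (X - x)) oc el); ring.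
(* If $x=x_3$ then $2P=-P$, so $3P=O$ and $4P=P\ne O$. *)
case: (eqVneq x x3) => [xx3|xx3] /=.
  have -> : y3 = - y by rewrite /y3 -xx3 subrr mulr0 sub0r.
  by rewrite opprK eqxx.
set l2 := (y3 - y) / (x3 - x); set x4 := l2 ^+ 2 - x - x3.
case: ifP => [/andP[/eqP xx4 _] _ | _ /eqP //].
have d0 : x3 - x != 0 by rewrite subr_eq0 eq_sym.
have e2 : l2 * (x3 - x) = y3 - y by rewrite /l2 divfK.
(* $4P=O$ forces $3P$ to have the abscissa of $P$, so the chord slope $l_2$ is $\pm l$. The sign $-$
   gives $2y=0$; the sign $+$ puts $(x_3,0)$ on the tangent. *)
have : l2 ^+ 2 == l ^+ 2.
  by apply/eqP; move: xx4; rewrite /x4 => xx4;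
    apply: (lincomb1 (c := -1) xx4); rewrite /x3; ring.
rewrite eqf_sqr => /orP[] /eqP ll; last first.
  have : 2%:R * y == 0.
    by apply/eqP; apply: (lincomb2 (c := 1) (c' := x - x3) e2 ll); rewrite /y3; ring.
  by rewrite mulf_eq0 (negPf two_neq0) (negPf y0).
have yl : y = l * (x - x3).
  apply: (mulfI two_neq0).
  by apply: (lincomb2 (c := 1) (c' := x - x3) e2 ll); rewrite /y3; ring.
have l0 : l != 0 by apply: contraNneq y0 => l0; rewrite yl l0 mul0r.
exists x3; first by rewrite id yl; ring.
move=> e ce ex3.
have ex : e != x.
  apply: contraNneq y0 => ex; have := oc'; rewrite -ex ce => /eqP.
  by rewrite expf_eq0.
have e30 : e - x3 != 0 by rewrite subr_eq0.
(* At a root $e$ the tangent identity reads $0=l^2(e-x_3)^2+(e-x)^2(e-x_3)$; divide by $e-x_3$. *)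
have : x3 - e = ((e - x) / l) ^+ 2.
  rewrite expr_div_n; apply: (canRL (mulfK (expf_neq0 2 l0))).
  apply: (mulfI e30).
  have := id e; rewrite ce => ide.
  by apply: (lincomb2 (c := 1) (c' := y + l * (e - x) + l * (e - x3)) ide yl); ring.
by move=> ->; apply: square_chi; rewrite mulf_neq0 ?invr_neq0 // subr_eq0.
Qed.

Lemma square_torsion4 e1 e2 e3 s t : s != 0 -> t != 0 ->
    E.1 = e1 * e2 + e1 * e3 + e2 * e3 -> E.2 = - (e1 * e2 * e3) ->
    e1 + e2 + e3 = 0 -> e1 - e2 = s ^+ 2 -> e1 - e3 = t ^+ 2 -> e2 != e3 ->
  torsion E 4 != torsion E 2.
Proof.
move=> s0 t0 eA eB sum0 es et e23.
have E3 : e3 = - e1 - e2 by apply: (lincomb1 (c := 1) sum0); ring.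
have E2 : e2 = e1 - s ^+ 2 by rewrite -es; ring.
have st0 : s + t != 0.
  apply: contraNneq e23 => st; apply/eqP.
  have e : e1 - e2 = e1 - e3.
    by rewrite es et; apply: (lincomb1 (c := s - t) st); ring.
  by apply: (lincomb1 (c := -1) e); ring.
(* A half of $(e_1,0)$: the factors $x-e_i$ are $st$, $s(s+t)$, $t(s+t)$, and the tangent there has
   slope $s+t$. *)
pose x := e1 + s * t; pose y := s * t * (s + t).
have y0 : y != 0 by rewrite !mulf_neq0.
have oc : y ^+ 2 = cubic x.
  have : cubic x = (x - e1) * (x - e2) * (x - e3).
    by rewrite /cubic eA eB E3; ring.
  have -> : x - e2 = s * t + s ^+ 2 by rewrite -es /x; ring.
  have -> : x - e3 = s * t + t ^+ 2 by rewrite -et /x; ring.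
  by move=> ->; rewrite /x /y; ring.
have d2 : (3%:R * x ^+ 2 + E.1) / (2%:R * y) = s + t.
  apply: (canLR (mulfK _)); first by rewrite mulf_neq0.
  rewrite eA /x /y E3.
  have h1 : s ^+ 2 = e1 - e2 by rewrite es.
  have h2 : t ^+ 2 = 2%:R * e1 + e2 by rewrite -et E3; ring.
  have -> : (s + t) * (2%:R * (s * t * (s + t)))
    = 2%:R * s * t * (s ^+ 2 + t ^+ 2) + 4%:R * (s ^+ 2 * t ^+ 2) by ring.
  have -> : 3%:R * (e1 + s * t) ^+ 2 = 3%:R * e1 ^+ 2 + 6%:R * e1 * s * t
     + 3%:R * (s ^+ 2 * t ^+ 2) by ring.
  rewrite h1 h2; ring.
apply/eqP => tt; have : Some (x, y) \in torsion E 4.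
  rewrite inE /= oc eqxx /= eq_oppr (negPf y0) d2.
  have -> : (s + t) ^+ 2 - x - x = e1.
    have -> : (s + t) ^+ 2 = s ^+ 2 + t ^+ 2 + 2%:R * (s * t) by ring.
    by rewrite -es -et E3 /x; ring.
  have -> : (s + t) * (x - e1) - y = 0 by rewrite /x /y; ring.
  have xe : (x == e1) = false.
    by rewrite -subr_eq0 /x addrAC subrr add0r mulf_eq0 (negPf s0) (negPf t0).
  rewrite xe /=.
  have -> : (0 - y) / (e1 - x) = s + t.
    apply: (canLR (mulfK _)); first by rewrite subr_eq0 eq_sym xe.
    by rewrite /x /y; ring.
  have -> : (s + t) ^+ 2 - x - e1 = x.
    have -> : (s + t) ^+ 2 = s ^+ 2 + t ^+ 2 + 2%:R * (s * t) by ring.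
    by rewrite -es -et E3 /x; ring.
  by rewrite subrr mulr0 sub0r opprK !eqxx.
by rewrite tt torsion2P (negPf y0).
Qed.
End Curve.
End QuadraticCharacter.

(** * Admissible curves and Legendre parameters *)

Section Admissible.
Variables (F : finFieldType) (r : nat).
Hypothesis cardF : #|F| = (4 * r + 3)%N.
Hypothesis two_neq0 : 2%:R != 0 :> F.
Hypothesis three_neq0 : 3%:R != 0 :> F.
Local Notation chi := (@chi F r).
Local Notation Lam := (Lam F r).

Lemma cubic_roots (E : weierstrass F) e1 e2 e3 :
    e1 != e2 -> e1 != e3 -> e2 != e3 ->
    cubic E e1 = 0 -> cubic E e2 = 0 -> cubic E e3 = 0 ->
  [/\ E.1 = e1 * e2 + e1 * e3 + e2 * e3, E.2 = - (e1 * e2 * e3) &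
      e1 + e2 + e3 = 0].
Proof.
move=> n12 n13 n23 c1 c2 c3.
have h12 : e1 ^+ 2 + e1 * e2 + e2 ^+ 2 + E.1 = 0.
  apply: (mulfI (_ : e1 - e2 != 0)); first by rewrite subr_eq0.
  by apply: (lincomb2 (c := 1) (c' := -1) c1 c2); rewrite /cubic; ring.
have h13 : e1 ^+ 2 + e1 * e3 + e3 ^+ 2 + E.1 = 0.
  apply: (mulfI (_ : e1 - e3 != 0)); first by rewrite subr_eq0.
  by apply: (lincomb2 (c := 1) (c' := -1) c1 c3); rewrite /cubic; ring.
have s : e1 + e2 + e3 = 0.
  apply: (mulfI (_ : e2 - e3 != 0)); first by rewrite subr_eq0.
  by apply: (lincomb2 (c := 1) (c' := -1) h12 h13); ring.
have hA : E.1 = e1 * e2 + e1 * e3 + e2 * e3.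
  by apply: (lincomb2 (c := 1) (c' := - (e1 + e2)) h12 s); ring.
split=> //.
by apply: (lincomb3 (c := 1) (c' := - e1) (c'' := - e1 ^+ 2) c1 hA s);
  rewrite /cubic; ring.
Qed.

Lemma cubic_roots_eq (E : weierstrass F) e1 e2 e3 x :
    E.1 = e1 * e2 + e1 * e3 + e2 * e3 -> E.2 = - (e1 * e2 * e3) ->
    e1 + e2 + e3 = 0 ->
  (cubic E x == 0) = [|| x == e1, x == e2 | x == e3].
Proof.
move=> hA hB s; have -> : cubic E x = (x - e1) * (x - e2) * (x - e3).
  by apply: (lincomb3 (c := x) (c' := 1) (c'' := x ^+ 2) hA hB s); rewrite /cubic; ring.
by rewrite !mulf_eq0 !subr_eq0 orbA.
Qed.

Lemma card_torsion2 (E : weierstrass F) :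
  #|torsion E 2| = #|[set x | cubic E x == 0]|.+1.
Proof.
pose h x : Defs.point F := Some (x, 0).
have -> : torsion E 2 = None |: [set h x | x in [set x | cubic E x == 0]].
  apply/setP => P; rewrite torsion2P // !inE; case: P => [[x y]|] //=.
  apply/andP/imsetP => [[/eqP -> cx]|[x' cx' [-> ->]]].
    by exists x; rewrite ?inE.
  by rewrite inE in cx'.
rewrite cardsU1 card_imset; last by move=> x x' [].
by rewrite (_ : None \notin _ = true) //; apply/imsetP => -[].
Qed.

(** With $u=e_2-e_1$ and $v=e_3-e_1$, the denominator is $-(uv(u-v))^2$ and $E.1=-(u^2-uv+v^2)/3$.
    The quotient is homogeneous of degree 0, hence a function of $v/u$. *)
Lemma j_invariant_jl (E : weierstrass F) e1 e2 e3 :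
    E.1 = e1 * e2 + e1 * e3 + e2 * e3 -> E.2 = - (e1 * e2 * e3) ->
    e1 + e2 + e3 = 0 -> e1 != e2 -> e1 != e3 -> e2 != e3 ->
  j_invariant E = jl ((e3 - e1) / (e2 - e1)).
Proof.
move=> hA hB s n12 n13 n23.
have d12 : e2 - e1 != 0 by rewrite subr_eq0 eq_sym.
have d13 : e3 - e1 != 0 by rewrite subr_eq0 eq_sym.
have d23 : e2 - e3 != 0 by rewrite subr_eq0.
have -> : j_invariant E = 1728%:R * (4%:R * E.1 ^+ 3) /
    - ((e2 - e1) * (e3 - e1) * (e2 - e3)) ^+ 2.
  rewrite /j_invariant; congr (_ / _); rewrite hA hB.
  have -> : e3 = - e1 - e2 by apply: (lincomb1 (c := 1) s); ring.
  ring.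
have hA' : E.1 = - ((e2 - e1) ^+ 2 - (e2 - e1) * (e3 - e1) + (e3 - e1) ^+ 2) / 3%:R.
  apply: (canRL (mulfK three_neq0)); rewrite hA.
  have -> : e3 = - e1 - e2 by apply: (lincomb1 (c := 1) s); ring.
  ring.
have -> : e2 - e3 = (e2 - e1) - (e3 - e1) by ring.
have d : (e2 - e1) - (e3 - e1) != 0.
  by have <- : e2 - e3 = (e2 - e1) - (e3 - e1) by ring.
rewrite hA' /jl; move: (e2 - e1) (e3 - e1) d12 d13 d => u v u0 v0 uv0.
by field; rewrite oppr_eq0 expf_eq0 /= !mulf_eq0 !negb_or u0 v0 uv0 three_neq0.
Qed.

(* As -1 is not a square, the quadratic characters of the differences e_i - e_j
   of the 2-torsion abscissas define a tournament on three vertices, and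
   (e_i, 0) is divisible by 2 exactly when i beats the two others. So there is
   no point of order 4 exactly when the tournament is cyclic, i.e. when l and
   1 - l are non-squares for l = (e_3 - e_1) / (e_2 - e_1). *)
Lemma admissible_lam (E : weierstrass F) :
  E \in admissible F -> exists2 l, l \in Lam & jl l = j_invariant E.
Proof.
rewrite inE => /and5P[_ /eqP t2 /eqP t4 _ _].
have tt : torsion E 4 = torsion E 2.
  by apply/esym/eqP; rewrite eqEcard (torsion24 two_neq0) t2 t4.
move: t2; rewrite card_torsion2 => -[]; set A := [set x | _].
rewrite cardE; case e: (enum A) => [|e1 [|e2 [|e3 [|]]]] // _.
have := enum_uniq A; rewrite e /= !inE negb_or andbT.
move=> /andP[/andP[n12 n13] n23].
have c x : x \in enum A -> cubic E x = 0 by rewrite mem_enum inE => /eqP.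
rewrite e in c.
have [hA hB s] : [/\ E.1 = e1 * e2 + e1 * e3 + e2 * e3, E.2 = - (e1 * e2 * e3) &
      e1 + e2 + e3 = 0].
  by apply: cubic_roots => //; apply: c; rewrite !inE eqxx ?orbT.
have key f1 f2 f3 : E.1 = f1 * f2 + f1 * f3 + f2 * f3 -> E.2 = - (f1 * f2 * f3) ->
    f1 + f2 + f3 = 0 -> f2 != f3 -> ~ (chi (f1 - f2) = 1 /\ chi (f1 - f3) = 1).
  move=> gA gB gs f23 [/chi_square[u u0 eu] /chi_square[v v0 ev]].
  by have := square_torsion4 two_neq0 u0 v0 gA gB gs eu ev f23; rewrite tt eqxx.
have k1 := key e1 e2 e3 hA hB s n23.
have k2 : ~ (chi (e2 - e3) = 1 /\ chi (e2 - e1) = 1).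
  by move=> h; apply: (key _ _ _ _ _ _ _ h);
    [rewrite hA; ring|rewrite hB; ring|rewrite -s; ring|rewrite eq_sym].
have k3 : ~ (chi (e3 - e1) = 1 /\ chi (e3 - e2) = 1).
  by move=> h; apply: (key _ _ _ _ _ _ _ h); [rewrite hA; ring|rewrite hB; ring|rewrite -s; ring|].
exists ((e3 - e1) / (e2 - e1)); last by rewrite (j_invariant_jl hA hB s).
have d12 : e2 - e1 != 0 by rewrite subr_eq0 eq_sym.
have d13 : e3 - e1 != 0 by rewrite subr_eq0 eq_sym.
have d23 : e2 - e3 != 0 by rewrite subr_eq0.
have N x y : chi (x - y) = - chi (y - x) by rewrite -chiN opprB.
apply/LamP; have -> : 1 - (e3 - e1) / (e2 - e1) = (e2 - e3) / (e2 - e1) by field.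
rewrite !chiM !chiV.
rewrite N (N e1 e3) in k1; rewrite (N e3 e2) in k3.
have [] := chiP cardF d12; have [] := chiP cardF d13; have [] := chiP cardF d23;
  move=> h1 h2 h3; rewrite h1 h2 h3 ?invrN ?invr1 ?mulr1 ?mul1r ?mulrNN ?opprK in k1 k2 k3 *;
  by [split | case: k1 | case: k2 | case: k3].
Qed.

Lemma lam_admissible l : l \in Lam -> jl l != 0 -> jl l != 1728%:R ->
  exists2 E, E \in admissible F & j_invariant E = jl l.
Proof.
move=> lL j0 j1; have l0 := Lam_neq0 lL; have l1 := Lam_neq1 lL.
(* The Legendre roots $0,1,l$ translated so that their sum is zero. *)
pose e1 := - (1 + l) / 3%:R; pose e2 := (2%:R - l) / 3%:R.
pose e3 := (2%:R * l - 1) / 3%:R.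
pose E : weierstrass F := (e1 * e2 + e1 * e3 + e2 * e3, - (e1 * e2 * e3)).
have d12 : e2 - e1 = 1 by rewrite /e1 /e2; field.
have d13 : e3 - e1 = l by rewrite /e1 /e3; field.
have d23 : e2 - e3 = 1 - l by rewrite /e2 /e3; field.
have s : e1 + e2 + e3 = 0 by rewrite /e1 /e2 /e3; field.
have n12 : e1 != e2 by rewrite eq_sym -subr_eq0 d12 oner_neq0.
have n13 : e1 != e3 by rewrite eq_sym -subr_eq0 d13.
have n23 : e2 != e3 by rewrite -subr_eq0 d23.
have jE : j_invariant E = jl l.
  by rewrite (@j_invariant_jl E e1 e2 e3) // d12 d13 divr1.
have rE x : (cubic E x == 0) = [|| x == e1, x == e2 | x == e3].
  exact: cubic_roots_eq.
have t2 : #|torsion E 2| = 4%N.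
  rewrite card_torsion2; congr _.+1.
  have -> : [set x | cubic E x == 0] = [set e1; e2; e3].
    by apply/setP => x; rewrite !inE rE orbA.
  by rewrite -finset.setUA cardsU1 cards2 !inE negb_or n12 n13 n23.
have tt : torsion E 4 = torsion E 2.
  apply/eqP; rewrite finset.eqEsubset (torsion24 two_neq0) andbT.
  apply/fintype.subsetP => P P4; rewrite torsion2P //.
  case: P P4 => [[x y]|] // P4; case: (eqVneq y 0) => [y0|y0] /=.
    move: P4; rewrite inE => /andP[/= /eqP].
    by rewrite y0 expr0n /= => oc _; rewrite /cubic -oc.
  have [x3 c3 h] := torsion4_square cardF two_neq0 y0 P4.
  have /LamP[h1 h2] := lL; rewrite -d23 in h2; rewrite -d13 in h1.
  have h3 : chi (e1 - e2) = -1 by rewrite -opprB d12 chiN chi1.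
  (* Each root has a non-square difference to the next one: $e_1-e_2=-1$, $e_2-e_3=1-l$,
     $e_3-e_1=l$. So no root can be the double of a point of order 4. *)
  move: c3 => /eqP; rewrite rE => /or3P[] /eqP x3E; rewrite x3E in h.
  - have := h e2; rewrite h3 => H; case: (one_neqN1 two_neq0); apply/esym/H.
      by apply/eqP; rewrite rE eqxx orbT.
    by rewrite eq_sym.
  - have := h e3; rewrite h2 => H; case: (one_neqN1 two_neq0); apply/esym/H.
      by apply/eqP; rewrite rE eqxx !orbT.
    by rewrite eq_sym.
  have := h e1; rewrite h1 => H; case: (one_neqN1 two_neq0); apply/esym/H => //.
  by apply/eqP; rewrite rE eqxx.
exists E => //; rewrite inE t2 tt t2 jE j0 j1 /nonsingular.
rewrite !eqxx !andbT.
have -> : 4%:R * E.1 ^+ 3 + 27%:R * E.2 ^+ 2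
   = - ((e2 - e1) * (e3 - e1) * (e2 - e3)) ^+ 2.
  rewrite /E /=; have -> : e3 = - e1 - e2 by apply: (lincomb1 (c := 1) s); ring.
  ring.
by rewrite oppr_eq0 d12 d13 d23 mul1r expf_neq0 // mulf_neq0.
Qed.

Variables (L : closedFieldType) (iota : {rmorphism F -> L}).

Lemma isomorphic_j (E E' : weierstrass F) :
    E \in admissible F -> E' \in admissible F ->
  isomorphic_over iota E E' = (j_invariant E == j_invariant E').
Proof.
rewrite !inE => /and5P[ns _ _ j0 j1] /and5P[ns' _ _ j0' j1'].
have c0 : 1728%:R * 4%:R != 0 :> F.
  by rewrite (_ : 1728%:R * 4%:R = 2%:R ^+ 8 * 3%:R ^+ 3) ?mulf_neq0 ?expf_neq0 //; ring.
have a0 (G : weierstrass F) : j_invariant G != 0 -> G.1 != 0.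
  by apply: contraNneq => G0; rewrite /j_invariant G0 expr0n !mulr0 mul0r.
have b0 (G : weierstrass F) : nonsingular G -> j_invariant G != 1728%:R -> G.2 != 0.
  rewrite /nonsingular => nG; apply: contraNneq => G0; apply/eqP.
  rewrite /j_invariant; move: nG; rewrite G0 expr0n mulr0 addr0 => nG.
  by rewrite mulfK.
have jE : (j_invariant E == j_invariant E') = (E.1 ^+ 3 * E'.2 ^+ 2 == E'.1 ^+ 3 * E.2 ^+ 2).
  rewrite /j_invariant eqr_div // -subr_eq0 -[RHS]subr_eq0.
  have -> : 1728%:R * (4%:R * E.1 ^+ 3) * (4%:R * E'.1 ^+ 3 + 27%:R * E'.2 ^+ 2)
    - 1728%:R * (4%:R * E'.1 ^+ 3) * (4%:R * E.1 ^+ 3 + 27%:R * E.2 ^+ 2)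
    = (1728%:R * 4%:R) * 3%:R ^+ 3 * (E.1 ^+ 3 * E'.2 ^+ 2 - E'.1 ^+ 3 * E.2 ^+ 2) by ring.
  by rewrite mulf_eq0 (negPf (_ : _ * _ ^+ 3 != 0)) // mulf_neq0 // expf_neq0.
rewrite jE; have A0 := a0 _ j0; have A0' := a0 _ j0'.
have B0 := b0 _ ns j1; have B0' := b0 _ ns' j1'.
apply/idP/eqP => [/asboolP[u [u0 eA eB]]|e].
  apply: (fmorph_inj iota); rewrite !rmorphM /= eA eB; ring.
apply/asboolP; pose a := iota E'.1 / iota E.1; pose b := iota E'.2 / iota E.2.
have iA : iota E.1 != 0 by rewrite fmorph_eq0.
have iA' : iota E'.1 != 0 by rewrite fmorph_eq0.
have iB : iota E.2 != 0 by rewrite fmorph_eq0.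
have iB' : iota E'.2 != 0 by rewrite fmorph_eq0.
have av : a != 0 by rewrite mulf_neq0 ?invr_neq0.
have bv : b != 0 by rewrite mulf_neq0 ?invr_neq0.
have ab : a ^+ 3 = b ^+ 2.
  have ie : iota E.1 ^+ 3 * iota E'.2 ^+ 2 = iota E'.1 ^+ 3 * iota E.2 ^+ 2.
    by rewrite -!rmorphXn -!rmorphM e.
  rewrite /a /b !expr_div_n; apply/eqP; rewrite eqr_div ?expf_neq0 //.
  by rewrite -ie mulrC.
(* $u^4=a$ and $u^6=b$ impose $u^2=b/a$; conversely $a^3=b^2$ gives $(b/a)^2=a$ and $(b/a)^3=b$, so
   one square root in [L] suffices. *)
have [u uE] : exists u, u ^+ 2 = b / a.
  have [u uE] := @solve_monicpoly L 2 (fun i => if i == 0%N then b / a else 0) isT.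
  by exists u; rewrite uE !big_ord_recl big_ord0 /= mul0r !addr0 expr0 mulr1.
exists u; split.
- have : u ^+ 2 != 0 by rewrite uE mulf_neq0 ?invr_neq0.
  by rewrite expf_eq0.
- rewrite (exprM u 2 2) uE expr_div_n -ab (_ : a ^+ 3 / a ^+ 2 = a); last by field.
  by rewrite /a divfK.
rewrite (exprM u 2 3) uE expr_div_n ab (_ : b ^+ 3 / b ^+ 2 = b); last by field.
by rewrite /b divfK.
Qed.

Definition Jset : {set F} := [set jl l | l in Lam] :\: [set 0; 1728%:R].

Lemma transversal_prod (S : {set weierstrass F}) :
    is_transversal S
      (equivalence_partition (isomorphic_over iota) (admissible F))
      (admissible F) ->
  \prod_(E in S) ('X - (j_invariant E)%:P) = \prod_(j in Jset) ('X - j%:P) :> {poly F}.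
Proof.
move=> /and3P[_ /fintype.subsetP SA /forall_inP cS].
pose block E := [set E' in admissible F | isomorphic_over iota E E'].
have cb E : E \in admissible F -> #|S :&: block E| = 1%N.
  by move=> EA; apply/eqP/cS/imsetP; exists E.
have inb E E' : (E' \in S :&: block E)
    = [&& E' \in S, E' \in admissible F & isomorphic_over iota E E'].
  by rewrite finset.in_setI /block finset.in_set.
have inj : {in S &, injective (@j_invariant F)}.
  move=> E E' ES ES' ej; have /eqP/cards1P[G eG] := cb E (SA _ ES).
  have : E \in S :&: block E by rewrite inb ES SA //= isomorphic_j ?SA.
  have : E' \in S :&: block E.
    by rewrite inb ES' SA //= isomorphic_j ?SA // ej.
  by rewrite eG !inE => /eqP -> /eqP ->.
rewrite -(big_imset (fun j => 'X - j%:P) inj) /=; apply: eq_bigl => j.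
apply/imsetP/setDP => [[E ES ->]|[/imsetP[l lL ->]]].
  have EA := SA _ ES; have [l lL e] := admissible_lam EA.
  split; first by rewrite -e; apply: imset_f.
  by move: EA; rewrite !inE negb_or => /and5P[_ _ _ -> ->].
rewrite !inE negb_or => /andP[j0 j1].
have [E EA jE] := lam_admissible lL j0 j1.
have /eqP/cards1P[G eG] := cb E EA.
have : G \in S :&: block E by rewrite eG inE.
rewrite inb => /and3P[GS GA]; rewrite isomorphic_j // => /eqP e.
by exists G => //; rewrite -e jE.
Qed.
End Admissible.

(** * The polynomial 1 + X^k + (1 - X)^k modulo p *)

Section LambdaPolynomial.
Variables (F : finFieldType) (r : nat).
Hypothesis cardF : #|F| = (4 * r + 3)%N.
Hypothesis two_neq0 : 2%:R != 0 :> F.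
Local Notation chi := (@chi F r).
Local Notation Lam := (Lam F r).

(** Sort the $l\ne0,1$ by the signs of $\chi(l),\chi(1-l)$. As $\chi(-1)=-1$, inversion exchanges
    $(+,+)$ and $(+,-)$, and $l\mapsto1-l$ exchanges $(+,-)$ and $(-,+)$. The $2r+1$ squares, one of
    them $l=1$, give $r$ elements in each of these classes, and $2r+1-r$ remain for $(-,-)$. *)
Lemma card_Lam : #|Lam| = r.+1.
Proof.
pose A a b := [set l : F | (chi l == a) && (chi (1 - l) == b)].
pose N a := [set l : F | chi l == a].
have n1 : (1 == -1 :> F) = false by apply/negbTE/eqP/one_neqN1.
have neq0 x a : chi x = a -> a != 0 -> x != 0.
  by move=> <-; apply: contraNneq => ->; rewrite chi0.
have eN : #|N 1| = #|N (-1)|.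
  have -> : N (-1) = [set - x | x in N 1].
    apply/setP => x; rewrite inE; apply/eqP/imsetP => [h|[y]].
      by exists (- x); rewrite ?opprK // inE chiN h opprK.
    by rewrite inE => /eqP h ->; rewrite chiN h.
  by rewrite card_imset //; apply: oppr_inj.
have cN : (#|N 1%R| + #|N (-1)%R| + 1 = #|F|)%N.
  rewrite -(cardsC (N 1%R)) -addnA; congr (_ + _)%N.
  have -> : ~: N 1 = 0 |: N (-1).
    apply/setP => x; rewrite !inE; case: (eqVneq x 0) => [->|x0] /=.
      by rewrite chi0 eq_sym oner_eq0.
    by have [->|->] := chiP cardF x0; rewrite ?eqxx ?n1 // eq_sym n1.
  rewrite cardsU1 inE chi0 eq_sym oppr_eq0 oner_eq0 addnC //.
have e1 : #|A 1 1| = #|A 1 (-1)|.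
  have inv a l : l \in A 1 a -> l^-1 \in A 1 (- a).
    rewrite !inE => /andP[/eqP h1 /eqP h2].
    have l0 := neq0 _ _ h1 (oner_neq0 _).
    have -> : 1 - l^-1 = - ((1 - l) * l^-1) by field.
    by rewrite chiN chiM !chiV h1 h2 invr1 mulr1 !eqxx.
  have -> : A 1 (-1) = [set x^-1 | x in A 1 1].
    apply/setP => x; apply/idP/imsetP => [h|[y h ->]]; last exact: inv.
    by exists x^-1; rewrite ?invrK //; have := inv _ _ h; rewrite opprK.
  by rewrite card_imset //; apply: invr_inj.
have e2 : #|A 1 (-1)| = #|A (-1) 1|.
  have -> : A (-1) 1 = [set 1 - x | x in A 1 (-1)].
    apply/setP => x; rewrite inE; apply/andP/imsetP => [[h1 h2]|[y]].
      by exists (1 - x); rewrite ?inE ?h2 subKr ?h1.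
    by rewrite inE => /andP[h1 h2] ->; rewrite subKr.
  rewrite card_imset // => x y /(congr1 (fun z => 1 - z)).
  by rewrite !subKr.
have nN1 : (0 == -1 :> F) = false by rewrite eq_sym oppr_eq0 oner_eq0.
have n1' : (-1 == 1 :> F) = false by rewrite eq_sym.
have n01 : (0 == 1 :> F) = false by rewrite eq_sym oner_eq0.
pose B := [set l : F | chi (1 - l) == 1].
have AE a : N a :&: B = A a 1 by apply/setP => x; rewrite !inE.
have s1 : N 1 :\: B = 1 |: A 1 (-1).
  apply/setP => x; rewrite !inE; case: (eqVneq x 1) => [->|x1] /=.
    by rewrite subrr chi0 chi1 n01 eqxx.
  have x1' : 1 - x != 0 by rewrite subr_eq0 eq_sym.
  by have [->|->] := chiP cardF x1'; rewrite ?eqxx ?n1 ?n1' /= ?andbT ?andbF.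
have s2 : N (-1) :\: B = Lam.
  apply/setP => x; rewrite !inE; case: (eqVneq x 1) => [->|x1] /=.
    by rewrite chi1 n1 /= andbF.
  have x1' : 1 - x != 0 by rewrite subr_eq0 eq_sym.
  by have [->|->] := chiP cardF x1'; rewrite ?eqxx ?n1 ?n1' /= ?andbT ?andbF.
have := cardsID B (N 1); have := cardsID B (N (-1)); rewrite !AE s1 s2 cardsU1.
have -> : (1 \notin A 1 (-1)) = true by rewrite inE subrr chi0 nN1 andbF.
by move: cN; rewrite cardF; lia.
Qed.

Definition Hpoly : {poly F} := 1 + 'X^((2 * r).+2) + (1 - 'X) ^+ (2 * r).+2.

Lemma sqr_dvdp (p : {poly F}) c : root p c -> root p^`() c ->
  ('X - c%:P) ^+ 2 %| p.
Proof.
move=> rp rp'; have /factor_theorem[q e] := rp.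
move: rp'; rewrite e derivM derivXsubC mulr1 rootE !hornerE subrr mulr0 add0r.
by move=> rq; rewrite expr2 dvdp_mul2r ?polyXsubC_eq0 // dvdp_XsubCl.
Qed.

Lemma deriv_Hpoly n : (1 + 'X^(n.+1) + (1 - 'X) ^+ n.+1 : {poly F})^`()
  = n.+1%:R * ('X^n - (1 - 'X) ^+ n).
Proof.
rewrite !derivD -[1]polyC1 derivC derivXn deriv_exp derivB derivC derivX.
by rewrite add0r sub0r mulN1r -mulr_natl -[X in _ + X]mulr_natl mulrN -mulrBr.
Qed.

(* Every element of Lam is a double root, and #|Lam| is half the degree. *)
Lemma Hpoly_prod : Hpoly = 2%:R *: \prod_(l in Lam) ('X - l%:P) ^+ 2.
Proof.
set G := \prod_(l in Lam) _.
have GH : G %| Hpoly.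
  rewrite /G -big_enum /=; have : {subset enum Lam <= Lam} by move=> x; rewrite mem_enum.
  have := enum_uniq Lam; elim: (enum Lam) => [|l s ih] /=.
    by rewrite big_nil dvd1p.
  move=> /andP[ls us] sub; rewrite big_cons Gauss_dvdp.
    rewrite ih // ?andbT => [|x xs]; last by apply: sub; rewrite inE xs orbT.
    have /LamP[h1 h2] : l \in Lam by apply: sub; rewrite inE eqxx.
    (* With $k=2r+2$, $l^k=l\,\chi(l)=-l$ and $(1-l)^k=-(1-l)$, so the value is 0. The derivative is
       $k(\chi(l)-\chi(1-l))=0$. *)
    apply: sqr_dvdp; rewrite rootE /Hpoly.
      rewrite !(hornerE, horner_exp) ![_ ^+ (2 * r).+2]exprS.
      rewrite -/(chi l) -/(chi (1 - l)) h1 h2; apply/eqP; ring.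
    rewrite deriv_Hpoly -polyC_natr hornerCM.
    rewrite !(hornerE, horner_exp) -/(chi l) -/(chi (1 - l)) h1 h2.
    by apply/eqP; ring.
  rewrite coprimep_expl // coprimep_sym coprimep_XsubC rootE horner_prod.
  rewrite prodf_seq_neq0; apply/allP => x xs /=.
  by rewrite horner_exp !hornerE expf_neq0 // subr_eq0; apply: contraNneq ls => ->.
have sG : size G = (2 * r).+3.
  rewrite /G size_prod => [|l _]; last by rewrite expf_neq0 // polyXsubC_eq0.
  rewrite (eq_bigr (fun=> 3%N)) => [|l _]; last by rewrite size_exp_XsubC.
  by rewrite sum_nat_const card_Lam; lia.
have mG : G \is monic.
  by apply: monic_prod => l _; apply: monic_exp; apply: monicXsubC.
(* The exponent is even, so $X^k$ and $(1-X)^k$ both have leading coefficient 1. *)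
have cH : Hpoly`_(2 * r).+2 = 2%:R.
  rewrite /Hpoly -[1 - 'X]opprB exprNn -signr_odd /= oddM /= expr0 mul1r.
  rewrite !coefD coef1 coefXn eqxx /= add0r.
  have := monic_exp (2 * r).+2 (monicXsubC (1 : F)).
  by rewrite monicE lead_coefE size_exp_XsubC /= => /eqP ->.
have sH : (size Hpoly <= (2 * r).+3)%N.
  rewrite /Hpoly -[1 - 'X]opprB exprNn -signr_odd /= oddM /= expr0 mul1r.
  apply: leq_trans (size_polyD _ _) _; rewrite geq_max; apply/andP; split.
    by apply: leq_trans (size_polyD _ _) _; rewrite geq_max size_poly1 size_polyXn leqnn.
  by rewrite (_ : 'X - 1 = 'X - 1%:P) // size_exp_XsubC.
have /dvdpP[q e] := GH.
have H0 : Hpoly != 0 by apply: contra_eq_neq cH => ->; rewrite coef0 eq_sym.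
have q0 : q != 0 by apply: contraNneq H0 => q0; rewrite e q0 mul0r.
have sq : (size q <= 1)%N.
  by move: sH; rewrite e (size_mul q0 (monic_neq0 mG)) sG addnS /= -[X in (_ <= X)%N]add1n leq_add2r.
move: cH; rewrite e (size1_polyC sq) mul_polyC coefZ.
by move: mG; rewrite monicE lead_coefE sG /= => /eqP ->; rewrite mulr1 => ->.
Qed.
End LambdaPolynomial.

(** * Fibres of the Legendre j-invariant on Lam *)

Section Fibers.
Variables (F : finFieldType) (r : nat).
Hypothesis cardF : #|F| = (4 * r + 3)%N.
Hypothesis two_neq0 : 2%:R != 0 :> F.
Hypothesis three_neq0 : 3%:R != 0 :> F.
Local Notation Lam := (Lam F r).

Let n256 : 256%:R != 0 :> F.
Proof. by rewrite (natrX _ 2 8) expf_neq0. Qed.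
Let n1728 : 1728%:R != 0 :> F.
Proof. by rewrite (natrM _ (2 ^ 6) (3 ^ 3)) !natrX mulf_neq0 // expf_neq0. Qed.

(** The numerator of $j(X)-j$ for the Legendre $j$-invariant, divided by 256 to make it monic; it
    has degree 6. *)
Definition jfiber (j : F) : {poly F} :=
  ('X^2 - 'X + 1) ^+ 3 - (j / 256%:R)%:P * ('X^2 * (1 - 'X) ^+ 2).

Lemma root_jfiber j l : l != 0 -> 1 - l != 0 -> root (jfiber j) l = (jl l == j).
Proof.
move=> l0 l1; have h1 : (1 : {poly F}).[l] = 1 by rewrite -[1]polyC1 hornerC.
rewrite rootE /jfiber hornerD hornerN hornerCM horner_exp hornerM !horner_exp.
rewrite !(hornerD, hornerN, hornerXn, hornerX, h1) /jl.
have -> : (l ^+ 2 - l + 1) ^+ 3 - j / 256%:R * (l ^+ 2 * (1 - l) ^+ 2)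
   = (256%:R * (l ^+ 2 - l + 1) ^+ 3 / (l ^+ 2 * (1 - l) ^+ 2) - j)
     * (l ^+ 2 * (1 - l) ^+ 2 / 256%:R) by field; rewrite l0 l1 n256.
rewrite mulf_eq0 subr_eq0 [X in _ || X]negbTE ?orbF //.
by rewrite !mulf_neq0 ?invr_neq0 ?expf_neq0.
Qed.

Lemma size_monic_jfiber j : size (jfiber j) = 7%N /\ jfiber j \is monic.
Proof.
have s3 : size ('X^2 - 'X + 1 : {poly F}) = 3%N.
  rewrite -addrA size_polyDl size_polyXn //.
  apply: leq_ltn_trans (size_polyD _ _) _; rewrite size_polyN size_polyX size_poly1.
  by [].
have m3 : 'X^2 - 'X + 1 \is @monic F.
  rewrite monicE -addrA lead_coefDl ?lead_coefXn // size_polyXn.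
  apply: leq_ltn_trans (size_polyD _ _) _; rewrite size_polyN size_polyX size_poly1.
  by [].
have m9 : ('X^2 - 'X + 1) ^+ 3 \is @monic F by apply: monic_exp.
have s9 : size (('X^2 - 'X + 1) ^+ 3 : {poly F}) = 7%N.
  have := size_exp ('X^2 - 'X + 1 : {poly F}) 3; rewrite s3 /= => h.
  by rewrite -(prednK (_ : 0 < size (('X^2 - 'X + 1 : {poly F}) ^+ 3))%N) ?h // size_poly_gt0 monic_neq0.
have sc : (size (- ((j / 256%:R)%:P * ('X^2 * (1 - 'X) ^+ 2)) : {poly F}) < 7)%N.
  rewrite size_polyN mul_polyC; apply: leq_ltn_trans (size_scale_leq _ _) _.
  rewrite -[1 - 'X]opprB sqrrN mulrC size_mulXn; last first.
    by rewrite expf_neq0 // -[1]polyC1 polyXsubC_eq0.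
  by rewrite -[1]polyC1 size_exp_XsubC.
rewrite /jfiber size_polyDl s9 //; split=> //.
by rewrite monicE lead_coefDl ?s9.
Qed.

Lemma jl_sub l : jl (1 - l) = jl l :> F.
Proof. by rewrite /jl subKr mulrC [in RHS]mulrC [_ ^+ 2 * _]mulrC; congr (_ * (_ * _ ^+ 3)); ring. Qed.
Lemma jl_inv l : l != 0 -> 1 - l != 0 -> jl l^-1 = jl l :> F.
Proof.
by move=> l0 l1; rewrite /jl; field; rewrite l0 l1 -[l - 1]opprB oppr_eq0 l1.
Qed.

(** The orbit of $l$ under the anharmonic group generated by $l\mapsto1-l$ and $l\mapsto1/l$. *)
Definition jorbit (l : F) :=
  [:: l; 1 - l; l^-1; 1 - l^-1; (1 - l)^-1; 1 - (1 - l)^-1].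

Lemma jorbit_Lam l x : l \in Lam -> x \in jorbit l -> x \in Lam /\ jl x = jl l.
Proof.
move=> lL; have l0 := Lam_neq0 lL; have l1 := Lam_neq1 lL.
have l1L := Lam_sub lL; have l'L := Lam_inv lL; have l1'L := Lam_inv l1L.
rewrite !in_cons in_nil orbF => /or4P[/eqP->|/eqP->|/eqP->|/or3P[]/eqP->].
- by split.
- by split=> //; rewrite jl_sub.
- by split=> //; rewrite jl_inv.
- by split; [apply: Lam_sub|rewrite jl_sub jl_inv].
- by split=> //; rewrite jl_inv ?jl_sub ?subKr.
by split; [apply: Lam_sub|rewrite jl_sub jl_inv ?jl_sub ?subKr].
Qed.

Lemma jl_0 l : l \in Lam -> (jl l == 0) = (l ^+ 2 - l + 1 == 0).
Proof.
move=> lL; have l0 := Lam_neq0 lL; have l1 := Lam_neq1 lL.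
rewrite /jl mulf_eq0 invr_eq0 [X in _ || X]negbTE ?orbF ?mulf_neq0 ?expf_neq0 //.
by rewrite mulf_eq0 (negPf n256) expf_eq0.
Qed.

Lemma jl_1728 l : l \in Lam ->
  (jl l == 1728%:R) = [|| l == -1, l == 2%:R | l == 2%:R^-1].
Proof.
move=> lL; have l0 := Lam_neq0 lL; have l1 := Lam_neq1 lL.
have -> : (l == 2%:R^-1) = (2%:R * l - 1 == 0).
  by rewrite subr_eq0 -(inj_eq (mulfI two_neq0)) divff.
rewrite -subr_eq0 -[l == -1]subr_eq0 -[l == 2%:R]subr_eq0 opprK.
have -> : jl l - 1728%:R = 64%:R * ((l + 1) * ((l - 2%:R) * (2%:R * l - 1))) ^+ 2
    / (l ^+ 2 * (1 - l) ^+ 2) by rewrite /jl; field; rewrite l0 l1.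
have n64 : 64%:R != 0 :> F by rewrite (natrX _ 2 6) expf_neq0.
rewrite mulf_eq0 invr_eq0 [X in _ || X]negbTE ?orbF ?mulf_neq0 ?expf_neq0 //.
by rewrite mulf_eq0 (negPf n64) expf_eq0 /= !mulf_eq0.
Qed.

Lemma uniq_jorbit l : l \in Lam -> jl l != 0 -> jl l != 1728%:R ->
  uniq (jorbit l).
Proof.
move=> lL; have l0 := Lam_neq0 lL; have l1 := Lam_neq1 lL.
rewrite jl_0 // jl_1728 // !negb_or => a0 /and3P[].
rewrite -subr_eq0 opprK => b0; rewrite -subr_eq0 => c0 d0.
have {}d0 : 2%:R * l - 1 != 0.
  by apply: contraNneq d0 => h; apply/eqP; apply: (mulfI two_neq0);
    rewrite divff //; apply: (lincomb1 (c := 1) h); ring.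
have D0 : (l + 1) * (l - 2%:R) * (2%:R * l - 1) * (l ^+ 2 - l + 1) != 0.
  by rewrite !mulf_neq0.
(* Each difference of two orbit elements divides [D0], whose factors vanish only over $j=0$ and
   $j=1728$. The fifteen cases below supply the cofactor [z]. *)
have key (x y z : F) : (x - y) * z = (l + 1) * (l - 2%:R) * (2%:R * l - 1) * (l ^+ 2 - l + 1) ->
    x != y.
  by move=> h; apply: contraNneq D0 => xy; rewrite -h xy subrr mul0r.
have l1' : l - 1 != 0 by rewrite -opprB oppr_eq0.
set a := l ^+ 2 - l + 1 in key; set b := l + 1 in key; set c := l - 2%:R in key.
set d := 2%:R * l - 1 in key.
rewrite /= !inE !negb_or !andbT.
do ?(apply/andP; split).
- by apply: (key _ _ (b * c * a)); rewrite /a /b /c /d; field; rewrite ?l0 ?l1 ?l1'.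
- by apply: (key _ _ (l / (l - 1) * c * d * a)); rewrite /a /b /c /d; field; rewrite ?l0 ?l1 ?l1'.
- by apply: (key _ _ (b * c * d * l)); rewrite /a /b /c /d; field; rewrite ?l0 ?l1 ?l1'.
- by apply: (key _ _ (- (1 - l) * b * c * d)); rewrite /a /b /c /d; field; rewrite ?l0 ?l1 ?l1'.
- by apply: (key _ _ (b * d * a * (l - 1) / l)); rewrite /a /b /c /d; field; rewrite ?l0 ?l1 ?l1'.
- by apply: (key _ _ (- l * b * c * d)); rewrite /a /b /c /d; field; rewrite ?l0 ?l1 ?l1'.
- by apply: (key _ _ (- c * d * a * l / (l - 1))); rewrite /a /b /c /d; field; rewrite ?l0 ?l1 ?l1'.
- by apply: (key _ _ (b * d * a * (1 - l) / l)); rewrite /a /b /c /d; field; rewrite ?l0 ?l1 ?l1'.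
- by apply: (key _ _ ((1 - l) * b * c * d)); rewrite /a /b /c /d; field; rewrite ?l0 ?l1 ?l1'.
- by apply: (key _ _ (- l * b * d * a)); rewrite /a /b /c /d; field; rewrite ?l0 ?l1 ?l1'.
- by apply: (key _ _ (- l * (1 - l) * b * c * a)); rewrite /a /b /c /d; field; rewrite ?l0 ?l1 ?l1'.
- by apply: (key _ _ (l * (1 - l) * b * c * d)); rewrite /a /b /c /d; field; rewrite ?l0 ?l1 ?l1'.
- by apply: (key _ _ (- l * (1 - l) * b * c * d)); rewrite /a /b /c /d; field; rewrite ?l0 ?l1 ?l1'.
- by apply: (key _ _ (l * (1 - l) * b * c * a)); rewrite /a /b /c /d; field; rewrite ?l0 ?l1 ?l1'.
- by apply: (key _ _ ((1 - l) * c * d * a)); rewrite /a /b /c /d; field; rewrite ?l0 ?l1 ?l1'.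
Qed.
Local Notation fiber j := (\prod_(x in Lam | jl x == j) ('X - x%:P)).

Lemma prod_fiber (s : seq F) (p : {poly F}) j : uniq s -> p \is monic ->
    size p = (size s).+1 -> all (root p) s ->
    (forall x, (x \in Lam) && (jl x == j) -> root p x) ->
    (forall x, x \in s -> x \in Lam /\ jl x = j) ->
  fiber j = p.
Proof.
move=> us mp sp rs rp hs.
have pE : p = \prod_(x <- s) ('X - x%:P).
  rewrite [LHS](all_roots_prod_XsubC sp rs) ?uniq_rootsE //.
  by rewrite (monicP mp) scale1r.
rewrite [RHS]pE big_uniq //=; apply: eq_bigl => x.
apply/idP/idP => [/rp|/hs[-> ->]]; last by rewrite eqxx.
by rewrite pE root_prod_XsubC.
Qed.

Lemma fiber_generic l : l \in Lam -> jl l != 0 -> jl l != 1728%:R ->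
  fiber (jl l) = jfiber (jl l).
Proof.
move=> lL j0 j1; have [sz mon] := size_monic_jfiber (jl l).
apply: (@prod_fiber (jorbit l)) => //.
- exact: uniq_jorbit.
- apply/allP => x /(jorbit_Lam lL)[xL jx].
  by rewrite root_jfiber ?jx ?(Lam_neq0 xL) ?(Lam_neq1 xL).
- by move=> x /andP[xL jx]; rewrite root_jfiber ?(Lam_neq0 xL) ?(Lam_neq1 xL).
- by move=> x /(jorbit_Lam lL).
Qed.

Lemma prod_XsubC2 a b : ('X - a%:P) * ('X - b%:P)
  = 'X^2 - (a + b)%:P * 'X + (a * b)%:P :> {poly F}.
Proof. by rewrite !rmorphD !rmorphM /=; ring. Qed.

(** Over $j=0$ the orbit collapses to $\{l,1-l\}$: [jfiber 0] is the cube of this quadratic, while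
    the product over [Lam] takes each root once. The roots differ because $(2l-1)^2=-3\ne0$. *)
Lemma fiber_0 l : l \in Lam -> jl l = 0 -> fiber 0 = 'X^2 - 'X + 1.
Proof.
move=> lL j0; have := eqxx (jl l); rewrite {2}j0 jl_0 // => /eqP a0.
have ll : l != 1 - l.
  apply: contraNneq three_neq0 => ll; apply/eqP.
  by apply: (lincomb2 (c := 4%:R) (c' := - (2%:R * l - 1)) a0 ll); ring.
have pE : 'X^2 - 'X + 1 = \prod_(x <- [:: l; 1 - l]) ('X - x%:P).
  rewrite big_cons big_seq1 prod_XsubC2.
  have -> : l + (1 - l) = 1 by ring.
  have -> : l * (1 - l) = 1 by apply: (lincomb1 (c := -1) a0); ring.
  by rewrite polyC1 mul1r.
apply: (@prod_fiber [:: l; 1 - l]).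
- by rewrite /= inE ll.
- by rewrite pE monic_prod_XsubC.
- by rewrite pE size_prod_XsubC.
- by apply/allP => x xs; rewrite pE root_prod_XsubC.
- move=> x /andP[xL]; rewrite jl_0 // => /eqP ax.
  rewrite rootE !(hornerD, hornerN, hornerXn, hornerX) -[1]polyC1 hornerC.
  by rewrite ax.
- move=> x; rewrite !in_cons in_nil orbF => /orP[]/eqP -> //.
  by rewrite jl_sub j0; split=> //; apply: Lam_sub.
Qed.

(** Over $j=1728$ the orbit is $\{-1,2,1/2\}$, and one of its elements in [Lam] brings in the other
    two. Again the product takes each root once, although [jfiber] has them doubled. *)
Lemma fiber_1728 l : l \in Lam -> jl l = 1728%:R ->
  fiber 1728%:R = ('X + 1) * ('X - 2%:R) * ('X - (2%:R^-1)%:P).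
Proof.
move=> lL j1; have := eqxx (jl l); rewrite {2}j1 jl_1728 // => h.
have h2 : 1 - 2%:R = -1 :> F by ring.
have hN : 1 - (-1) = 2%:R :> F by ring.
have hV : 1 - 2%:R^-1 = 2%:R^-1 :> F by field.
have L2 : 2%:R \in Lam.
  case/or3P: h => /eqP le; rewrite le in lL => //.
    by rewrite -hN; apply: Lam_sub.
  by rewrite -[2%:R]invrK; apply: Lam_inv.
have LN : -1 \in Lam by rewrite -h2; apply: Lam_sub.
have LV := Lam_inv L2.
have n1 : -1 != 2%:R :> F.
  apply: contraNneq three_neq0 => e; apply/eqP.
  by apply: (lincomb1 (c := -1) e); ring.
have n2 : -1 != 2%:R^-1 :> F.
  apply: contraNneq three_neq0 => e; apply/eqP.
  have : 2%:R * -1 = 1 :> F by rewrite e divff.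
  by move=> {}e; apply: (lincomb1 (c := -1) e); ring.
have n3 : 2%:R != 2%:R^-1 :> F.
  apply: contraNneq three_neq0 => e; apply/eqP.
  have : 2%:R * 2%:R = 1 :> F by rewrite {2}e divff.
  by move=> {}e; apply: (lincomb1 (c := 1) e); ring.
have pE : ('X + 1) * ('X - 2%:R) * ('X - (2%:R^-1)%:P)
  = \prod_(x <- [:: -1; 2%:R; 2%:R^-1]) ('X - x%:P) :> {poly F}.
  by rewrite !big_cons big_nil mulr1 mulrA rmorphN rmorph1 opprK polyC_natr.
apply: (@prod_fiber [:: -1; 2%:R; 2%:R^-1]).
- by rewrite /= !inE negb_or n1 n2 n3.
- by rewrite pE monic_prod_XsubC.
- by rewrite pE size_prod_XsubC.
- by apply/allP => x xs; rewrite pE root_prod_XsubC.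
- move=> x /andP[xL]; rewrite jl_1728 // => hx.
  by rewrite pE root_prod_XsubC !inE.
- move=> x; rewrite !in_cons in_nil orbF => hx.
  have xL : x \in Lam by case/or3P: hx => /eqP ->.
  by split=> //; apply/eqP; rewrite jl_1728.
Qed.

Definition eps (j : F) : bool := j \in [set jl l | l in Lam].

Lemma prod_Lam : \prod_(l in Lam) ('X - l%:P) =
  \prod_(j in Jset F r) jfiber j * ('X^2 - 'X + 1) ^+ eps 0
  * (('X + 1) * ('X - 2%:R) * ('X - (2%:R^-1)%:P)) ^+ eps 1728%:R.
Proof.
rewrite (partition_big_imset (@jl F)) /=.
rewrite (big_setID [set 0; 1728%:R]) /= -/(Jset F r) mulrC -mulrA; congr (_ * _).
  apply: eq_bigr => j /setDP[/imsetP[l lL ->]]; rewrite !inE negb_or.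
  by case/andP => j0 j1; rewrite -fiber_generic.
rewrite (eq_bigl (fun j => (j \in [set 0; 1728%:R]) && (j \in [set jl l | l in Lam])));
  last by move=> j; rewrite finset.in_setI andbC.
rewrite big_mkcondr big_setU1 /=; last by rewrite inE eq_sym n1728.
rewrite big_set1 /eps; congr (_ * _).
  case: ifP => [/imsetP[l lL /esym jl0]|_]; last by rewrite expr0.
  by rewrite expr1 -(fiber_0 lL jl0).
case: ifP => [/imsetP[l lL /esym jl0]|_]; last by rewrite expr0.
by rewrite expr1 -(fiber_1728 lL jl0).
Qed.

(** Degrees in [prod_Lam]. Doubled, this is the weight decomposition of $k=2(r+1)$, with $n=|J|$ and
    the two bits as $a$ and $b$. *)
Lemma card_Jset : r.+1 = (6 * #|Jset F r| + 2 * eps 0%R + 3 * eps 1728%:R%R)%N.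
Proof.
have m0 j : jfiber j != 0 by rewrite monic_neq0 //; case: (size_monic_jfiber j).
have sJ : size (\prod_(j in Jset F r) jfiber j) = (6 * #|Jset F r|).+1.
  rewrite size_prod => [|j _]; last exact: m0.
  rewrite (eq_bigr (fun=> 7%N)) => [|j _]; last by case: (size_monic_jfiber j).
  rewrite sum_nat_const.
  rewrite -[LHS]/((#|Jset F r| * 7).+1 - #|Jset F r|)%N; lia.
have s0 (b : bool) : size (('X^2 - 'X + 1 : {poly F}) ^+ b) = (2 * b).+1.
  case: b; rewrite ?expr0 ?size_poly1 // expr1 -addrA size_polyDl size_polyXn //.
  apply: leq_ltn_trans (size_polyD _ _) _; rewrite size_polyN size_polyX size_poly1.
  by [].
have s1 (b : bool) : size ((('X + 1) * ('X - 2%:R) * ('X - (2%:R^-1)%:P) : {poly F}) ^+ b)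
    = (3 * b).+1.
  case: b; rewrite ?expr0 ?size_poly1 // expr1.
  have -> : ('X + 1) * ('X - 2%:R) * ('X - (2%:R^-1)%:P)
    = \prod_(x <- [:: -1; 2%:R; 2%:R^-1]) ('X - x%:P) :> {poly F}.
    by rewrite !big_cons big_nil mulr1 mulrA rmorphN rmorph1 opprK polyC_natr.
  by rewrite size_prod_XsubC.
have := congr1 (fun p : {poly F} => size p) prod_Lam.
rewrite -big_enum size_prod_XsubC -cardE (card_Lam cardF two_neq0).
rewrite !size_mul ?mulf_neq0 -?size_poly_gt0 ?sJ ?s0 ?s1 // !addnS /= => -[->].
by [].
Qed.
End Fibers.

(** * The congruence modulo p *)

Lemma homog_pow (K : comNzRingType) (L g a b : K) r k :
    (r.+1 * 2)%N = k -> a * L = a - b ->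
    1 + L ^+ k + (1 - L) ^+ k = 2%:R * g ^+ 2 ->
  a ^+ k + (a - b) ^+ k + b ^+ k = 2%:R * (a ^+ r.+1 * g) ^+ 2.
Proof.
move=> kE aL e; rewrite -aL.
have -> : b = a * (1 - L) by rewrite mulrBr aL mulr1 subKr.
rewrite 2!exprMn exprMn -(exprM a r.+1 2) kE (mulrCA 2%:R) -e.
by rewrite 2!mulrDr mulr1.
Qed.

Section Congruence.
Variables (F : finFieldType) (r : nat).
Hypothesis cardF : #|F| = (4 * r + 3)%N.
Hypothesis two_neq0 : 2%:R != 0 :> F.
Hypothesis three_neq0 : 3%:R != 0 :> F.
Hypothesis charF : (4 * r + 3)%N \in [pchar F].
Local Notation Lam := (Lam F r).
Local Notation toF := (fps_map (intr : {rmorphism int -> F})).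
Local Notation dbl := (@fps_dbl F).
Local Notation A := (toF T3).
Local Notation B := (toF T4).
Local Notation t := (toF (theta int)).

Definition modp_form : fps F :=
  \prod_(j in Jset F r) (toF E4 ^+ 3 - fpsC j * toF DeltaZ)
  * toF E4 ^+ eps r (0 : F) * toF E6 ^+ eps r (1728%:R : F).

Lemma toF_natM n x : toF (n%:R * x) = n%:R * toF x.
Proof. by rewrite rmorphM rmorph_nat. Qed.

Lemma dbl_E4 : dbl (toF E4) = A ^+ 2 - A * B + B ^+ 2.
Proof. by rewrite -fps_map_dbl E4_theta; ring. Qed.
Lemma dbl_E6 : 2%:R * dbl (toF E6) = (2%:R * A - B) * (A + B) * (2%:R * B - A).
Proof. by rewrite -fps_map_dbl -toF_natM E6_theta; ring. Qed.
Lemma dbl_Delta : 256%:R * dbl (toF DeltaZ) = (A * B * (A - B)) ^+ 2.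
Proof. by rewrite -fps_map_dbl -toF_natM DeltaZ_theta; ring. Qed.

Lemma nat_coef0 (n : nat) : n%:R != 0 :> F -> (n%:R : fps F) 0%N != 0.
Proof. by rewrite fpsE_nat. Qed.

Lemma modp_form0 : modp_form 0%N = 1.
Proof.
rewrite /modp_form !fpsEM0 !fpsEX0 fpsE_prod0 !fpsE_map E4_0 E6_0 rmorph1 !expr1n !mulr1.
apply: big1 => j _; rewrite fpsEB fpsEX0 fpsEM0 !fpsE_map E4_0 DeltaZ_0.
by rewrite rmorph1 rmorph0 mulr0 subr0 expr1n.
Qed.

Section Evaluation.
Variable L : fps F.
Hypothesis AL : A * L = A - B.

Definition eval_fps (q : {poly F}) : fps F := (map_poly (@fpsC F) q).[L].
Lemma eval_fpsM p q : eval_fps (p * q) = eval_fps p * eval_fps q.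
Proof. by rewrite /eval_fps rmorphM hornerM. Qed.
Lemma eval_fpsD p q : eval_fps (p + q) = eval_fps p + eval_fps q.
Proof. by rewrite /eval_fps rmorphD hornerD. Qed.
Lemma eval_fpsN p : eval_fps (- p) = - eval_fps p.
Proof. by rewrite /eval_fps rmorphN hornerN. Qed.
Lemma eval_fpsC c : eval_fps c%:P = fpsC c.
Proof. by rewrite /eval_fps map_polyC hornerC. Qed.
Lemma eval_fps1 : eval_fps 1 = 1.
Proof. by rewrite -polyC1 eval_fpsC rmorph1. Qed.
Lemma eval_fps_nat n : eval_fps n%:R = n%:R.
Proof. by rewrite -polyC_natr eval_fpsC rmorph_nat. Qed.
Lemma eval_fpsX : eval_fps 'X = L.
Proof. by rewrite /eval_fps map_polyX hornerX. Qed.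
Lemma eval_fpsXn p n : eval_fps (p ^+ n) = eval_fps p ^+ n.
Proof. by rewrite /eval_fps rmorphXn horner_exp. Qed.
Lemma eval_fps_prod (I : Type) (s : seq I) (P : pred I) (G : I -> {poly F}) :
  eval_fps (\prod_(i <- s | P i) G i) = \prod_(i <- s | P i) eval_fps (G i).
Proof. by rewrite /eval_fps rmorph_prod horner_prod. Qed.

(** As [Lam] has $r+1$ elements and $L=T_2/T_3$, this is $\prod_l(T_2-lT_3)$. *)
Definition Lam_form : fps F := A ^+ r.+1 * \prod_(l in Lam) (L - fpsC l).

Lemma Lam_form_sqr : A ^+ (2 * r).+2 + (A - B) ^+ (2 * r).+2 + B ^+ (2 * r).+2 = 2%:R * Lam_form ^+ 2.
Proof.
have := congr1 eval_fps (Hpoly_prod cardF two_neq0).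
rewrite /Hpoly -mul_polyC 2!eval_fpsD eval_fps1 2!eval_fpsXn eval_fpsD
    eval_fpsN eval_fps1 eval_fpsX eval_fpsM eval_fpsC eval_fps_prod.
under eq_bigr => l _ do rewrite eval_fpsXn eval_fpsD eval_fpsN eval_fpsX eval_fpsC.
rewrite prodrXl rmorph_nat /Lam_form => e.
by apply: (homog_pow (L := L)) => //; lia.
Qed.

Lemma Lam_form_modp : Lam_form = dbl modp_form.
Proof.
have e0 : A ^+ 2 * eval_fps ('X^2 - 'X + 1) = dbl (toF E4).
  rewrite eval_fpsD eval_fpsD eval_fpsN eval_fpsXn eval_fpsX eval_fps1 dbl_E4.
  move: (toF T3) (toF T4) AL => a b aL.
  by apply: (lincomb1 (c := a * L - b) aL); ring.
have e1 : A ^+ 3 * eval_fps (('X + 1) * ('X - 2%:R) * ('X - (2%:R^-1)%:P)) = dbl (toF E6).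
  rewrite eval_fpsM eval_fpsM eval_fpsD eval_fps1 eval_fpsD eval_fpsN
    eval_fps_nat eval_fpsD eval_fpsN eval_fpsC eval_fpsX.
  apply: (fps_mulI (nat_coef0 two_neq0)); rewrite dbl_E6.
  have h : 2%:R * fpsC (2%:R^-1) = 1 :> fps F.
    by rewrite -(rmorph_nat (@fpsC F)) -rmorphM divff // rmorph1.
  move: (fpsC _) (toF T3) (toF T4) AL h => c a b aL h.
  transitivity ((a * L + a) * (a * L - 2%:R * a) * (2%:R * (a * L) - 2%:R * c * a)).
    ring.
  by rewrite h aL; ring.
have ej j : A ^+ 6 * eval_fps (jfiber j) = dbl (toF E4) ^+ 3 - fpsC j * dbl (toF DeltaZ).
  rewrite -e0 /jfiber eval_fpsD eval_fpsN eval_fpsXn eval_fpsM eval_fpsC eval_fpsM eval_fpsXn eval_fpsXn.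
  rewrite eval_fpsD eval_fpsD eval_fpsN eval_fpsXn eval_fpsX eval_fps1
    eval_fpsD eval_fps1 eval_fpsN eval_fpsX.
  have n256 : 256%:R != 0 :> F by rewrite (natrX _ 2 8) expf_neq0.
  have -> : fpsC j = fpsC (j / 256%:R) * 256%:R.
    by rewrite -(rmorph_nat (@fpsC F)) -rmorphM divfK.
  rewrite -[_ * 256%:R * _]mulrA dbl_Delta.
  move: (fpsC _) (toF T3) (toF T4) AL => c a b aL.
  transitivity ((a ^+ 2 * (L ^+ 2 - L + 1)) ^+ 3 - c * (a * (a * L) * (a - a * L)) ^+ 2).
    ring.
  by rewrite aL; ring.
rewrite /Lam_form /modp_form.
have -> : \prod_(l in Lam) (L - fpsC l) = eval_fps (\prod_(l in Lam) ('X - l%:P)).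
  by rewrite eval_fps_prod; apply: eq_bigr => l _; rewrite eval_fpsD eval_fpsN eval_fpsX eval_fpsC.
rewrite (prod_Lam r two_neq0 three_neq0) 2!eval_fpsM eval_fps_prod !eval_fpsXn.
(* The power $T_3^{r+1}$ splits exactly into a sixth power for each $j$, a square for $E_4$ and a
   cube for $E_6$, as [ej], [e0] and [e1] require. *)
rewrite (card_Jset cardF two_neq0 three_neq0).
rewrite exprD exprD (exprM _ 6) (exprM _ 2) (exprM _ 3).
have dM x y : dbl (x * y) = dbl x * dbl y by rewrite rmorphM.
have dB x y : dbl (x - y) = dbl x - dbl y by rewrite rmorphB.
have dX x n : dbl (x ^+ n) = dbl x ^+ n by rewrite rmorphXn.
rewrite [RHS]dM [in RHS]dM [in RHS]dX [in RHS]dX -e0 -e1 -prodr_const.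
have -> : dbl (\prod_(j in Jset F r) (toF E4 ^+ 3 - fpsC j * toF DeltaZ))
   = \prod_(j in Jset F r) (A ^+ 6 * eval_fps (jfiber j)).
  rewrite (rmorph_prod dbl) /=.
  apply: eq_bigr => j _; rewrite ej dB dM dX; congr (_ - _ * _).
  by rewrite fps_dblC.
rewrite [in RHS]big_split /= (exprMn _ (A ^+ 2)) (exprMn _ (A ^+ 3)).
move: (\prod_(i in Jset F r) A ^+ 6) (\prod_(i in Jset F r) eval_fps _) => x y.
move: ((A ^+ 2) ^+ _) ((A ^+ 3) ^+ _) (eval_fps _ ^+ _) (eval_fps _ ^+ _) => u v z w; ring.
Qed.
End Evaluation.

(** Frobenius: $\theta^p-1=(\theta-1)^p$ in characteristic $p=4r+3$, and $\theta-1=O(Q)$. *)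
Lemma toF_theta_pow : vanish (4 * r + 3) (t ^+ (4 * r + 3) - 1).
Proof.
have c : (4 * r + 3)%N \in [pchar (fps F)].
  move: charF; rewrite !inE => /andP[-> /eqP e] /=; apply/eqP.
  by rewrite -(rmorph_nat (@fpsC F)) e rmorph0.
have -> : t ^+ (4 * r + 3) - 1 = (t - 1) ^+ (4 * r + 3).
  rewrite -[t in LHS](subrK 1) exprDn_pchar ?expr1n ?addrK //.
  by rewrite pnatE ?(pcharf_prime c).
rewrite -[X in vanish X _]muln1; apply: vanishX => -[|//] _.
by rewrite fpsEB fpsE1 fpsE_map theta_0 rmorph1 subrr.
Qed.

Lemma modp_form_theta : vanish #|Jset F r|.+1 (modp_form - t).
Proof.
have A0 : A 0%N = 1 by rewrite fpsE_map /T3 fpsEX0 theta_0 expr1n rmorph1.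
have [y Ay] := fps_unit A0; pose L := (A - B) * y.
have AL : A * L = A - B by rewrite /L mulrCA Ay mulr1.
have W2 := Lam_form_sqr AL; have We := Lam_form_modp AL.
set k := (2 * r).+2 in W2.
have kp : (k <= 4 * r + 3)%N by rewrite /k; lia.
pose t4 := toF (fps_flip (theta int)).
(* Since $4k=2p+2$, the power $(x^4)^k$ is $x^2(x^p)^2$. *)
have vp (x : fps F) : vanish (4 * r + 3) (x ^+ (4 * r + 3) - 1) ->
    vanish k ((x ^+ 4) ^+ k - x ^+ 2).
  move=> h; have -> : (x ^+ 4) ^+ k - x ^+ 2
    = x ^+ 2 * (x ^+ (4 * r + 3) + 1) * (x ^+ (4 * r + 3) - 1).
    have -> : (x ^+ 4) ^+ k = x ^+ 2 * (x ^+ (4 * r + 3)) ^+ 2.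
      by rewrite -!exprM -exprD; congr (_ ^+ _); rewrite /k; lia.
    ring.
  by apply: vanishMl; apply: vanishW h.
have h1 : vanish k (A ^+ k - t ^+ 2).
  by rewrite /T3 rmorphXn; apply: vp; apply: toF_theta_pow.
have h2 : vanish k (B ^+ k - t4 ^+ 2).
  rewrite /T4 rmorphXn; apply: vp.
  have := vanish_flip toF_theta_pow.
  by rewrite rmorphB rmorph1 rmorphXn /= -fps_map_flip.
have h3 : vanish k ((A - B) ^+ k).
  rewrite -[X in vanish X _]muln1; apply: vanishX => -[|//] _.
  by rewrite -rmorphB fpsE_map T2_0 rmorph0.
have e : t ^+ 2 + t4 ^+ 2 = 2%:R * dbl t ^+ 2.
  have h := congr1 toF theta_sqr; rewrite -fps_map_dbl /t4.
  by apply: (lincomb1 (c := 1) h); ring.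
(* The equality of squares is factored. The sum [Lam_form L + dbl t] has constant term 2, so it
   cancels and the difference vanishes to order $k$. *)
have h4 : vanish k (2%:R * ((Lam_form L - dbl t) * (Lam_form L + dbl t))).
  apply: vanish_eq (vanishD h1 (vanishD h2 h3)).
  move: W2 e; move: (A ^+ k) (B ^+ k) ((A - B) ^+ k) (Lam_form L) (t ^+ 2)
    (t4 ^+ 2) (dbl t) => a b c v u u4 d W2 e.
  by apply: (lincomb2 (c := 1) (c' := -1) W2 e); ring.
have {}h4 := vanish_cancel (nat_coef0 two_neq0) h4.
rewrite mulrC in h4.
have t0 : t 0%N = 1 by rewrite fpsE_map theta_0 rmorph1.
have {h4}h5 : vanish k (Lam_form L - dbl t).
  by apply: vanish_cancel h4; rewrite fpsED We !fps_dbl0 modp_form0 t0.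
rewrite We -rmorphB /= in h5.
(* The coefficient of $q^i$ is that of $Q^{2i}$, and $2i<k$ for $i\le|J|$ by [card_Jset]. *)
move=> i iJ; have := h5 (i * 2)%N; rewrite fpsE_dbl dvdn_mull // mulnK //; apply.
by have := card_Jset cardF two_neq0 three_neq0; rewrite /k; lia.
Qed.
End Congruence.

(** * Expansions in the nome along the imaginary axis *)

Section Expansions.
Variable R : realType.
Local Notation C := R[i].
Local Open Scope complex_scope.
Implicit Types (g h : R -> C) (G H : fps C) (p s : {poly C}).

(** The norm of [R[i]] takes its values in [R[i]]; this is its real-valued form. *)
Definition mag (z : C) : R := Normc.normc z.

Lemma magE z : `|z| = (mag z)%:C :> C.
Proof. by rewrite normc_def /mag; case: z. Qed.
Lemma magD z w : mag (z + w) <= mag z + mag w.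
Proof. by have := ler_normD z w; rewrite !magE -rmorphD /= lecR. Qed.
Lemma magN z : mag (- z) = mag z.
Proof. by apply: complexI; rewrite -!magE normrN. Qed.
Lemma magB z w : mag (z - w) <= mag z + mag w.
Proof. by rewrite -(magN w) magD. Qed.
Lemma magM z w : mag (z * w) = mag z * mag w.
Proof. by apply: complexI; rewrite rmorphM /= -!magE normrM. Qed.
Lemma magX z n : mag (z ^+ n) = mag z ^+ n.
Proof. by apply: complexI; rewrite rmorphXn /= -!magE normrX. Qed.
Lemma mag_ge0 z : 0 <= mag z.
Proof. by rewrite -lecR -magE normr_ge0. Qed.
Lemma mag_real (r : R) : mag r%:C = `|r|.
Proof. by rewrite /mag /= expr0n addr0 sqrtr_sqr. Qed.
Lemma mag0 : mag 0 = 0. Proof. by rewrite mag_real normr0. Qed.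
Lemma mag_eq0 z : mag z <= 0 -> z = 0.
Proof.
move=> h; apply/eqP; rewrite -normr_eq0 magE; apply/eqP; congr _%:C.
by apply/eqP; rewrite eq_le h mag_ge0.
Qed.
Lemma mag_sum I (r : seq I) (P : pred I) (F : I -> C) :
  mag (\sum_(i <- r | P i) F i) <= \sum_(i <- r | P i) mag (F i).
Proof.
elim/big_rec2: _ => [|i y z _ h]; first by rewrite mag0.
by apply: (le_trans (magD _ _)); rewrite lerD2l.
Qed.

Lemma horner_bound p : exists2 K, 0 <= K &
  forall r : R, 0 <= r <= 1 -> mag p.[r%:C] <= K.
Proof.
exists (\sum_(i < size p) mag p`_i); first by apply: sumr_ge0 => i _; apply: mag_ge0.
move=> r /andP[r0 r1]; rewrite horner_coef; apply: le_trans (mag_sum _ _ _) _.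
apply: ler_sum => i _; rewrite magM magX mag_real ger0_norm //.
by rewrite ler_piMr ?mag_ge0 // exprn_ile1.
Qed.

(* Asymptotic expansion up to O(r^N) as r -> 0+. Expansions multiply without
   any appeal to Cauchy products of convergent series. *)
Definition expands N g G := exists2 p : {poly C},
  (forall i, (i < N)%N -> p`_i = G i) &
  exists2 K : R, 0 <= K & exists2 d : R, 0 < d <= 1 &
    forall r, 0 < r < d -> mag (g r - p.[r%:C]) <= K * r ^+ N.

Lemma expandsW M N g G : (M <= N)%N -> expands N g G -> expands M g G.
Proof.
move=> MN [p pG [K K0 [d /andP[d0 d1] h]]].
exists p; first by move=> i iM; apply: pG; apply: leq_trans MN.
exists K => //; exists d; rewrite ?d0 //.
move=> r rd; apply: le_trans (h r rd) _; apply: ler_wpM2l => //.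
have /andP[r0 {}rd] := rd; apply: ler_wiXn2l => //; first exact: ltW.
by apply: ltW; apply: lt_le_trans d1.
Qed.

Lemma expands_poly N p : expands N (fun r => p.[r%:C]) (fps_poly p).
Proof.
exists p => //; exists 0 => //; exists 1; first by rewrite ltr01 lexx.
by move=> r _; rewrite subrr mag0 mul0r.
Qed.

Lemma expandsC N c : expands N (fun=> c) (fpsC c).
Proof.
have [p pG [K K0 [d dd h]]] := expands_poly N c%:P.
exists p => //; exists K => //; exists d => // r /h.
by rewrite hornerC.
Qed.

Lemma expandsD N g h G H :
  expands N g G -> expands N h H -> expands N (fun r => g r + h r) (G + H).
Proof.
move=> [p pG [K K0 [d /andP[d0 d1] gp]]] [s sH [L L0 [e /andP[e0 e1] hs]]].
exists (p + s); first by move=> i iN; rewrite coefD pG // sH.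
exists (K + L); first exact: addr_ge0.
exists (Num.min d e); first by rewrite lt_min d0 e0 ge_min d1.
move=> r; rewrite lt_min => /and3P[r0 rd re].
rewrite hornerD opprD addrACA mulrDl; apply: le_trans (magD _ _) _.
by apply: lerD; [apply: gp; rewrite r0|apply: hs; rewrite r0].
Qed.

Lemma expandsM N g h G H :
  expands N g G -> expands N h H -> expands N (fun r => g r * h r) (G * H).
Proof.
move=> [p pG [K K0 [d /andP[d0 d1] gp]]] [s sH [L L0 [e /andP[e0 e1] hs]]].
exists (p * s).
  case: N pG sH {gp hs} => // N pG sH i; rewrite ltnS => iN.
  by rewrite (fps_mul_poly (n := N) (x := G) (y := H)).
have [A A0 pA] := horner_bound p; have [B B0 sB] := horner_bound s.
exists (K * (B + L) + A * L); first by rewrite addr_ge0 ?mulr_ge0 ?addr_ge0.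
exists (Num.min d e); first by rewrite lt_min d0 e0 ge_min d1.
move=> r; rewrite lt_min => /and3P[r0 rd re].
have r01 : 0 <= r <= 1 by rewrite (ltW r0) (ltW (lt_le_trans rd d1)).
have gr := gp r; rewrite r0 rd in gr; have hr := hs r; rewrite r0 re in hr.
have {gp hs gr}gr := gr isT; have {hr}hr := hr isT.
have {}pA := pA _ r01; have {}sB := sB _ r01.
have rN : 0 <= r ^+ N by rewrite exprn_ge0 // ltW.
have rN1 : r ^+ N <= 1 by have /andP[? ?] := r01; rewrite exprn_ile1.
have hB : mag (h r) <= B + L.
  rewrite -[h r](subrK s.[r%:C]) addrC; apply: le_trans (magD _ _) _.
  by apply: lerD => //; apply: le_trans hr _; rewrite ler_piMr.
rewrite hornerM; have -> : g r * h r - p.[r%:C] * s.[r%:C]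
  = (g r - p.[r%:C]) * h r + p.[r%:C] * (h r - s.[r%:C]) by ring.
apply: le_trans (magD _ _) _; rewrite !magM mulrDl; apply: lerD.
  by rewrite mulrAC; apply: ler_pM; rewrite ?mag_ge0.
by rewrite -mulrA; apply: ler_pM; rewrite ?mag_ge0.
Qed.

Lemma expandsX N g G n :
  expands N g G -> expands N (fun r => g r ^+ n) (G ^+ n).
Proof.
move=> h; elim: n => [|n ih].
  by have := expandsC N 1; rewrite rmorph1; apply.
rewrite exprS; have := expandsM h ih; congr expands.
by apply/funext => r; rewrite exprS.
Qed.

Lemma expands_sum N n (g : nat -> R -> C) (G : nat -> fps C) :
  (forall i, (i < n)%N -> expands N (g i) (G i)) ->
  expands N (fun r => \sum_(i < n) g i r) (\sum_(i < n) G i).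
Proof.
elim: n => [|n ih] h.
  rewrite big_ord0 -(rmorph0 (@fpsC C)).
  by under eq_fun do rewrite big_ord0; apply: expandsC.
rewrite big_ord_recr /=; under eq_fun do rewrite big_ord_recr /=.
by apply: expandsD; [apply: ih => i iN; apply: h; lia|apply: h].
Qed.

(** $g(r)=r^m(G_m+O(r))$, and the bracket is non-zero for small $r$. *)
Lemma expands_lead m g G : expands m.+1 g G ->
    (forall i, (i < m)%N -> G i = 0) -> G m != 0 ->
  exists2 d : R, 0 < d & forall r, 0 < r < d -> g r != 0.
Proof.
move=> [p pG [K K0 [d /andP[d0 d1] gp]]] G0 Gm.
have [s sE] : exists s, p = 'X^m * ((G m)%:P + 'X * s).
  exists (drop_poly m.+1 p); rewrite -{1}(poly_take_drop m.+1 p) mulrDr.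
  rewrite mulrA -exprSr [_ * drop_poly _ _]mulrC; congr (_ + _).
  apply/polyP => i; rewrite coef_take_poly coefXnM coefC.
  case: (ltngtP i m) => [im|im|->]; last by rewrite ltnSn subnn /= pG.
    by rewrite (ltn_trans im (ltnSn m)) pG ?G0 //; lia.
  by rewrite ltnS leqNgt im /= gtn_eqF // subn_gt0.
have [A A0 sA] := horner_bound s.
have Gm0 : 0 < mag (G m).
  by rewrite lt_neqAle mag_ge0 andbT eq_sym; apply: contraNneq Gm => /eqP;
    rewrite eq_le => /andP[/mag_eq0 -> _].
(* A zero of $g$ at $r$ would give $|G_m|\le(A+K)r$, which fails for $r<e$; the 1 keeps the
   denominator positive. *)
pose e := mag (G m) / (A + K + 1).
have AK : 0 < A + K + 1 by rewrite ltr_wpDl ?addr_ge0.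
exists (Num.min d e); first by rewrite lt_min d0 divr_gt0.
move=> r; rewrite lt_min => /and3P[r0 rd re]; apply/eqP => gr.
have r01 : 0 <= r <= 1 by rewrite (ltW r0) (ltW (lt_le_trans rd d1)).
have := gp r; rewrite r0 rd gr sub0r magN => /(_ isT).
rewrite sE hornerM hornerXn magM magX mag_real ger0_norm ?(ltW r0) //.
rewrite exprSr mulrCA ler_pM2l ?exprn_gt0 // hornerD hornerC hornerM hornerX => h.
have : mag (G m) <= K * r + r * A.
  rewrite -[G m](addrK (r%:C * s.[r%:C])); apply: le_trans (magB _ _) _.
  apply: lerD => //; rewrite magM mag_real ger0_norm ?(ltW r0) //.
  by rewrite ler_pM2l // sA.
apply/negP; rewrite -ltNge; move: re; rewrite /e ltr_pdivlMr //.
by apply: le_lt_trans; nra.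
Qed.

Lemma expands_eq0 N g G (d : R) : 0 < d -> (forall r, 0 < r < d -> g r = 0) ->
  expands N g G -> vanish N G.
Proof.
move=> d0 g0 h n; elim/ltn_ind: n => n ih nN; apply/eqP/negPn/negP => Gn.
have hn := expandsW nN h.
have [|e e0 gn] := expands_lead hn _ Gn.
  by move=> i iN; apply: ih => //; apply: ltn_trans nN.
pose r := Num.min d e / 2%:R.
have m0 : 0 < Num.min d e by rewrite lt_min d0.
have rm : r < Num.min d e by rewrite /r; lra.
have r0 : 0 < r by rewrite /r; lra.
move: rm; rewrite lt_min => /andP[rd re].
by move: (gn r); rewrite r0 re g0 ?r0 // eqxx => /(_ isT).
Qed.

End Expansions.

(** * Convergent expansions and the Eisenstein coefficients *)

Section QExpansions.
Variable R : realType.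
Local Notation C := R[i].
Local Open Scope complex_scope.
Local Open Scope classical_set_scope.

Lemma cvg_mag (u : nat -> C) (l : C) : u @ \oo --> l <->
  forall e : R, 0 < e -> exists N, forall n, (N <= n)%N -> mag (l - u n) <= e.
Proof.
split=> [/cvgrPdist_le h e e0 | h].
  have e0' : 0 < e%:C by rewrite ltcR.
  by have [N _ hN] := h _ e0'; exists N => n Nn; have := hN n Nn; rewrite magE lecR.
apply/cvgrPdist_le => e e0.
have ee : e = (complex.Re e)%:C by apply/eqP; rewrite eq_sym RRe_real ?gtr0_real.
have [|N hN] := h (complex.Re e); first by rewrite -ltcR -ee.
exists N => // n Nn /=; rewrite magE ee lecR; exact: hN.
Qed.

(** Convergence at $r_0$ bounds $|c_n|r_0^n$ by some $M$. For $r\le r_0/2$ the tail is then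
    dominated by a geometric series of ratio $x=r/r_0\le1/2$, whence the bound $2Mx^N$. *)
Lemma series_expands (c : nat -> C) (g : R -> C) (d : R) N : 0 < d ->
    (forall r, 0 < r < d -> series (fun n => c n * r%:C ^+ n) @ \oo --> g r) ->
  expands N g (Fps c).
Proof.
move=> d0 h; pose r0 := Num.min d 1 / 2%:R.
have m0 : 0 < Num.min d 1 by rewrite lt_min d0 ltr01.
have m1 : Num.min d 1 <= 1 by rewrite ge_min lexx orbT.
have md : Num.min d 1 <= d by rewrite ge_min lexx.
have r00 : 0 < r0 by rewrite /r0; lra.
have [M M0 cM] : exists2 M : R, 0 <= M & forall n, mag (c n) * r0 ^+ n <= M.
  have := h r0; rewrite r00 (_ : r0 < d) => [/(_ isT)|]; last by rewrite /r0; lra.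
  move=> /(cvgP (g r0)) /cvg_series_cvg_0 /cvg_mag /(_ _ ltr01) [n0 hn0].
  exists (1 + \sum_(i < n0) mag (c i) * r0 ^+ i).
    by rewrite addr_ge0 // sumr_ge0 // => i _; rewrite mulr_ge0 ?mag_ge0 // exprn_ge0 // ltW.
  move=> n; case: (leqP n0 n) => [/hn0|nn].
    rewrite sub0r magN magM magX mag_real ger0_norm ?(ltW r00) // => le1.
    apply: le_trans le1 _; rewrite lerDl sumr_ge0 // => i _.
    by rewrite mulr_ge0 ?mag_ge0 // exprn_ge0 // ltW.
  rewrite (bigD1 (Ordinal nn)) //= addrCA lerDl addr_ge0 // sumr_ge0 // => i _.
  by rewrite mulr_ge0 ?mag_ge0 // exprn_ge0 // ltW.
exists (\poly_(i < N) c i); first by move=> i iN; rewrite coef_poly iN.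
exists (2%:R * M / r0 ^+ N).
  by rewrite divr_ge0 ?mulr_ge0 // exprn_ge0 // ltW.
exists (r0 / 2%:R); first by rewrite /r0; lra.
move=> r /andP[rp rr0]; have [x xE] : exists x, x = r / r0 by exists (r / r0).
have x0 : 0 <= x by rewrite xE divr_ge0 ?ltW.
have x12 : x <= 1 / 2%:R by rewrite xE ler_pdivrMr //; lra.
have rx : r = x * r0 by rewrite xE divfK // gt_eqF.
have -> : 2%:R * M / r0 ^+ N * r ^+ N = 2%:R * M * x ^+ N.
  by rewrite rx [(x * r0) ^+ N]exprMn [_ * r0 ^+ N]mulrC mulrA divfK // expf_neq0 // gt_eqF.
have := h r; rewrite rp (_ : r < d) => [/(_ isT)|]; last by rewrite /r0 in rr0; lra.
move=> /cvg_mag hr.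
have part j : mag (series (fun n => c n * r%:C ^+ n) (N + j)%N
    - (\poly_(i < N) c i).[r%:C]) <= 2%:R * M * x ^+ N.
  have -> : series (fun n => c n * r%:C ^+ n) (N + j)%N - (\poly_(i < N) c i).[r%:C]
     = \sum_(i < j) c (N + i)%N * r%:C ^+ (N + i).
    rewrite seriesEord /= big_split_ord /= horner_poly addrAC subrr add0r.
    by [].
  (* The subtracted term $x^{N+j}$ is kept so that the induction on [j] closes. *)
  have le : \sum_(i < j) M * x ^+ (N + i) <= 2%:R * M * (x ^+ N - x ^+ (N + j)).
    elim: j => [|j ih]; first by rewrite big_ord0 addn0 subrr mulr0.
    rewrite big_ord_recr /= addnS exprSr; set y := x ^+ (N + j) in ih *.
    have y0 : 0 <= y by rewrite exprn_ge0.
    have : M * y <= 2%:R * M * (y - y * x); last by move: ih; lra.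
    rewrite [2%:R * M]mulrC -mulrA ler_wpM2l //.
    have : y * x <= y * (1 / 2%:R) by rewrite ler_wpM2l.
    lra.
  apply: le_trans (mag_sum _ _ _) _; apply: le_trans (_ : _ <= \sum_(i < j) M * x ^+ (N + i)) _.
    apply: ler_sum => i _; rewrite magM magX mag_real ger0_norm ?(ltW rp) //.
    by rewrite rx exprMn mulrCA mulrC ler_wpM2r // exprn_ge0.
  apply: le_trans le _; rewrite ler_wpM2l ?mulr_ge0 // gerBl exprn_ge0 //.
apply/ler_addgt0Pr => e e0; have [n1 hn1] := hr e e0.
have := hn1 (N + n1)%N (leq_addl _ _); have := part n1.
set sN := series _ _; set pr := _.[_] => h1 h2.
rewrite -[g r](subrK sN) -addrA; apply: le_trans (magD _ _) _.
by rewrite [leRHS]addrC lerD.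
Qed.

(** [eisenstein] is defined through [limn], so convergence has to be established. The coefficients
    are real, and comparison with a geometric series over the reals is transferred to [R[i]]. *)
Lemma geometric_cvg (c : nat -> R) (K B r : R) : 0 <= K -> 0 < B ->
    (forall n, `|c n| <= K * B ^+ n) -> 0 < r < (B * 2%:R)^-1 ->
  cvgn (series (fun n => (c n)%:C * r%:C ^+ n) : nat -> C).
Proof.
move=> K0 B0 cK /andP[r0 rB].
have Br : 0 <= B * r <= 1 / 2%:R.
  have h : r * (B * 2%:R) < 1 by rewrite -ltr_pdivlMr ?mulr_gt0 // div1r.
  by rewrite mulr_ge0 ?ltW //=; move: h; lra.
have cv : cvgn (series (fun n => c n * r ^+ n)).
  apply: normed_cvg.
  apply: (@series_le_cvg _ _ (fun n => K * (B * r) ^+ n)) => [n|n|n|].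
  - exact: normr_ge0.
  - by rewrite mulr_ge0 // exprn_ge0 //; case/andP: Br.
  - rewrite /= normrM normrX (ger0_norm (ltW r0)) exprMn mulrA ler_wpM2r //.
    by rewrite exprn_ge0 // ltW.
  apply: is_cvg_geometric_series; rewrite ger0_norm; case/andP: Br => // _ h.
  by apply: le_lt_trans h _; lra.
apply/cvg_ex; exists (limn (series (fun n => c n * r ^+ n)))%:C.
apply/cvg_mag => e e0; move/cvgrPdist_le: cv => /(_ e e0) [N _ hN].
exists N => n Nn; have := hN n Nn.
have -> : series (fun n => (c n)%:C * r%:C ^+ n) n
  = (series (fun n => c n * r ^+ n) n)%:C :> C.
  rewrite !seriesEord rmorph_sum; apply: eq_bigr => i _.
  by rewrite rmorphM rmorphXn.
by rewrite -rmorphB mag_real.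
Qed.

(* The point of the imaginary axis with nome r. *)
Definition tau_of (r : R) : C := 0 +i* (- ln r / (pi *+ 2)).

Lemma tau_ofP r : 0 < r < 1 -> upper_half_plane (tau_of r).
Proof.
move=> r01; rewrite /upper_half_plane /= divr_gt0 ?oppr_gt0 ?ln_lt0 //.
by rewrite pmulrn_lgt0 // pi_gt0.
Qed.

Lemma nome_tau_of r : 0 < r -> nome (tau_of r) = r%:C.
Proof.
move=> r0; have e : pi *+ 2 * (- ln r / (pi *+ 2)) = - ln r :> R.
  by rewrite mulrC divfK // gt_eqF // pmulrn_lgt0 // pi_gt0.
by rewrite /nome /tau_of /= e mulr0 cos0 sin0 opprK lnK ?posrE // mulr1.
Qed.

Lemma qterm_tau_of c r : 0 < r ->
  qterm c (tau_of r) = fun n => c n * r%:C ^+ n.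
Proof. by move=> r0; apply/funext => n; rewrite /qterm nome_tau_of. Qed.

Lemma bernoulli_seqS m s b : bernoulli_seq m = s ->
  ((m == 0%N)%:R - \sum_(j < m) 'C(m.+1, j)%:R * s`_j) / m.+1%:R = b ->
  bernoulli_seq m.+1 = rcons s b.
Proof. by move=> <- <-. Qed.
Lemma bernoulli_seq5 : bernoulli_seq 5 = [:: 1; - 1 / 2%:R; 1 / 6%:R; 0; - 1 / 30%:R].
Proof.
have e0 : bernoulli_seq 0 = [::] by [].
have e1 := bernoulli_seqS (b := 1) e0.
have {e0}e1 := e1 ltac:(by rewrite big_ord0 /= subr0 divr1).
have e2 := bernoulli_seqS (b := - 1 / 2%:R) e1.
have {e1}e2 := e2 ltac:(rewrite !big_ord_recl big_ord0 /= /bump /= bin0; by field).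
have e3 := bernoulli_seqS (b := 1 / 6%:R) e2.
have {e2}e3 := e3 ltac:(rewrite !big_ord_recl big_ord0 /= /bump /= bin0 bin1; by field).
have e4 := bernoulli_seqS (b := 0) e3.
have {e3}e4 := e4 ltac:(rewrite !big_ord_recl big_ord0 /= /bump /= bin0 bin1
  (_ : 'C(4, 2) = 6)%N //; by field).
have e5 := bernoulli_seqS (b := - 1 / 30%:R) e4.
have {e4}e5 := e5 ltac:(rewrite !big_ord_recl big_ord0 /= /bump /= bin0 bin1
  (_ : 'C(5, 2) = 10)%N // !mulr0; by field).
exact: e5.
Qed.
Lemma bernoulli_seq7 : bernoulli_seq 7 =
  [:: 1; - 1 / 2%:R; 1 / 6%:R; 0; - 1 / 30%:R; 0; 1 / 42%:R].
Proof.
have e5 := bernoulli_seq5; have e6 := bernoulli_seqS (b := 0) e5.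
have {e5}e6 := e6 ltac:(rewrite !big_ord_recl big_ord0 /= /bump /= bin0 bin1
  (_ : 'C(6, 2) = 15)%N // (_ : 'C(6, 4) = 15)%N // !mulr0; by field).
have e7 := bernoulli_seqS (b := 1 / 42%:R) e6.
have {e6}e7 := e7 ltac:(rewrite !big_ord_recl big_ord0 /= /bump /= bin0 bin1
  (_ : 'C(7, 2) = 21)%N // (_ : 'C(7, 4) = 35)%N // !mulr0; by field).
exact: e7.
Qed.
Lemma bernoulli4 : bernoulli 4 = - 1 / 30%:R.
Proof. by rewrite /bernoulli bernoulli_seq5. Qed.
Lemma bernoulli6 : bernoulli 6 = 1 / 42%:R.
Proof. by rewrite /bernoulli bernoulli_seq7. Qed.

Lemma eisenstein_coef4 n : eisenstein_coef 4 n = (E4 n)%:~R.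
Proof.
rewrite /eisenstein_coef /E4 fpsED fpsEMnl fpsE1 /=; case: eqP => // _.
rewrite bernoulli4 add0r rmorphM /= -!pmulrn; congr (_ * _).
by field.
Qed.
Lemma eisenstein_coef6 n : eisenstein_coef 6 n = (E6 n)%:~R.
Proof.
rewrite /eisenstein_coef /E6 fpsEB fpsEMnl fpsE1 /=; case: eqP => [_|_].
  by rewrite mulr0 subr0.
rewrite bernoulli6 sub0r rmorphN rmorphM /= -!pmulrn mulNr; congr (- (_ * _)).
by field.
Qed.

(** The crude bound $\sigma_r(n)\le n^{r+1}$ made exponential through $n\le2^n$; a positive radius
    of convergence is all that is needed. *)
Lemma sigma_bound r n : (sigma r n <= (2 ^ r.+1) ^ n)%N.
Proof.
case: n => [|n]; first by rewrite /sigma big_cons big_nil exp1n.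
apply: leq_trans (_ : n.+1 ^ r.+1 <= _)%N; last first.
  by rewrite -expnM mulnC expnM leq_exp2r // ltnW // ltn_expl.
rewrite sigmaE // expnS -[X in (_ <= X * _)%N](card_ord n.+1) -sum_nat_const.
rewrite big_mkcond; apply: leq_sum => i _; case: ifP => // _.
by case: r => // r; rewrite leq_exp2r.
Qed.
End QExpansions.

Lemma homogenize (K : fieldType) (c : nat -> K) (x y z : K) n a b : y != 0 ->
  (\sum_(i < n.+1) c i * (x ^+ 3 / y) ^+ i) * (y ^+ n * x ^+ a * z ^+ b) =
  \sum_(i < n.+1) c i * (x ^+ (3 * i + a) * y ^+ (n - i) * z ^+ b).
Proof.
move=> y0; rewrite mulr_suml; apply: eq_bigr => i _.
have -> : y ^+ n = y ^+ (n - i) * y ^+ i by rewrite -exprD subnK // -ltnS.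
rewrite expr_div_n -exprM exprD; set u := y ^+ i.
have u0 : u != 0 by rewrite expf_neq0.
by field.
Qed.

(** * From functions to coefficients *)

Section CoefficientIdentity.
Variable R : realType.
Local Notation C := R[i].
Local Open Scope complex_scope.
Local Open Scope classical_set_scope.
Local Notation toC := (fps_map (intr : {rmorphism int -> C})).

Lemma eisenstein_expands k (E : fps int) (K B : R) N :
    (forall n, eisenstein_coef k n = (E n)%:~R) -> 0 <= K -> 0 < B ->
    (forall n, `|(E n)%:~R| <= K * B ^+ n) ->
  expands N (fun r => eisenstein k (tau_of r)) (toC E).
Proof.
move=> kE K0 B0 EB; apply: (@series_expands _ _ _ (B * 2%:R)^-1).
  by rewrite invr_gt0 mulr_gt0.
move=> r /andP[r0 rB]; rewrite /eisenstein.
have -> : series (qterm (fun n => ratr (eisenstein_coef k n)) (tau_of r))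
   = series (fun n => ((E n)%:~R : R)%:C * r%:C ^+ n).
  rewrite qterm_tau_of //; congr series; apply/funext => n.
  by rewrite kE ratr_int rmorph_int.
have -> : (fun n => toC E n * r%:C ^+ n) = (fun n => ((E n)%:~R : R)%:C * r%:C ^+ n).
  by apply/funext => n /=; rewrite rmorph_int.
by apply: (geometric_cvg K0 B0 EB); rewrite r0.
Qed.

Lemma E4_expands N : expands N (fun r => eisenstein 4 (tau_of r)) (toC E4).
Proof.
apply: (@eisenstein_expands _ _ 241%:R 16%:R); rewrite ?ltr0n ?ler0n //.
  exact: eisenstein_coef4.
move=> n; rewrite /E4 fpsED fpsEMnl fpsE1 /=; case: eqP => [->|_].
  by rewrite mulr0 addr0 normr1 expr0 mulr1 ler1n.
rewrite add0r -natrM rmorph_nat normr_nat -natrX -natrM ler_nat.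
by rewrite leq_mul //; have := sigma_bound 3 n.
Qed.
Lemma E6_expands N : expands N (fun r => eisenstein 6 (tau_of r)) (toC E6).
Proof.
apply: (@eisenstein_expands _ _ 505%:R 64%:R); rewrite ?ltr0n ?ler0n //.
  exact: eisenstein_coef6.
move=> n; rewrite /E6 fpsEB fpsEMnl fpsE1 /=; case: eqP => [->|_].
  by rewrite mulr0 subr0 normr1 expr0 mulr1 ler1n.
rewrite sub0r rmorphN normrN -natrM rmorph_nat normr_nat -natrX -natrM ler_nat.
by rewrite leq_mul //; have := sigma_bound 5 n.
Qed.

Lemma expands_eq N (g h : R -> C) (G H : fps C) :
  g =1 h -> G = H -> expands N g G -> expands N h H.
Proof. by move=> /funext -> ->. Qed.

Lemma Delta_expands N : expands N (fun r => Delta (tau_of r)) (toC DeltaZ).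
Proof.
have := expandsM (expandsD (expandsX 3 (E4_expands N))
   (expandsM (expandsC N (-1)) (expandsX 2 (E6_expands N))))
   (expandsC N 1728%:R^-1).
apply: expands_eq => [r|]; first by rewrite /Delta mulN1r.
have n0 : (1728%:R : fps C) 0%N != 0 by rewrite fpsE_nat pnatr_eq0.
apply: (fps_mulI n0).
have e : 1728%:R * toC DeltaZ = toC E4 ^+ 3 - toC E6 ^+ 2.
  by rewrite -(rmorph_nat toC) -rmorphM DeltaZE; ring.
have e' : 1728%:R * fpsC (1728%:R^-1 : C) = 1.
  by rewrite -(rmorph_nat (@fpsC C)) -rmorphM divff ?pnatr_eq0 // rmorph1.
have e1 : fpsC (-1 : C) = -1 by rewrite rmorphN rmorph1.
by rewrite e1; apply: (lincomb2 (c := toC E4 ^+ 3 - toC E6 ^+ 2) (c' := -1) e' e); ring.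
Qed.

Lemma coef_identity k (f : C -> C) (c : nat -> C) (P : {poly rat}) n a b :
    has_qexpansion f c -> is_P k f P -> weight_decomposition k n a b ->
  vanish n.+1 (Fps c - \sum_(i < n.+1) fpsC (ratr P`_i)
     * toC (E4 ^+ (3 * i + a) * DeltaZ ^+ (n - i) * E6 ^+ b)).
Proof.
move=> fc fP w; have [sP PE] := fP _ _ _ w.
pose g i (r : R) := ratr P`_i * (eisenstein 4 (tau_of r) ^+ (3 * i + a)
   * Delta (tau_of r) ^+ (n - i) * eisenstein 6 (tau_of r) ^+ b).
have eg i : expands n.+1 (g i) (fpsC (ratr P`_i)
     * toC (E4 ^+ (3 * i + a) * DeltaZ ^+ (n - i) * E6 ^+ b)).
  have := expandsM (expandsC n.+1 (ratr P`_i)) (expandsM (expandsM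
    (expandsX (3 * i + a) (E4_expands n.+1))
    (expandsX (n - i) (Delta_expands n.+1))) (expandsX b (E6_expands n.+1))).
  by apply: expands_eq => //; rewrite !rmorphM !rmorphXn.
have ef : expands n.+1 (fun r => f (tau_of r)) (Fps c).
  apply: (@series_expands _ _ _ 1) => // r r01.
  have /andP[r0 _] := r01.
  by rewrite -(qterm_tau_of _ r0); apply: fc; apply: tau_ofP.
(* $E_4$, $E_6$ and $\Delta$ have leading coefficient 1, at orders 0, 0 and 1. So near $q=0$ the
   denominator in [is_P] is non-zero and its identity is available. *)
have lead (h : R -> C) (H : fps int) m : (forall N, expands N h (toC H)) ->
    vanish m H -> H m != 0 -> exists2 d : R, 0 < d & forall r, 0 < r < d -> h r != 0.
  move=> hH vH Hm; apply: (expands_lead (hH m.+1)) => [i im|].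
    by rewrite /= vH // rmorph0.
  by rewrite /= intr_eq0.
have [d4 d40 h4] := lead _ _ 0%N E4_expands (fun i (h : (i < 0)%N) => ltac:(by [])) (ltac:(by rewrite E4_0)).
have [d6 d60 h6] := lead _ _ 0%N E6_expands (fun i (h : (i < 0)%N) => ltac:(by [])) (ltac:(by rewrite E6_0)).
have v1 : vanish 1 DeltaZ by case=> // _; exact: DeltaZ_0.
have [dD dD0 hD] := lead _ _ 1%N Delta_expands v1 (ltac:(by rewrite DeltaZ_1)).
pose d := Num.min (Num.min d4 d6) (Num.min dD 1).
have d0 : 0 < d by rewrite /d !lt_min d40 d60 dD0 ltr01.
apply: (@expands_eq0 _ _ (fun r => f (tau_of r) + (-1) * \sum_(i < n.+1) g i r) _ d) => //; last first.
  have := expandsD ef (expandsM (expandsC n.+1 (-1)) (expands_sum (fun i (_ : (i < n.+1)%N) => eg i))).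
  by apply: expands_eq => //; rewrite rmorphN rmorph1 mulN1r.
move=> r /andP[r0]; rewrite /d !lt_min => /andP[/andP[r4 r6] /andP[rD r1]].
have {}h4 := h4 r; rewrite r0 r4 in h4; have {}h4 := h4 isT.
have {}h6 := h6 r; rewrite r0 r6 in h6; have {}h6 := h6 isT.
have {}hD := hD r; rewrite r0 rD in hD; have {}hD := hD isT.
have ur : upper_half_plane (tau_of r) by apply: tau_ofP; rewrite r0.
have den0 := mulf_neq0 (mulf_neq0 (expf_neq0 n hD) (expf_neq0 a h4)) (expf_neq0 b h6).
have fE := PE _ ur den0; move/(canRL (divfK den0)): fE => ->.
rewrite (@horner_coef_wide _ n.+1); last by rewrite size_map_poly.
under eq_bigr => i _ do rewrite coef_map.
have := @homogenize C (fun i => ratr P`_i) (eisenstein 4 (tau_of r))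
  (Delta (tau_of r)) (eisenstein 6 (tau_of r)) n a b hD.
rewrite -/(klein_j (tau_of r)) => ->.
by rewrite mulN1r subrr.
Qed.
End CoefficientIdentity.

(** * Comparison of coefficients *)

Section Triangular.
Variables (K : comNzRingType) (n : nat) (G : nat -> fps K).
Hypothesis vG : forall i, (i <= n)%N -> vanish (n - i) (G i).
Hypothesis lG : forall i, (i <= n)%N -> G i (n - i)%N = 1.

(** The coefficient of $Q^m$ is $d_{n-m}$ plus a combination of the $d_{n-m'}$ with $m'<m$, which
    are already zero. *)
Lemma triangular_uniq (d : nat -> K) :
    vanish n.+1 (\sum_(i < n.+1) fpsC (d i) * G i) ->
  forall i, (i <= n)%N -> d i = 0.
Proof.
move=> h i iN; rewrite -(subKn iN); have := leq_subr i n.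
move: (n - i)%N => m {i iN}; elim/ltn_ind: m => m ih mn.
have := h m mn; rewrite fpsE_sum.
have kn : (n - m < n.+1)%N by rewrite ltnS leq_subr.
rewrite (bigD1 (Ordinal kn)) // fpsE_CM -[nat_of_ord _]/(n - m)%N big1.
  rewrite -[X in X = 0 -> _]/(d (n - m)%N * G (n - m)%N m + 0) addr0.
  by have := lG (leq_subr m n); rewrite subKn // => ->; rewrite mulr1.
move=> i /andP[_ im]; rewrite fpsE_CM; have {}im : (i : nat) != (n - m)%N := im.
have iN : (i <= n)%N by rewrite -ltnS.
case: (ltngtP (n - i)%N m) => [lt|gt|e].
- by rewrite -(subKn iN) (ih _ lt (leq_subr _ _)) mul0r.
- by rewrite (vG iN gt) mulr0.
by rewrite -e subKn // eqxx in im.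
Qed.

Lemma triangular_inj (d e : nat -> K) :
    vanish n.+1 (\sum_(i < n.+1) fpsC (d i) * G i - \sum_(i < n.+1) fpsC (e i) * G i) ->
  forall i, (i <= n)%N -> d i = e i.
Proof.
move=> h i iN; apply/eqP; rewrite -subr_eq0; apply/eqP.
apply: (triangular_uniq (d := fun i => d i - e i)) iN.
apply: vanish_eq h; rewrite -sumrB; apply: eq_bigr => j _.
by rewrite rmorphB mulrBl.
Qed.

(** The coefficient of $Q^N$ fixes $d_{n-N}$. The leading coefficients are 1, so no division occurs,
    and over [int] the solution is integral. *)
Lemma triangular_exists (t : fps K) :
  exists d : nat -> K, vanish n.+1 (t - \sum_(i < n.+1) fpsC (d i) * G i).
Proof.
suff : forall N, (N <= n.+1)%N ->
    exists d : nat -> K, vanish N (t - \sum_(i < n.+1) fpsC (d i) * G i) by apply.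
elim=> [|N ih] Nn; first by exists (fun=> 0).
have [d h] := ih (ltnW Nn); set e := (t - \sum_(i < n.+1) fpsC (d i) * G i) N.
exists (fun i => d i + (if i == (n - N)%N then e else 0)).
have kn : (n - N < n.+1)%N by rewrite ltnS leq_subr.
have -> : t - \sum_(i < n.+1) fpsC (d i + (if (i : nat) == (n - N)%N then e else 0)) * G i
  = t - \sum_(i < n.+1) fpsC (d i) * G i - fpsC e * G (n - N)%N.
  rewrite -addrA -opprD; congr (_ - _).
  rewrite (bigD1 (Ordinal kn)) //= [in RHS](bigD1 (Ordinal kn)) //= eqxx.
  rewrite rmorphD /= mulrDl addrAC; congr (_ + _ + _).
  apply: eq_bigr => i; rewrite -val_eqE /= => /negPf ->.
  by rewrite addr0.
move=> i; rewrite ltnS leq_eqVlt fpsEB fpsE_CM => /predU1P[->|iN].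
  by have := lG (leq_subr N n); rewrite subKn // => ->; rewrite mulr1 subrr.
by rewrite (h _ iN) (vG (leq_subr N n)) ?subKn // mulr0 subr0.
Qed.
End Triangular.

Lemma fps_map_comb (K : comNzRingType) (f : {rmorphism int -> K}) n
    (G : nat -> fps int) (w : nat -> int) (t : fps int) :
  fps_map f (t - \sum_(i < n.+1) fpsC (w i) * G i)
  = fps_map f t - \sum_(i < n.+1) fpsC (f (w i)) * fps_map f (G i).
Proof.
rewrite rmorphB rmorph_sum; congr (_ - _); apply: eq_bigr => i _.
rewrite rmorphM; congr (_ * _); apply: fpsP => j.
by rewrite fpsE_map !fpsE_C; case: ifP => // _; rewrite rmorph0.
Qed.

Lemma fpsM_lead (K : comNzRingType) M N (x y : fps K) :
  vanish M x -> vanish N y -> (x * y) (M + N)%N = x M * y N.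
Proof.
move=> hx hy; rewrite fpsEM.
have k : (M < (M + N).+1)%N by rewrite ltnS leq_addr.
rewrite (bigD1 (Ordinal k)) // -[nat_of_ord _]/M addKn big1 => [|i].
  by rewrite -[LHS]/(x M * y N + 0) addr0.
rewrite -val_eqE -[val (Ordinal k)]/M -[val i]/(nat_of_ord i);
  case: ltngtP => // [iM|Mi] _; first by rewrite hx ?mul0r.
by rewrite hy ?mulr0 //; have := ltn_ord i; lia.
Qed.

Lemma fpsX_lead (K : comNzRingType) (x : fps K) m :
  vanish 1 x -> x 1%N = 1 -> vanish m (x ^+ m) /\ (x ^+ m) m = 1.
Proof.
move=> v1 x1; have v k : vanish k (x ^+ k).
  by rewrite -[X in vanish X _]muln1; apply: vanishX.
split=> //; elim: m => [|m ih]; first by rewrite expr0 fpsE1.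
by rewrite exprS -add1n (fpsM_lead v1 (v m)) x1 ih mul1r.
Qed.

(** With $x=E_4^3$ and $y=\Delta$ this writes [modp_form] in the triangular basis, with the
    coefficients of $\prod_j(X-j)$. *)
Lemma homog_prod (K : comNzRingType) (s : seq K) (x y : fps K) :
  \prod_(c <- s) (x - fpsC c * y) =
  \sum_(i < (size s).+1)
    fpsC ((\prod_(c <- s) ('X - c%:P))`_i) * (x ^+ i * y ^+ (size s - i)).
Proof.
elim: s => [|c s ih].
  by rewrite !big_nil big_ord1 coef1 rmorph1 !expr0 !mulr1.
rewrite !big_cons ih; set p := \prod_(c <- s) _; set n := size s.
have pn : p`_n.+1 = 0 by apply: nth_default; rewrite /p size_prod_XsubC.
under [RHS]eq_bigr => i _ do rewrite mulrBl coefB rmorphB mulrBl coefCM.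
rewrite sumrB mulrBl; congr (_ - _).
  rewrite [RHS]big_ord_recl coefXM /= rmorph0 mul0r add0r mulr_sumr.
  apply: eq_bigr => i _; rewrite coefXM /= /bump /= add1n subSS exprS; ring.
rewrite [RHS]big_ord_recr /= pn mulr0 rmorph0 mul0r addr0 mulr_sumr.
apply: eq_bigr => i _; have iN : (i <= n)%N by rewrite -ltnS.
by rewrite subSn // exprS rmorphM /=; ring.
Qed.

Lemma rmorph_monomial (K L : comNzRingType) (g : {rmorphism K -> L}) (x y z : K) i a m b :
  g (x ^+ (3 * i + a) * y ^+ m * z ^+ b)
  = (g x ^+ 3) ^+ i * g x ^+ a * g y ^+ m * g z ^+ b.
Proof. by rewrite !rmorphM !rmorphXn exprD exprM. Qed.

Section Final.
Variables (n : nat) (a b : bool).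
Definition monomial i : fps int := E4 ^+ (3 * i + a) * DeltaZ ^+ (n - i) * E6 ^+ b.

Lemma monomialP i : vanish (n - i) (monomial i) /\ monomial i (n - i)%N = 1.
Proof.
have v1 : vanish 1 DeltaZ by case=> // _; exact: DeltaZ_0.
have [vD lD] := fpsX_lead (n - i) v1 DeltaZ_1.
split; first by apply: vanishMr; apply: vanishMl.
have v0 : vanish 0 (E4 ^+ (3 * i + a) * E6 ^+ b) by move=> j; rewrite ltn0.
have := fpsM_lead v0 vD; rewrite add0n mulrAC => ->.
by rewrite lD fpsEM0 !fpsEX0 E4_0 E6_0 !expr1n !mulr1.
Qed.
End Final.

Lemma weight_decompositionP p r n (a b : bool) : p = (4 * r + 3)%N ->
  r.+1 = (6 * n + 2 * a + 3 * b)%N -> weight_decomposition (p.+1)./2 n a b.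
Proof. by move=> -> h; split; case: a b h => [] []; lia. Qed.

Theorem theorem1p8 (R : realType) (p : nat) (p_prime : prime p)
  (p_ge7 : (7 <= p)%N) (p_mod4 : p = 3 %[mod 4])
  (Fpbar : closedFieldType) (iota : {rmorphism 'F_p -> Fpbar})
  (Fpbar_algebraic : integralRange iota)
  (f : R[i] -> R[i])
  (hf : is_C (p.+1)./2 (fun n => (theta_coef n)%:R) f)
  (P : {poly rat}) (hP : is_P (p.+1)./2 f P)
  (S : {set weierstrass 'F_p})
  (hS : is_transversal S
          (equivalence_partition (isomorphic_over iota) (admissible 'F_p))
          (admissible 'F_p)) :
  exists2 Pint : {poly int},
    P = map_poly intr Pint &
    map_poly intr Pint = \prod_(E in S) ('X - (j_invariant E)%:P) :> {poly 'F_p}.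
Proof.
pose r := (p %/ 4)%N.
have pE : p = (4 * r + 3)%N by rewrite {1}(divn_eq p 4) p_mod4 mulnC.
have cF : #|'F_p| = (4 * r + 3)%N by rewrite card_Fp.
have neq0 k : (0 < k < p)%N -> k%:R != 0 :> 'F_p.
  case/andP=> k0 kp; rewrite -(dvdn_pcharf (pchar_Fp p_prime)).
  by rewrite gtnNdvd.
have two0 : 2%:R != 0 :> 'F_p by apply: neq0; lia.
have three0 : 3%:R != 0 :> 'F_p by apply: neq0; lia.
have chF : (4 * r + 3)%N \in [pchar 'F_p] by rewrite -pE; apply: pchar_Fp.
pose J := Jset 'F_p r; pose n := #|J|.
pose a := eps r (0 : 'F_p); pose b := eps r (1728%:R : 'F_p).
have cJ := card_Jset cF two0 three0; rewrite -/J -/n -/a -/b in cJ.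
have wd := weight_decompositionP pE cJ.
have [_ [c fc ct]] := hf; have {}ct := ct _ _ _ wd.
pose G := monomial n a b; have GP i := monomialP n a b i; rewrite -/G in GP.
have vG i (_ : (i <= n)%N) := (GP i).1; have lG i (_ : (i <= n)%N) := (GP i).2.
(* [w] solves the system for theta over the integers. Its image in [R[i]] is compared with the
   coefficients of [P], and its image in ['F_p] with those of the product; uniqueness applies in
   both. *)
have [w hw] := triangular_exists vG lG (theta int).
pose toC := fps_map (intr : {rmorphism int -> R[i]}).
pose toF := fps_map (intr : {rmorphism int -> 'F_p}).
have vK (K : comNzRingType) (g : {rmorphism int -> K}) i :
    (i <= n)%N -> vanish (n - i) (fps_map g (G i)).
  by move=> iN; apply: fps_map_vanish; apply: vG.
have lK (K : comNzRingType) (g : {rmorphism int -> K}) i :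
    (i <= n)%N -> fps_map g (G i) (n - i)%N = 1.
  by move=> iN; rewrite fpsE_map (lG i iN) rmorph1.
have wC := fps_map_vanish (intr : {rmorphism int -> R[i]}) hw.
have wF := fps_map_vanish (intr : {rmorphism int -> 'F_p}) hw.
rewrite fps_map_comb in wC; rewrite fps_map_comb in wF.
have Pw i : (i <= n)%N -> P`_i = (w i)%:~R.
  move=> iN; apply: (fmorph_inj (ratr : {rmorphism rat -> R[i]})).
  rewrite [RHS]ratr_int; move: i iN.
  apply: (triangular_inj (vK _ (intr : {rmorphism int -> R[i]}))
    (lK _ (intr : {rmorphism int -> R[i]}))).
  have h1 := coef_identity fc hP wd.
  have h2 : vanish n.+1 (Fps c - toC (theta int)).
    by move=> i iN; rewrite fpsEB fpsE_map -[Fps c i]/(c i) (ct i iN) rmorph_nat subrr.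
  apply: vanish_eq (vanishD (vanishB h2 h1) wC).
  rewrite /toC; move: (Fps c) (fps_map _ _) (\sum_(i < n.+1) _) (\sum_(i < n.+1) _) => x y u v.
  ring.
exists (\poly_(i < n.+1) w i).
  have [sP _] := hP _ _ _ wd.
  apply/polyP => i; rewrite coef_map coef_poly; case: ltnP => [iN|iN].
    exact: Pw.
  by rewrite nth_default ?rmorph0 // (leq_trans sP).
rewrite (transversal_prod cF two0 three0 hS) -/J.
have gE i : toF (G i) = (toF E4 ^+ 3) ^+ i * toF E4 ^+ a * toF DeltaZ ^+ (n - i)
    * toF E6 ^+ b.
  exact: (@rmorph_monomial _ _ (fps_map (intr : {rmorphism int -> 'F_p}))
    E4 DeltaZ E6 i a (n - i) b).
have mE : modp_form 'F_p r
  = \sum_(i < n.+1) fpsC (\prod_(j in J) ('X - j%:P))`_i * toF (G i).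
  rewrite /modp_form -/J -/a -/b -big_enum homog_prod -cardE -/n !mulr_suml.
  rewrite big_enum; apply: eq_bigr => i _.
  rewrite gE /toF.
  move: (fpsC _) ((_ ^+ 3) ^+ i) (_ ^+ a) (_ ^+ (n - i)) (_ ^+ b) => u x y z v.
  ring.
(* In $\mathbb{F}_p$ both coefficient families represent theta modulo $q^{n+1}$ in the same
   monomials. *)
have Jw i : (i <= n)%N -> (\prod_(j in J) ('X - j%:P))`_i = (w i)%:~R.
  move: i; apply: (triangular_inj (vK _ (intr : {rmorphism int -> 'F_p}))
    (lK _ (intr : {rmorphism int -> 'F_p}))).
  have h := modp_form_theta cF two0 three0 chF.
  rewrite mE in h; apply: vanish_eq (vanishD h wF).
  by rewrite addrA subrK.
apply/polyP => i; rewrite coef_map coef_poly; case: ltnP => [iN|iN].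
  exact/esym/Jw.
rewrite /= mulr0z nth_default // -big_enum size_prod_XsubC -cardE.
exact: iN.
Qed.
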